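(* Let $d\in\mathbb{N}$ ($d\geq 1$) and $0<\alpha<1$, and let $(-\Delta)^\alpha(n,m)=\langle\delta_n,(-\Delta)^\alpha\delta_m\rangle$, $n,m\in\mathbb{Z}^d$, denote the matrix elements of the discrete fractional Laplacian on $\ell^2(\mathbb{Z}^d)$. Then: (i) For all $n,m\in\mathbb{Z}^d$ with $n\neq m$, $(-\Delta)^\alpha(n,m)<0$; and $(-\Delta)^\alpha(n,n)>0$ for all $n\in\mathbb{Z}^d$. (ii) The limit $$\lim_{|n-m|\to\infty}|n-m|^{d+2\alpha}\big(-(-\Delta)^\alpha(n,m)\big)=K_{d,\alpha}$$ exists, with $$K_{d,\alpha}=\frac{4^\alpha\,\Gamma(d/2+\alpha)}{\pi^{d/2}\,|\Gamma(-\alpha)|}>0.$$ (iii) There exist constants $c_{d,\alpha},C_{d,\alpha}>0$ depending only on $d$ and $\alpha$ such that for all $n,m\in\mathbb{Z}^d$ with $n\neq m$ $$\frac{c_{d,\alpha}}{|n-m|^{d+2\alpha}}\leq-(-\Delta)^\alpha(n,m)\leq\frac{C_{d,\alpha}}{|n-m|^{d+2\alpha}}.$$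
   Context: The discrete Laplacian is given by $(-\Delta\varphi)(n)=\sum_{m\in\mathbb{Z}^d,\,|n-m|_1=1}(\varphi(n)-\varphi(m))$ for $\varphi\in\ell^2(\mathbb{Z}^d)$, $n\in\mathbb{Z}^d$, where $|x|_1=\sum_i|x_i|$; it is a bounded non-negative self-adjoint operator on $\ell^2(\mathbb{Z}^d)$, and $(-\Delta)^\alpha$ is defined by the functional calculus. $(\delta_n)_{n\in\mathbb{Z}^d}$ is the canonical orthonormal basis of $\ell^2(\mathbb{Z}^d)$, $|\cdot|$ is the Euclidean norm, and $\Gamma$ is the Gamma function. *)

(* Defs.v *)
From HB Require Import structures.
From mathcomp Require Import all_boot all_order all_algebra finmap.
From mathcomp Require Import all_classical all_reals all_analysis.
From mathcomp Require Import complex ring zify.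
From mathcomp.analysis.showcase Require summability.

Set Implicit Arguments.
Unset Strict Implicit.
Unset Printing Implicit Defensive.

Import Order.TTheory GRing.Theory Num.Theory.
Import numFieldNormedType.Exports.

Local Open Scope classical_set_scope.
Local Open Scope ring_scope.
Local Open Scope complex_scope.

Notation "''Z^' d" := 'rV[int]_d (at level 8, d at level 2, format "''Z^' d") : type_scope.

Definition norm1 (d : nat) (x : 'Z^d) : int := \sum_(i < d) `|x 0 i|.

Definition euclid (R : realType) (d : nat) (x : 'Z^d) : R :=
  Num.sqrt (\sum_(i < d) ((x 0 i)%:~R) ^+ 2).

Section SquareSummable.
Variables (R : realType) (d : nat).

Definition sqr_summable (phi : 'Z^d -> R[i]^o) : Prop :=
  (\esum_(n in [set: 'Z^d]) ((Normc.normc (phi n)) ^+ 2)%:E < +oo)%E.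

Definition l2_pred : {pred 'Z^d -> R[i]^o} := mem [set phi | sqr_summable phi].

Lemma l2_predP phi : reflect (sqr_summable phi) (phi \in l2_pred).
Proof. by apply: (iffP idP); rewrite inE. Qed.

Lemma sqr_summableZ (c : R[i]) phi :
  sqr_summable phi -> sqr_summable (c *: phi).
Proof.
rewrite /sqr_summable => sphi.
apply: (@le_lt_trans _ _ ((Normc.normc c ^+ 2)%:E *
    \esum_(n in [set: 'Z^d]) ((Normc.normc (phi n)) ^+ 2)%:E)%E); last first.
  by rewrite lte_mul_pinfty// lee_fin sqr_ge0.
apply: ge_ereal_sup => _ [X XT <-].
have -> : (\sum_(n \in X) (Normc.normc ((c *: phi) n) ^+ 2)%:E =
    (Normc.normc c ^+ 2)%:E *
    \sum_(n \in X) (Normc.normc (phi n) ^+ 2)%:E)%E.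
  rewrite ge0_mule_fsumr; last by move=> n; rewrite lee_fin sqr_ge0.
  by apply: eq_fsbigr => n _; rewrite -EFinM -exprMn -Normc.normcM.
apply: lee_wpmul2l; first by rewrite lee_fin sqr_ge0.
by apply: esum_ge; exists X.
Qed.

Lemma sqr_summableD phi psi :
  sqr_summable phi -> sqr_summable psi -> sqr_summable (phi + psi).
Proof.
move=> /(sqr_summableZ 2) sphi /(sqr_summableZ 2) spsi.
have := lte_add_pinfty sphi spsi; rewrite -esumD; last first.
- by move=> n _; rewrite lee_fin sqr_ge0.
- by move=> n _; rewrite lee_fin sqr_ge0.
apply: le_lt_trans; apply: le_esum => n _; rewrite -EFinD lee_fin.
rewrite !Normc.normcM.
set a := Normc.normc (phi n); set b := Normc.normc (psi n).
have a0 : 0 <= a by rewrite /a; case: (phi n) => x y /=; rewrite sqrtr_ge0.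
have b0 : 0 <= b by rewrite /b; case: (psi n) => x y /=; rewrite sqrtr_ge0.
have -> : Normc.normc (2 : R[i]) = 2.
  by rewrite (normcMn (1 : R[i])) Normc.normc1.
have : Normc.normc ((phi + psi) n) <= a + b by exact: le_normcD.
have : 0 <= Normc.normc ((phi + psi) n).
  by case: ((phi + psi) n) => x y /=; rewrite sqrtr_ge0.
move: (Normc.normc _) => c c0 cab.
apply: (@le_trans _ _ ((a + b) ^+ 2)); first by rewrite lerXn2r// nnegrE addr_ge0.
rewrite -subr_ge0.
have -> : (2 * a) ^+ 2 + (2 * b) ^+ 2 - (a + b) ^+ 2 =
   2 * (a ^+ 2 + b ^+ 2) + (a - b) ^+ 2 by ring.
apply: addr_ge0; last exact: sqr_ge0.
by apply: mulr_ge0 => //; apply: addr_ge0; exact: sqr_ge0.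
Qed.

Lemma l2_submod_closed : submod_closed l2_pred.
Proof.
split=> [|c phi psi /l2_predP sphi /l2_predP spsi]; apply/l2_predP.
  rewrite /sqr_summable esum1 ?ltry// => n _.
  by rewrite Normc.normc0 expr0n.
by apply: sqr_summableD => //; exact: sqr_summableZ.
Qed.

HB.instance Definition _ :=
  GRing.isSubmodClosed.Build R[i] ('Z^d -> R[i]^o) l2_pred l2_submod_closed.

Record l2 : Type := L2 {
  l2_fun :> 'Z^d -> R[i]^o;
  l2_funP : l2_fun \in l2_pred }.

HB.instance Definition _ := [isSub for l2_fun].
HB.instance Definition _ := [Choice of l2 by <:].
HB.instance Definition _ := [SubChoice_isSubLmodule of l2 by <:].

Lemma sqr_summable_shift phi (v : 'Z^d) :
  sqr_summable phi -> sqr_summable (fun n => phi (n - v)).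
Proof.
rewrite /sqr_summable; congr (_ < _)%E; apply: reindex_esum.
split=> //; first by move=> x y _ _; exact: addIr.
by move=> x _; exists (x + v) => //; rewrite addrK.
Qed.

End SquareSummable.

Arguments l2 : clear implicits.

Section Laplacian.
Variables (R : realType) (d : nat).

Definition neg_laplacian_fun (phi : 'Z^d -> R[i]^o) : 'Z^d -> R[i]^o :=
  fun n => \sum_(m \in [set m | norm1 (n - m) = 1]) (phi n - phi m).

Lemma finite_norm1_sphere : finite_set [set v : 'Z^d | norm1 v = 1].
Proof.
pose g (f : {ffun 'I_d -> 'I_3}) : 'Z^d := \row_i ((f i : nat)%:Z - 1).
apply: (@sub_finite_set _ _ (g @` setT)); last first.
  by apply: finite_image; exact: finite_finset.
move=> v /= v1.
have vle i : `|v 0 i| <= 1.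
  rewrite -v1 /norm1 (bigD1 i)//= lerDl.
  by apply: sumr_ge0 => j _; exact: normr_ge0.
have vlt i : (absz (v 0%R i + 1)%R < 3)%N by move: (vle i); lia.
exists [ffun i => Ordinal (vlt i)] => //.
apply/rowP => i; rewrite mxE ffunE /=; move: (vle i); lia.
Qed.

Lemma neg_laplacian_funE phi : neg_laplacian_fun phi =
  \sum_(v <- fset_set [set v : 'Z^d | norm1 v = 1])
    (phi - (fun n => phi (n - v))).
Proof.
apply/funext => n; rewrite fct_sumE /neg_laplacian_fun.
rewrite -fsbig_finite; last exact: finite_norm1_sphere.
rewrite (reindex_fsbig (fun v => n - v) [set v : 'Z^d | norm1 v = 1])//.
split=> [v /=|v w _ _ /addrI/oppr_inj//|m /= nm1].
- by rewrite opprB addrC subrK.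
- by exists (n - m) => //; rewrite opprB addrC subrK.
Qed.

Lemma neg_laplacian_fun_l2 (phi : l2 R d) :
  neg_laplacian_fun phi \in @l2_pred R d.
Proof.
rewrite neg_laplacian_funE; apply: rpred_sum => v _.
apply: rpredB; first exact: l2_funP.
by apply/l2_predP/sqr_summable_shift/l2_predP; exact: l2_funP.
Qed.

Definition neg_laplacian (phi : l2 R d) : l2 R d :=
  L2 (neg_laplacian_fun_l2 phi).

Definition delta_fun (n : 'Z^d) : 'Z^d -> R[i]^o := fun m => (m == n)%:R.

Lemma delta_fun_l2 n : delta_fun n \in @l2_pred R d.
Proof.
apply/l2_predP; rewrite /sqr_summable (esumID [set n]) //; last first.
  by move=> m _; rewrite lee_fin sqr_ge0.
rewrite setTI esum_set1 ?lee_fin ?sqr_ge0// setTI esum1 ?adde0 ?ltry//.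
by move=> m /= /eqP mn; rewrite /delta_fun (negbTE mn) Normc.normc0 expr0n.
Qed.

Definition delta (n : 'Z^d) : l2 R d := L2 (delta_fun_l2 n).

End Laplacian.

Arguments neg_laplacian : clear implicits.
Arguments delta : clear implicits.

Section FunctionalCalculus.
Variables (R : realType) (d : nat).
Local Notation H := (l2 R d).

(* The unordered sum, i.e. the limit of the finite partial sums along the
   inclusion of finite subsets of Z^d. *)
Definition inner (phi psi : H) : R[i] :=
  summability.sum (fun n : 'Z^d => ((phi n)^* * psi n : R[i]^o)).

Definition l2norm (phi : H) : R :=
  Num.sqrt (fine (\esum_(n in [set: 'Z^d]) ((Normc.normc (phi n)) ^+ 2)%:E)).

Definition bounded_linear (T : H -> H) : Prop :=
  linear T /\ exists M : R, forall phi, l2norm (T phi) <= M * l2norm phi.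

Definition spectrum (A : H -> H) : set R[i] :=
  [set z | ~ exists B : H -> H, bounded_linear B /\
     (forall phi, B (A phi - z *: phi) = phi) /\
     (forall phi, A (B phi) - z *: B phi = phi)].

Definition poly_op (p : {poly R}) (A : H -> H) (phi : H) : H :=
  \sum_(i < size p) (p`_i)%:C *: iter i A phi.

(* For a bounded self-adjoint A, the spectrum of A is real and f(A) is the
   limit in operator norm of p_k(A) for any real polynomials p_k converging to
   f uniformly on the spectrum; such p_k exist when f is continuous. *)
Definition is_fun_calc (A : H -> H) (f : R -> R) (T : H -> H) : Prop :=
  bounded_linear T /\
  forall p : nat -> {poly R},
    {uniform [set x : R | spectrum A x%:C],
       (fun k x => (p k).[x]) @ \oo --> f} ->
    forall e : R, 0 < e -> \forall k \near \oo, forall phi : H,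
      l2norm (poly_op (p k) A phi - T phi) <= e * l2norm phi.

(* The value is meaningful only where such a T exists and is unique, as it
   does for A bounded self-adjoint and f continuous. *)
Definition fun_calc (A : H -> H) (f : R -> R) : H -> H :=
  xget (fun=> 0) [set T | is_fun_calc A f T].

Definition frac_laplacian (alpha : R) : H -> H :=
  fun_calc (neg_laplacian R d) (fun x => x `^ alpha).

Definition frac_laplacian_mx (alpha : R) (n m : 'Z^d) : R[i] :=
  inner (delta R d n) (frac_laplacian alpha (delta R d m)).

End FunctionalCalculus.

(* |n - m| -> oo, as a filter on pairs (n, m). *)
Definition dist_infty (R : realType) (d : nat) : set_system ('Z^d * 'Z^d) :=
  filter_from [set: R]
    (fun r => [set nm | r < euclid R (nm.1 - nm.2)]).

Arguments dist_infty : clear implicits.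

Definition Gamma_integral (R : realType) (x : R) : R :=
  \int[lebesgue_measure]_(t in `]0, +oo[) (t `^ (x - 1) * expR (- t)).

(* Gamma on the real line away from the non-positive integers: Euler's integral
   for x > 0, extended by Gamma(x) = Gamma(x + k) / (x (x + 1) ... (x + k - 1))
   to x <= 0, where k is the least natural number with x + k > 0. *)
Definition Gamma (R : realType) (x : R) : R :=
  let k := Num.truncn (1 - x) in
  Gamma_integral (x + k%:R) / \prod_(i < k) (x + i%:R).

Definition Kconst (R : realType) (d : nat) (alpha : R) : R :=
  4 `^ alpha * Gamma (d%:R / 2 + alpha) /
  (pi `^ (d%:R / 2) * `|Gamma (- alpha)|).

(* Main.v *)
(* Write A = -Delta.  The operator 3d - A has matrix entries >= 0 (it counts
   lattice walks with steps 0, e_i and -e_i), spectrum in [-d, 3d], and powers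
   x^alpha are expanded around 3d: with c = int_0^oo (1 - e^-t) t^(-alpha-1) dt,
     c x^alpha = int_0^oo (1 - e^(-x t)) t^(-alpha-1) dt,
   and e^(-x t) = e^(-3dt) e^((3d-x)t) gives a power series in 3d - x with
   absolutely summable coefficients on [0, 6d], all negative except the constant
   one.  It converges in operator norm to A^alpha, so for n <> m
     - A^alpha(n, m) = c^-1 int_0^oo Q_t(n - m) t^(-alpha-1) dt,
   where Q_t is the heat kernel, a product of one-dimensional kernels.
   Substituting t = r^2 / (4u), r = |n - m|, turns r^(d+2alpha) times the right
   side into (4^alpha / c) int_0^oo r^d Q_(r^2/4u)(n - m) u^(alpha-1) du.  By the
   local limit theorem the integrand tends to
   pi^(-d/2) u^(d/2+alpha-1) e^-u, and the bounds Q_t <= C t^(-d/2) and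
   Q_t(v) <= C t |v|^(-d-2) dominate it; this gives Gamma(d/2+alpha), while
   c = |Gamma(-alpha)|. *)

Require Import Defs.
From mathcomp Require Import all_boot all_order all_algebra finmap.
From mathcomp Require Import all_classical all_reals all_analysis.
From mathcomp Require Import measurable_realfun complex ring lra zify.

Set Implicit Arguments.
Unset Strict Implicit.
Unset Printing Implicit Defensive.

Import Order.TTheory GRing.Theory Num.Theory.
Import numFieldNormedType.Exports.

Local Open Scope classical_set_scope.
Local Open Scope ring_scope.
Local Open Scope complex_scope.

Arguments l2_fun : simpl never.

(** The walk is lazy for the sake of monotonicity. The counts of the simple walk vanish at the wrong
    parity, so they do not decrease in |k|. With the hold step they do, and then a bound on a
    weighted sum of counts over 0, ..., k bounds the count at k. All decay in |v| comes from this.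
    The cosine integral provides only the uniform bound t^(-1/2) and the local limit. The power d +
    2 in Q_t(v) <= C t |v|^(-d-2) is dictated by the substitution: at t = r^2/(4u) it leaves C/u
    without any power of r, so the rescaled integrand is O(u^(alpha-2)) at infinity, uniformly in v.
    The factor t is there because a walk needs a step to reach v <> 0. The functional calculus is
    characterised through polynomials that converge on the spectrum, so identifying A^alpha requires
    locating that spectrum. Its real points must lie in [0, 6d], where the partial sums of the
    series converge uniformly. It must contain [0, 4d], where the norm bound evaluates an arbitrary
    approximating sequence. *)

Lemma sum_seq2 (V : nmodType) (I : Type) (F : I -> V) a b :
  \sum_(i <- [:: a; b]) F i = F a + F b.
Proof. by rewrite !big_cons big_nil addr0. Qed.

Lemma sum_seq3 (V : nmodType) (I : Type) (F : I -> V) a b c :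
  \sum_(i <- [:: a; b; c]) F i = F a + (F b + F c).
Proof. by rewrite big_cons sum_seq2. Qed.

(** * Square-summable functions *)

Section SquareNorm.
Context {R : realType} {d : nat}.
Local Notation H := (l2 R d).
Implicit Types (phi psi : H) (n : 'Z^d) (z : R[i]).

Definition sqnormc (z : R[i]) : R := complex.Re z ^+ 2 + complex.Im z ^+ 2.

Lemma sqnormcE z : Normc.normc z ^+ 2 = sqnormc z.
Proof. by case: z => x y; rewrite /= sqr_sqrtr ?addr_ge0 ?sqr_ge0. Qed.

Lemma sqnormc_ge0 z : 0 <= sqnormc z.
Proof. by rewrite addr_ge0 ?sqr_ge0. Qed.

Lemma sqnormc_eq0 z : (sqnormc z == 0) = (z == 0).
Proof.
case: z => x y; rewrite /sqnormc /= paddr_eq0 ?sqr_ge0// !sqrf_eq0.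
by rewrite eq_complex.
Qed.

Lemma l2D phi psi n : (phi + psi : H) n = phi n + psi n.
Proof. by []. Qed.
Lemma l2B phi psi n : (phi - psi : H) n = phi n - psi n.
Proof. by []. Qed.
Lemma l2Z (c : R[i]) phi n : (c *: phi : H) n = c * phi n.
Proof. by []. Qed.
Lemma l20 n : (0 : H) n = 0.
Proof. by []. Qed.
Lemma l2N phi n : (- phi : H) n = - phi n.
Proof. by []. Qed.

Lemma l2P phi psi : (forall n, phi n = psi n) -> phi = psi.
Proof. by move=> e; apply: val_inj; apply/funext. Qed.

Definition l2sq phi : R := l2norm phi ^+ 2.

Lemma l2norm_ge0 phi : 0 <= l2norm phi.
Proof. by rewrite sqrtr_ge0. Qed.

Lemma esum_l2sq phi : (\esum_(n in [set: 'Z^d]) (sqnormc (phi n))%:E = (l2sq phi)%:E)%E.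
Proof.
have fin : (\esum_(n in [set: 'Z^d]) (Normc.normc (phi n) ^+ 2)%:E < +oo)%E.
  by apply/l2_predP; exact: l2_funP.
have pos : (0 <= \esum_(n in [set: 'Z^d]) (Normc.normc (phi n) ^+ 2)%:E)%E.
  by apply: esum_ge0 => n _; rewrite lee_fin sqr_ge0.
rewrite /l2sq /l2norm sqr_sqrtr ?fine_ge0// fineK ?ge0_fin_numE//.
by apply: eq_esum => n _; rewrite sqnormcE.
Qed.

Lemma l2sq_ge0 phi : 0 <= l2sq phi. Proof. exact: sqr_ge0. Qed.

Lemma l2normE phi : l2norm phi = Num.sqrt (l2sq phi).
Proof. by rewrite sqrtr_sqr ger0_norm ?l2norm_ge0. Qed.

Lemma l2sq_comb (s : seq (R * H)) : (forall p, p \in s -> 0 <= p.1) ->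
  ((\sum_(p <- s) p.1 * l2sq p.2)%:E =
   \esum_(n in [set: 'Z^d]) (\sum_(p <- s) p.1 * sqnormc (p.2 n))%:E)%E.
Proof.
elim: s => [_|p s IH s0]; first by rewrite big_nil esum1// => n _; rewrite big_nil.
have p0 : 0 <= p.1 by apply: s0; rewrite mem_head.
have {}s0 q : q \in s -> 0 <= q.1 by move=> qs; apply: s0; rewrite inE qs orbT.
rewrite big_cons EFinD IH// EFinM -esum_l2sq.
have -> : (p.1%:E * (\esum_(n in [set: 'Z^d]) (sqnormc (p.2 n))%:E) =
    (\esum_(n in [set: 'Z^d]) (p.1 * sqnormc (p.2 n))%:E))%E.
  move: p0; rewrite le_eqVlt => /orP[/eqP <-|p0].
    by rewrite mul0e esum1// => n _; rewrite mul0r.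
  apply/eqP; rewrite eq_le; apply/andP; split.
    rewrite -lee_pdivlMl//; apply: ge_ereal_sup => _ [X XT <-].
    rewrite lee_pdivlMl// ge0_mule_fsumr; last first.
      by move=> n; rewrite lee_fin sqnormc_ge0.
    by apply: esum_ge; exists X.
  apply: ge_ereal_sup => _ [X XT <-].
  under eq_fsbigr do rewrite EFinM.
  rewrite -ge0_mule_fsumr; last by move=> n; rewrite lee_fin sqnormc_ge0.
  apply: lee_wpmul2l; first by rewrite lee_fin ltW.
  by apply: esum_ge; exists X.
rewrite -esumD.
- by apply: eq_esum => n _; rewrite big_cons EFinD.
- by move=> n _; rewrite lee_fin mulr_ge0 ?sqnormc_ge0// ltW.
- by move=> n _; rewrite lee_fin big_seq sumr_ge0// => q qs; rewrite mulr_ge0 ?sqnormc_ge0// s0.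
Qed.

(* Every identity for the inner product is derived from comparisons of this
   kind, so that no signed infinite sum is ever formed. *)
Lemma l2sq_comb_le (s t : seq (R * H)) :
  all (fun p => 0 <= p.1) s -> all (fun p => 0 <= p.1) t ->
  (forall n, \sum_(p <- s) p.1 * sqnormc (p.2 n) <= \sum_(p <- t) p.1 * sqnormc (p.2 n)) ->
  \sum_(p <- s) p.1 * l2sq p.2 <= \sum_(p <- t) p.1 * l2sq p.2.
Proof.
move=> /allP s0 /allP t0 st; rewrite -lee_fin !l2sq_comb//.
by apply: le_esum => n _; rewrite lee_fin.
Qed.

Lemma l2sq_comb_eq (s t : seq (R * H)) :
  all (fun p => 0 <= p.1) s -> all (fun p => 0 <= p.1) t ->
  (forall n, \sum_(p <- s) p.1 * sqnormc (p.2 n) = \sum_(p <- t) p.1 * sqnormc (p.2 n)) ->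
  \sum_(p <- s) p.1 * l2sq p.2 = \sum_(p <- t) p.1 * l2sq p.2.
Proof.
move=> s0 t0 st; apply/eqP; rewrite eq_le; apply/andP.
by split; apply: l2sq_comb_le => // n; rewrite st.
Qed.

Lemma l2sq_eq3 phi1 phi2 phi3 psi1 psi2 psi3 :
  (forall n, sqnormc (phi1 n) + (sqnormc (phi2 n) + sqnormc (phi3 n)) =
     sqnormc (psi1 n) + (sqnormc (psi2 n) + sqnormc (psi3 n))) ->
  l2sq phi1 + (l2sq phi2 + l2sq phi3) = l2sq psi1 + (l2sq psi2 + l2sq psi3).
Proof.
move=> h.
have := @l2sq_comb_eq [:: (1, phi1); (1, phi2); (1, phi3)]
  [:: (1, psi1); (1, psi2); (1, psi3)].
rewrite !sum_seq3 /= !mul1r; apply => [||n]; rewrite ?ler01//.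
by rewrite !sum_seq3 /= !mul1r.
Qed.

Lemma l2sq_eq2 (c : R) phi1 phi2 psi1 psi2 : 0 <= c ->
  (forall n, sqnormc (phi1 n) + c * sqnormc (phi2 n) =
     sqnormc (psi1 n) + c * sqnormc (psi2 n)) ->
  l2sq phi1 + c * l2sq phi2 = l2sq psi1 + c * l2sq psi2.
Proof.
move=> c0 h.
have := @l2sq_comb_eq [:: (1, phi1); (c, phi2)] [:: (1, psi1); (c, psi2)].
rewrite !sum_seq2 /= !mul1r; apply => [||n]; rewrite ?ler01 ?c0//.
by rewrite !sum_seq2 /= !mul1r.
Qed.

Lemma l2sq_le2 (a b : R) phi psi1 psi2 : 0 <= a -> 0 <= b ->
  (forall n, sqnormc (phi n) <= a * sqnormc (psi1 n) + b * sqnormc (psi2 n)) ->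
  l2sq phi <= a * l2sq psi1 + b * l2sq psi2.
Proof.
move=> a0 b0 h.
have := @l2sq_comb_le [:: (1, phi)] [:: (a, psi1); (b, psi2)].
rewrite !sum_seq2 big_seq1 /= !mul1r; apply => [||n]; rewrite ?ler01 ?a0 ?b0//.
by rewrite !sum_seq2 big_seq1 /= !mul1r.
Qed.

Lemma sqnormc_le_l2sq phi n : sqnormc (phi n) <= l2sq phi.
Proof.
rewrite -lee_fin -esum_l2sq.
apply: esum_ge; exists [set n]; first by split.
by rewrite fsbig_set1.
Qed.

Lemma l2sq_eq0 phi : l2sq phi = 0 -> phi = 0.
Proof.
move=> p0; apply: l2P => n; apply/eqP; rewrite -sqnormc_eq0.
by rewrite eq_le sqnormc_ge0 -p0 sqnormc_le_l2sq.
Qed.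

Lemma l2norm_eq0 phi : l2norm phi = 0 -> phi = 0.
Proof. by move=> p0; apply: l2sq_eq0; rewrite /l2sq p0 expr0n. Qed.

Lemma l2sqZ (c : R) phi : l2sq (c%:C *: phi) = c ^+ 2 * l2sq phi.
Proof.
have := @l2sq_comb_eq [:: (1, c%:C *: phi)] [:: (c ^+ 2, phi)].
rewrite !big_seq1 /= mul1r => -> //; rewrite ?sqr_ge0 ?ler01// => n.
rewrite !big_seq1 /= l2Z; case: (phi n) => x y; rewrite /sqnormc /=; ring.
Qed.

Lemma l2sqZc (c : R[i]) phi : l2sq (c *: phi) = sqnormc c * l2sq phi.
Proof.
have := @l2sq_comb_eq [:: (1, c *: phi)] [:: (sqnormc c, phi)].
rewrite !big_seq1 /= mul1r => -> //; rewrite ?sqnormc_ge0 ?ler01// => n.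
rewrite !big_seq1 /= l2Z; case: (phi n) c => x y [a b]; rewrite /sqnormc /=; ring.
Qed.

Lemma l2normZ (c : R) phi : l2norm (c%:C *: phi) = `|c| * l2norm phi.
Proof. by rewrite !l2normE l2sqZ sqrtrM ?sqr_ge0// sqrtr_sqr. Qed.

Lemma l2sqN phi : l2sq (- phi) = l2sq phi.
Proof. by rewrite -scaleN1r -(rmorphN1 (real_complex R)) l2sqZ sqrrN expr1n mul1r. Qed.

Lemma l2normN phi : l2norm (- phi) = l2norm phi.
Proof. by rewrite !l2normE l2sqN. Qed.

Lemma l2norm0 : l2norm (0 : H) = 0.
Proof.
by rewrite -(scale0r (0 : H)) -(rmorph0 (real_complex R)) l2normZ normr0 mul0r.
Qed.

(** With a and b the two norms, |x + y|^2 <= (1 + b/a)|x|^2 + (1 + a/b)|y|^2 holds pointwise, the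
    difference being |b x - a y|^2/(ab). Summing gives exactly (a + b)^2, so no Cauchy-Schwarz
    inequality for sums is involved. Zero norms are split off because of the quotients. *)
Lemma l2normD phi psi : l2norm (phi + psi) <= l2norm phi + l2norm psi.
Proof.
have := l2norm_ge0 phi; have := l2norm_ge0 psi.
rewrite [0 <= l2norm psi]le_eqVlt => /orP[/eqP p0 _|p0].
  by rewrite -p0 (@l2norm_eq0 psi)// !addr0.
rewrite le_eqVlt => /orP[/eqP f0|f0].
  by rewrite -f0 (@l2norm_eq0 phi)// !add0r.
rewrite -(@ler_pXn2r _ 2) ?nnegrE ?addr_ge0 ?l2norm_ge0//.
set a := l2norm phi; set b := l2norm psi.
have -> : (a + b) ^+ 2 = (1 + b / a) * a ^+ 2 + (1 + a / b) * b ^+ 2.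
  by field; rewrite !gt_eqF.
have ab : 0 < b / a by rewrite divr_gt0.
have ba : 0 < a / b by rewrite divr_gt0.
apply: l2sq_le2 => [||n]; rewrite ?addr_ge0 ?(ltW ab) ?(ltW ba)// l2D.
case: (phi n) (psi n) => x y [z t]; rewrite /sqnormc /= -subr_ge0.
suff -> : (1 + b / a) * (x ^+ 2 + y ^+ 2) + (1 + a / b) * (z ^+ 2 + t ^+ 2) -
   ((x + z) ^+ 2 + (y + t) ^+ 2) = ((b * x - a * z) ^+ 2 + (b * y - a * t) ^+ 2) / (a * b).
  by rewrite divr_ge0 ?addr_ge0 ?sqr_ge0 ?mulr_ge0 // ltW.
by field; rewrite !gt_eqF.
Qed.

Lemma l2normB phi psi : l2norm (phi - psi) <= l2norm phi + l2norm psi.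
Proof. by rewrite (le_trans (l2normD _ _))// l2normN. Qed.

Lemma l2norm_sum (I : Type) (s : seq I) (F : I -> H) :
  l2norm (\sum_(i <- s) F i) <= \sum_(i <- s) l2norm (F i).
Proof.
elim: s => [|i s IH]; first by rewrite !big_nil l2norm0.
by rewrite !big_cons (le_trans (l2normD _ _))// lerD2l.
Qed.

Lemma bound_l2norm_le0 phi :
  (forall e : R, 0 < e -> l2norm phi <= e) -> phi = 0.
Proof.
move=> h; apply: l2norm_eq0; apply/eqP; rewrite eq_le l2norm_ge0 andbT.
by apply/ler_addgt0Pl => e e0; rewrite addr0 h.
Qed.

(** By polarization this is the real part of the inner product. Real bilinearity and symmetry are
    enough for operators that are real polynomials in A. *)
Definition ip phi psi : R := (l2sq (phi + psi) - l2sq (phi - psi)) / 4.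

Lemma ipC phi psi : ip phi psi = ip psi phi.
Proof. by rewrite /ip (addrC phi) -(l2sqN (phi - psi)) opprB. Qed.

Lemma ipDl phi phi' psi : ip (phi + phi') psi = ip phi psi + ip phi' psi.
Proof.
have alg (a b c a' b' c' : R) : a + (b + c) = a' + (b' + c') ->
  a - a' = (b' - b) + (c' - c) by move=> e; lra.
rewrite /ip -mulrDl; congr (_ / _); apply: alg.
apply: l2sq_eq3 => n; rewrite !(l2D,l2N).
case: (phi n) (phi' n) (psi n) => x y [z t] [u v]; rewrite /sqnormc /=; ring.
Qed.

Lemma ipDr phi psi psi' : ip phi (psi + psi') = ip phi psi + ip phi psi'.
Proof. by rewrite !(ipC phi) ipDl. Qed.

Lemma ipNl phi psi : ip (- phi) psi = - ip phi psi.
Proof.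
rewrite /ip -(l2sqN (- phi + psi)) -(l2sqN (- phi - psi)) !opprD !opprK.
by rewrite -[RHS]mulNr; congr (_ / _); rewrite [RHS]opprB.
Qed.

Lemma ipNr phi psi : ip phi (- psi) = - ip phi psi.
Proof. by rewrite !(ipC phi) ipNl. Qed.

Lemma ip0l psi : ip 0 psi = 0.
Proof. by rewrite -(subrr psi) ipDl ipNl subrr. Qed.

Lemma ipZl (c : R) phi psi : ip (c%:C *: phi) psi = c * ip phi psi.
Proof.
(* Below, c serves as a weight in a sum of squares and has to be nonnegative; a negative sign is
   moved onto [phi]. *)
wlog c0 : c phi / 0 <= c => [hw|].
  have [c0|c0] := leP 0 c; first exact: hw.
  have -> : c%:C *: phi = (- c)%:C *: (- phi).
    by apply: l2P => n; rewrite !l2Z l2N rmorphN mulrNN.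
  have /(hw _ (- phi)) -> : 0 <= - c by rewrite oppr_ge0 ltW.
  by rewrite (ipNl phi psi) mulrNN.
have alg (a b a' b' : R) : a + c * b = a' + c * b' -> a - a' = c * (b' - b).
  by move=> e; lra.
rewrite /ip mulrA; congr (_ / _); apply: alg.
apply: l2sq_eq2 => // n; rewrite !(l2D,l2N,l2Z).
case: (phi n) (psi n) => x y [z t]; rewrite /sqnormc /=; ring.
Qed.

Lemma ipZr (c : R) phi psi : ip phi (c%:C *: psi) = c * ip phi psi.
Proof. by rewrite !(ipC phi) ipZl. Qed.

Lemma ipsq phi : ip phi phi = l2sq phi.
Proof.
have e2 : phi + phi = (2 : R)%:C *: phi.
  by apply: l2P => n; rewrite l2D l2Z rmorph_nat mulr_natl.
have e0 : l2sq (0 : H) = 0 by rewrite /l2sq l2norm0 expr0n.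
by rewrite /ip subrr e0 e2 l2sqZ subr0 -natrX mulrAC divff ?mul1r// pnatr_eq0.
Qed.

End SquareNorm.

(** * Completeness of l2 and limits of operators *)

Section OperatorLimit.
Context {R : realType} {d : nat}.
Local Notation H := (l2 R d).

Lemma cvg_sqnormc (a b : nat -> R) (x y : R) :
  (a k @[k --> \oo] --> x) -> (b k @[k --> \oo] --> y) ->
  sqnormc (a k +i* b k) @[k --> \oo] --> sqnormc (x +i* y).
Proof.
by move=> ax byy; rewrite /sqnormc /= !expr2; apply: cvgD; apply: cvgM.
Qed.

Lemma cvgn_dominated_dist (e u : nat -> R) : (e k @[k --> \oo] --> (0 : R)) ->
  (forall k j, (k <= j)%N -> `|u j - u k| <= e k) -> cvgn u.
Proof.
move=> e0 h; apply/cauchy_cvgP/cauchy_exP => eps eps0.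
have /cvgrPdist_lt/(_ eps eps0)[k _ hk] := e0.
exists (u k), k => // j /= kj; rewrite /ball /= distrC.
apply: le_lt_trans (h _ _ kj) _.
by apply: le_lt_trans (hk k (leqnn k)); rewrite sub0r normrN ler_norm.
Qed.

Lemma cvg_sumr (I : Type) (s : seq I) (f : nat -> I -> R) (l : I -> R) :
  (forall i, f k i @[k --> \oo] --> l i) ->
  \sum_(i <- s) f k i @[k --> \oo] --> \sum_(i <- s) l i.
Proof.
move=> h; elim: s => [|i s IH].
  by under eq_fun do rewrite big_nil; rewrite big_nil; exact: cvg_cst.
by under eq_fun do rewrite big_cons; rewrite big_cons; exact: cvgD.
Qed.

Lemma sqr_summable_bound (phi : 'Z^d -> R[i]^o) (c : R) :
  (forall F : set 'Z^d, finite_set F -> \sum_(n \in F) sqnormc (phi n) <= c) ->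
  phi \in @l2_pred R d.
Proof.
move=> h; apply/l2_predP; apply: (@le_lt_trans _ _ c%:E); last exact: ltry.
apply: ge_ereal_sup => _ [X [fX _] <-].
under eq_fsbigr do rewrite sqnormcE.
by rewrite fsumEFin// lee_fin; exact: h.
Qed.

Lemma l2sq_le_bound (phi : H) (c : R) :
  (forall F : set 'Z^d, finite_set F -> \sum_(n \in F) sqnormc (phi n) <= c) ->
  l2sq phi <= c.
Proof.
move=> h; rewrite -lee_fin -esum_l2sq.
by apply: ge_ereal_sup => _ [X [fX _] <-]; rewrite fsumEFin// lee_fin h.
Qed.

Lemma fsum_sqnormc_le (phi : H) (F : set 'Z^d) : finite_set F ->
  \sum_(n \in F) sqnormc (phi n) <= l2sq phi.
Proof.
move=> fF; rewrite -lee_fin -esum_l2sq -fsumEFin//.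
by apply: esum_ge; exists F.
Qed.

(** The limit is taken coordinatewise. A bound on the sum over a finite set passes to the limit, and
    finite sets determine the norm, so the rate [e] survives. *)
Lemma l2_cauchy_cvg (phi : nat -> H) (e : nat -> R) :
  (e k @[k --> \oo] --> (0 : R)) ->
  (forall k j, (k <= j)%N -> l2norm (phi j - phi k) <= e k) ->
  exists psi : H, (forall k, l2norm (psi - phi k) <= e k) /\
    forall n, (complex.Re (phi k n) @[k --> \oo] --> complex.Re (psi n)) /\
              (complex.Im (phi k n) @[k --> \oo] --> complex.Im (psi n)).
Proof.
move=> e0 h.
have e_ge0 k : 0 <= e k by apply: le_trans (h k k (leqnn k)); exact: l2norm_ge0.
have hsq k j : (k <= j)%N -> l2sq (phi j - phi k) <= e k ^+ 2.
  by move=> kj; rewrite lerXn2r ?nnegrE ?l2norm_ge0 ?h.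
have cau (p : R[i] -> R) n : (forall z w, p (z - w) = p z - p w) ->
    (forall z, p z ^+ 2 <= sqnormc z) -> cvgn (fun k => p (phi k n)).
  move=> pB ple; apply: (@cvgn_dominated_dist e) => // k j kj.
  rewrite -pB -l2B -(@ler_pXn2r _ 2) ?nnegrE//.
  rewrite real_normK ?num_real// (le_trans (ple _))//.
  exact: le_trans (sqnormc_le_l2sq _ _) (hsq _ _ kj).
have cRe n : cvgn (fun k => complex.Re (phi k n)).
  apply: cau => [[x y] [z t]//|[x y]]; by rewrite /sqnormc /= lerDl sqr_ge0.
have cIm n : cvgn (fun k => complex.Im (phi k n)).
  apply: cau => [[x y] [z t]//|[x y]]; by rewrite /sqnormc /= lerDr sqr_ge0.
pose psi n : R[i]^o := limn (fun k => complex.Re (phi k n)) +i* limn (fun k => complex.Im (phi k n)).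
have bnd k F : finite_set F ->
    \sum_(n \in F) sqnormc (psi n - phi k n) <= e k ^+ 2.
  move=> fF.
  have : (\sum_(n \in F) sqnormc (phi j n - phi k n)) @[j --> \oo] -->
      \sum_(n \in F) sqnormc (psi n - phi k n).
    under eq_fun do rewrite fsbig_finite//=.
    rewrite fsbig_finite//=; apply: cvg_sumr => n.
    have := @cvg_sqnormc (fun j => complex.Re (phi j n - phi k n))
      (fun j => complex.Im (phi j n - phi k n)) (complex.Re (psi n - phi k n))
      (complex.Im (psi n - phi k n)).
    have E z : (complex.Re z +i* complex.Im z : R[i]) = z by case: z.
    under [X in _ -> _ -> X @ _ --> _]eq_fun do rewrite E.
    rewrite E; apply; rewrite raddfB/=.
      by under eq_fun do rewrite raddfB/=; apply: cvgB => //; exact: cvg_cst.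
    by under eq_fun do rewrite raddfB/=; apply: cvgB => //; exact: cvg_cst.
  move/cvgr_to_le; apply; exists k => // j /= kj.
  exact: le_trans (fsum_sqnormc_le (phi j - phi k) fF) (hsq _ _ kj).
have mem k : (fun n => psi n - phi k n) \in @l2_pred R d.
  by apply: (sqr_summable_bound (c := e k ^+ 2)) => F fF; exact: (bnd k F fF).
have psil2 : psi \in @l2_pred R d.
  have -> : psi = (fun n => psi n - phi 0%N n) + (phi 0%N : 'Z^d -> R[i]^o).
    by apply/funext => n; rewrite addrfctE subrK.
  by apply: rpredD; [exact: mem|exact: l2_funP].
exists (L2 psil2); split => // k.
rewrite -(@ler_pXn2r _ 2) ?nnegrE ?l2norm_ge0//.
by apply: l2sq_le_bound => F fF; exact: bnd.
Qed.

Lemma l2norm_cvg0_eq0 (chi : H) (e : nat -> R) (C : R) :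
  (e k @[k --> \oo] --> (0 : R)) -> (forall k, l2norm chi <= e k * C) -> chi = 0.
Proof.
move=> e0 h; apply: l2norm_eq0; apply/eqP; rewrite eq_le l2norm_ge0 andbT.
have : e k * C @[k --> \oo] --> 0 * C by apply: cvgM => //; exact: cvg_cst.
by rewrite mul0r => /cvgr_to_ge; apply; exists 0%N => // k _; exact: h.
Qed.

Lemma l2normZc (c : R[i]) (phi : H) :
  l2norm (c *: phi) = Num.sqrt (sqnormc c) * l2norm phi.
Proof. by rewrite !l2normE l2sqZc sqrtrM ?sqnormc_ge0. Qed.

(** Two modes of convergence are recorded: in operator norm, for the functional calculus, and in
    each coordinate, from which matrix elements are read off. *)
Lemma op_cauchy_cvg (T : nat -> H -> H) (e : nat -> R) :
  (forall k, linear (T k)) ->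
  (e k @[k --> \oo] --> (0 : R)) ->
  (forall k j phi, (k <= j)%N -> l2norm (T j phi - T k phi) <= e k * l2norm phi) ->
  (exists M, forall phi, l2norm (T 0%N phi) <= M * l2norm phi) ->
  exists S : H -> H, [/\ bounded_linear S,
    (forall k phi, l2norm (S phi - T k phi) <= e k * l2norm phi) &
    forall phi n, (complex.Re (T k phi n) @[k --> \oo] --> complex.Re (S phi n)) /\
              (complex.Im (T k phi n) @[k --> \oo] --> complex.Im (S phi n))].
Proof.
move=> lT e0 h [M hM].
have lim phi : exists psi : H, (forall k, l2norm (psi - T k phi) <= e k * l2norm phi) /\
    forall n, (complex.Re (T k phi n) @[k --> \oo] --> complex.Re (psi n)) /\
              (complex.Im (T k phi n) @[k --> \oo] --> complex.Im (psi n)).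
  apply: (@l2_cauchy_cvg (fun k => T k phi) (fun k => e k * l2norm phi)) => [|k j kj].
    by rewrite -[X in _ --> X](mul0r (l2norm phi)); apply: cvgM => //; exact: cvg_cst.
  exact: h.
have [S hS] := choice lim; exists S; split; last first.
- by move=> phi; case: (hS phi).
- by move=> k phi; case: (hS phi).
split; last first.
  exists (e 0%N + M) => phi; rewrite -(subrK (T 0%N phi) (S phi)).
  rewrite (le_trans (l2normD _ _))// mulrDl lerD//.
  by case: (hS phi).
move=> c phi psi; apply/eqP; rewrite -subr_eq0; apply/eqP.
pose C := l2norm (c *: phi + psi) + (Num.sqrt (sqnormc c) * l2norm phi + l2norm psi).
apply: (@l2norm_cvg0_eq0 _ e C) => // k.
have -> : S (c *: phi + psi) - (c *: S phi + S psi) =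
    (S (c *: phi + psi) - T k (c *: phi + psi)) -
    (c *: (S phi - T k phi) + (S psi - T k psi)).
  apply: l2P => n; rewrite lT !(l2D,l2N,l2Z) mulrBr.
  move: (S _ _) (S _ _) (S _ _) (T _ _ _) (T _ _ _) => x y z t u.
  by rewrite -!mulNr mulNr; ring.
have hS1 chi : l2norm (S chi - T k chi) <= e k * l2norm chi by case: (hS chi).
apply: le_trans (l2normB _ _) _; rewrite mulrDr; apply: lerD => //.
apply: le_trans (l2normD _ _) _; rewrite mulrDr; apply: lerD => //.
by rewrite l2normZc mulrCA ler_wpM2l ?sqrtr_ge0.
Qed.

End OperatorLimit.

(** * The Laplacian as a bounded self-adjoint operator *)

Section Laplacian.
Context {R : realType} {d : nat}.
Local Notation H := (l2 R d).
Implicit Types (phi psi : H) (n v : 'Z^d).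

Lemma l2_sumE (I : Type) (s : seq I) (F : I -> H) n :
  (\sum_(i <- s) F i : H) n = \sum_(i <- s) F i n.
Proof.
by elim: s => [|i s IH]; rewrite ?big_nil// !big_cons l2D IH.
Qed.

Lemma shift_subproof v phi : (fun n => phi (n - v)) \in @l2_pred R d.
Proof. by apply/l2_predP/sqr_summable_shift/l2_predP; exact: l2_funP. Qed.

Definition shift v phi : H := L2 (shift_subproof v phi).

Lemma shiftE v phi n : shift v phi n = phi (n - v).
Proof. by []. Qed.

Lemma l2sq_shift v phi : l2sq (shift v phi) = l2sq phi.
Proof.
apply: EFin_inj; rewrite -!esum_l2sq.
rewrite [RHS](reindex_esum [set: 'Z^d] [set: 'Z^d] (fun n => n - v))//.
split=> //; first by move=> x y _ _; exact: addIr.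
by move=> x _; exists (x + v) => //; rewrite addrK.
Qed.

Lemma l2norm_shift v phi : l2norm (shift v phi) = l2norm phi.
Proof. by rewrite !l2normE l2sq_shift. Qed.

Lemma ip_shift v phi psi : ip (shift v phi) psi = ip phi (shift (- v) psi).
Proof.
have e (a b : H) : shift v a = b -> l2sq a = l2sq b by move=> <-; rewrite l2sq_shift.
rewrite /ip; congr ((_ - _) / _); apply/esym/e/l2P => n;
  by rewrite shiftE !(l2D,l2N) !shiftE opprK subrK.
Qed.

Definition unitv (i : 'I_d) : 'Z^d := delta_mx 0 i.

Lemma norm1N v : norm1 (- v) = norm1 v.
Proof. by apply: eq_bigr => i _; rewrite mxE normrN. Qed.

Lemma norm1_unitv i : norm1 (unitv i) = 1.
Proof.
rewrite /norm1 (bigD1 i)//= big1 => [|j ji]; rewrite mxE ?eqxx//.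
by rewrite (negbTE ji) andbF.
Qed.

Lemma norm1_eq1 v : norm1 v = 1 -> exists i, v = unitv i \/ v = - unitv i.
Proof.
move=> v1.
have [i vi] : exists i, v 0 i != 0.
  apply/existsP; apply: contra_eqT v1 => /existsPn v0.
  by rewrite /norm1 big1// => i _; move/negPn: (v0 i) => /eqP ->.
exists i.
have := v1; rewrite /norm1 (bigD1 i)//= => e.
have s0 : 0 <= \sum_(j < d | j != i) `|v 0 j| by rewrite sumr_ge0.
have a0 : 0 < `|v 0 i| by rewrite normr_gt0.
have [sz vi1] : \sum_(j < d | j != i) `|v 0 j| = 0 /\ `|v 0 i| = 1.
  by move: e s0 a0; move: (\sum_(j < d | _) _) `|v 0 i| => a b; lia.
have vj j : j != i -> v 0 j = 0.
  move=> ji; apply/eqP; rewrite -normr_eq0; move: sz.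
  by move/psumr_eq0P => /(_ (fun _ _ => normr_ge0 _)) ->.
have [vp|vm] : v 0 i = 1 \/ v 0 i = -1 by lia.
  left; apply/rowP => j; rewrite mxE eqxx /=.
  by have [->|/vj->] := eqVneq j i.
right; apply/rowP => j; rewrite !mxE eqxx /=.
by have [->|/vj->] := eqVneq j i.
Qed.

Lemma unitv_inj : injective unitv.
Proof.
move=> i j /rowP/(_ i); rewrite !mxE !eqxx /=.
by have [->|] := eqVneq i j.
Qed.

Lemma sphere_perm : perm_eq (fset_set [set v : 'Z^d | norm1 v = 1])
  ([seq unitv i | i <- index_enum (fintype_ordinal__canonical__fintype_Finite d)] ++ [seq - unitv i | i <- index_enum (fintype_ordinal__canonical__fintype_Finite d)]).
Proof.
apply: uniq_perm; first exact: fset_uniq.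
  have inj2 : injective (fun i => - unitv i) by move=> i j /oppr_inj/unitv_inj.
  rewrite cat_uniq (map_inj_uniq unitv_inj) (map_inj_uniq inj2) index_enum_uniq andbT/=.
  apply/hasPn => _ /mapP[i _ ->]; apply/negP => /mapP[j _] /rowP/(_ i).
  by rewrite !mxE !eqxx /=; case: (i == j).
move=> v; rewrite in_fset_set ?inE; last exact: finite_norm1_sphere.
apply/idP/idP; rewrite mem_cat.
  rewrite inE => /norm1_eq1[i [->|->]]; apply/orP; [left|right]; apply/mapP;
  by exists i => //; rewrite mem_index_enum.
rewrite inE; case/orP => /mapP[i _ ->] /=; rewrite ?norm1N norm1_unitv//.
Qed.

Lemma neg_laplacianE phi n : neg_laplacian R d phi n =
  \sum_(i < d) ((phi n - phi (n - unitv i)) + (phi n - phi (n + unitv i))).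
Proof.
transitivity (neg_laplacian_fun phi n); first by [].
rewrite neg_laplacian_funE fct_sumE (perm_big _ sphere_perm)/= big_cat/=.
rewrite !big_map -big_split/=.
by apply: eq_bigr => i _; rewrite -{4}[unitv i]opprK.
Qed.

Definition lazy_op phi : H := (3 * d%:R)%:C *: phi - neg_laplacian R d phi.

Lemma lazy_opE phi n : lazy_op phi n =
  \sum_(i < d) (phi n + phi (n - unitv i) + phi (n + unitv i)).
Proof.
rewrite l2D l2N l2Z neg_laplacianE.
have -> : (3 * d%:R)%:C * phi n = \sum_(i < d) (3 * phi n).
  by rewrite sumr_const card_ord rmorphM !rmorph_nat -[RHS]mulr_natl mulrA [d%:R * 3]mulrC.
by rewrite -sumrB; apply: eq_bigr => i _; ring.
Qed.

Lemma neg_laplacian_linear : linear (neg_laplacian R d).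
Proof.
move=> c phi psi; apply: l2P => n; rewrite l2D l2Z !neg_laplacianE mulr_sumr.
by rewrite -big_split; apply: eq_bigr => i _; rewrite !(l2D,l2Z) /=; ring.
Qed.

Lemma neg_laplacian_shift phi : neg_laplacian R d phi =
  \sum_(i < d) ((phi - shift (unitv i) phi) + (phi - shift (- unitv i) phi)).
Proof.
apply: l2P => n; rewrite neg_laplacianE.
rewrite l2_sumE; apply: eq_bigr => i _.
by rewrite !(l2D,l2N,shiftE) opprK.
Qed.

Lemma lazy_op_shift phi : lazy_op phi =
  \sum_(i < d) (phi + shift (unitv i) phi + shift (- unitv i) phi).
Proof.
apply: l2P => n; rewrite lazy_opE.
rewrite l2_sumE; apply: eq_bigr => i _.
by rewrite !(l2D,l2N,shiftE) opprK.
Qed.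

Lemma l2norm_lazy_op phi : l2norm (lazy_op phi) <= 3 * d%:R * l2norm phi.
Proof.
rewrite lazy_op_shift (le_trans (l2norm_sum _ _))//.
rewrite (le_trans (ler_sum _ (G := fun=> 3 * l2norm phi) _))// => [i _|].
  rewrite (le_trans (l2normD _ _))// (le_trans (lerD (l2normD _ _) (lexx _)))//.
  by rewrite !l2norm_shift; set x := l2norm phi; rewrite le_eqVlt; apply/orP; left; apply/eqP; ring.
by rewrite sumr_const card_ord -[X in X <= _]mulr_natl mulrA [d%:R * _]mulrC.
Qed.

Lemma ip_suml (I : Type) (s : seq I) (F : I -> H) psi :
  ip (\sum_(i <- s) F i) psi = \sum_(i <- s) ip (F i) psi.
Proof. by elim: s => [|i s IH]; rewrite ?big_nil ?ip0l// !big_cons ipDl IH. Qed.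

Lemma ip_sub_shiftC v phi psi :
  ip (phi - shift v phi) psi = ip (psi - shift (- v) psi) phi.
Proof.
by rewrite !ipDl !ipNl ip_shift (ipC psi phi) (ipC (shift (- v) psi)).
Qed.

Lemma neg_laplacian_sym phi psi :
  ip (neg_laplacian R d phi) psi = ip phi (neg_laplacian R d psi).
Proof.
rewrite !neg_laplacian_shift ip_suml (ipC phi) ip_suml; apply: eq_bigr => i _.
rewrite (ipDl (phi - _)) (ipDl (psi - _)) [RHS]addrC.
by congr (_ + _); rewrite ip_sub_shiftC ?opprK.
Qed.

(** A shift preserves the norm, so the cross terms in the square combine into the form itself. Hence
    the form of A is a sum of squares; the version with a plus sign yields the upper bound 4d. *)
Lemma ip_sub_shift v phi : ip (phi - shift v phi) phi = l2sq (phi - shift v phi) / 2.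
Proof.
rewrite -(ipsq (phi - _)) (ipDr (phi - _)) ipNr !ipDl !ipNl !ipsq l2sq_shift.
rewrite (ipC phi (shift v phi)); move: (ip _ _) (l2sq _) => a b; lra.
Qed.

Lemma ip_add_shift v phi : ip (phi + shift v phi) phi = l2sq (phi + shift v phi) / 2.
Proof.
rewrite -(ipsq (phi + _)) (ipDr (phi + _)) !ipDl !ipsq l2sq_shift.
rewrite (ipC phi (shift v phi)); move: (ip _ _) (l2sq _) => a b; lra.
Qed.

Lemma neg_laplacian_ge0 phi : 0 <= ip (neg_laplacian R d phi) phi.
Proof.
rewrite neg_laplacian_shift ip_suml; apply: sumr_ge0 => i _.
by rewrite ipDl !ip_sub_shift addr_ge0 ?divr_ge0 ?l2sq_ge0.
Qed.

Lemma neg_laplacian_le phi :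
  ip (neg_laplacian R d phi) phi <= 4 * d%:R * l2sq phi.
Proof.
rewrite neg_laplacian_shift ip_suml.
have -> : 4 * d%:R * l2sq phi = \sum_(i < d) (4 * l2sq phi).
  by rewrite sumr_const card_ord -[RHS]mulr_natl mulrA [d%:R * _]mulrC.
apply: ler_sum => i _; rewrite (ipDl (phi - _)).
have h v : ip (phi - shift v phi) phi <= 2 * l2sq phi.
  rewrite ipDl ipNl ipsq; have := ip_add_shift v phi.
  rewrite ipDl ipsq; have := l2sq_ge0 (phi + shift v phi).
  move: (ip _ _) (l2sq _) (l2sq _) => a b c; lra.
have := h (unitv i); have := h (- unitv i).
move: (ip _ _) (ip _ _) (l2sq _) => a b c; lra.
Qed.

End Laplacian.

Lemma bin_mul_bin (j k r : nat) :
  ('C(j + k, j) * 'C(j + k + r, j + k) = 'C(j + k + r, j) * 'C(k + r, k))%N.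
Proof.
have f n m : ('C(n + m, n) * (n`! * m`!) = (n + m)`!)%N.
  by have := bin_fact (leq_addr m n); rewrite addKn.
apply/eqP; rewrite -(@eqn_pmul2r (j`! * k`! * r`!)) ?muln_gt0 ?fact_gt0//.
apply/eqP; transitivity ((j + k + r)`!).
  by rewrite -(f (j + k)%N r) -(f j k); ring.
by rewrite -addnA -(f j (k + r)%N) -(f k r); ring.
Qed.

(** * Polynomials in a linear operator *)

Lemma scale_comb_swap (K : comNzRingType) (V : lmodType K) (k c : K) (a b x y : V) :
  k *: a + b + c *: (k *: x + y) = k *: (a + c *: x) + (b + c *: y).
Proof. by rewrite !scalerDr !scalerA addrACA mulrC. Qed.

Section PolyOp.
Context {R : realType} {d : nat}.
Local Notation H := (l2 R d).
Variable A : H -> H.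
Hypothesis linA : linear A.
Implicit Types (phi psi : H) (p q : {poly R}).

Lemma lin0 : A 0 = 0.
Proof. by have := linA (- 1) 0 0; rewrite scaler0 add0r scaleN1r addNr. Qed.

Lemma linD phi psi : A (phi + psi) = A phi + A psi.
Proof. by have := linA 1 phi psi; rewrite !scale1r. Qed.

Lemma linZ c phi : A (c *: phi) = c *: A phi.
Proof. by have := linA c phi 0; rewrite lin0 !addr0. Qed.

Lemma lin_sum (I : Type) (s : seq I) (F : I -> H) :
  A (\sum_(i <- s) F i) = \sum_(i <- s) A (F i).
Proof. by elim: s => [|i s IH]; rewrite ?big_nil ?lin0// !big_cons linD IH. Qed.

Lemma poly_opE p N phi : (size p <= N)%N ->
  poly_op p A phi = \sum_(i < N) (p`_i)%:C *: iter i A phi.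
Proof.
move=> pN; rewrite /poly_op [RHS](bigID (fun i : 'I_N => (i < size p)%N))/=.
rewrite [X in _ = _ + X]big1 ?addr0; last first.
  by move=> i; rewrite -leqNgt => /(nth_default 0) ->; rewrite rmorph0 scale0r.
by rewrite (big_ord_widen N (fun i => (p`_i)%:C *: iter i A phi) pN).
Qed.

Lemma poly_opD p q phi : poly_op (p + q) A phi = poly_op p A phi + poly_op q A phi.
Proof.
pose N := maxn (size p) (size q).
rewrite !(@poly_opE _ N) ?leq_maxl ?leq_maxr ?(leq_trans (size_polyD _ _))//.
by rewrite -big_split; apply: eq_bigr => i _; rewrite coefD rmorphD scalerDl.
Qed.

Lemma poly_opZ (c : R) p phi : poly_op (c *: p) A phi = c%:C *: poly_op p A phi.
Proof.
rewrite (@poly_opE _ (size p)) ?size_scale_leq// /poly_op scaler_sumr.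
by apply: eq_bigr => i _; rewrite coefZ rmorphM scalerA.
Qed.

Lemma poly_op0 phi : poly_op 0 A phi = 0.
Proof. by rewrite /poly_op size_poly0 big_ord0. Qed.

Lemma poly_opB p q phi : poly_op (p - q) A phi = poly_op p A phi - poly_op q A phi.
Proof. by rewrite poly_opD -scaleN1r poly_opZ rmorphN1 scaleN1r. Qed.

Lemma poly_op_sum (I : Type) (s : seq I) (F : I -> {poly R}) phi :
  poly_op (\sum_(i <- s) F i) A phi = \sum_(i <- s) poly_op (F i) A phi.
Proof. by elim: s => [|i s IH]; rewrite ?big_nil ?poly_op0// !big_cons poly_opD IH. Qed.

Lemma poly_opC (c : R) phi : poly_op c%:P A phi = c%:C *: phi.
Proof. by rewrite (@poly_opE _ 1) ?size_polyC_leq1// big_ord1 coefC. Qed.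

Lemma poly_op_mulX p phi : poly_op (p * 'X) A phi = poly_op p A (A phi).
Proof.
rewrite (@poly_opE _ (size p).+1); last first.
  by apply: leq_trans (size_polyMleq _ _) _; rewrite size_polyX addn2.
rewrite big_ord_recl coefMX/= rmorph0 scale0r add0r; apply: eq_bigr => i _.
by rewrite coefMX/= -iterS iterSr.
Qed.

Lemma poly_opA p phi : poly_op p A (A phi) = A (poly_op p A phi).
Proof.
by rewrite /poly_op lin_sum; apply: eq_bigr => i _; rewrite linZ -iterSr.
Qed.

Lemma poly_opM p q phi : poly_op (p * q) A phi = poly_op p A (poly_op q A phi).
Proof.
elim/poly_ind: p q phi => [|p c IH] q phi; first by rewrite mul0r !poly_op0.
rewrite mulrDl -mulrA poly_opD IH [X in _ = X]poly_opD poly_op_mulX poly_opC.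
by rewrite mul_polyC poly_opZ -commr_polyX poly_op_mulX poly_opA.
Qed.

Lemma poly_op_linear p : linear (poly_op p A).
Proof.
elim/poly_ind: p => [|p c IH] k phi psi; first by rewrite !poly_op0 scaler0 addr0.
by rewrite !poly_opD !poly_op_mulX !poly_opC linA IH scale_comb_swap.
Qed.

End PolyOp.

(** * Norm bounds for polynomials of the Laplacian *)

Section Bernstein.
Context {R : realType}.
Implicit Types (p : {poly R}).

(** Degree raising: L^(N-j) is written as ((L - X) + X)^(N-j) and expanded, and the products of
    binomials regroup by [bin_mul_bin]. The terms with i < j vanish together with C(i, j). *)
Lemma bernstein_monomial (L : R) (N j : nat) : (j <= N)%N ->
  'C(N, j)%:R * L ^+ (N - j) *: 'X^j =
  \sum_(i < N.+1) ('C(i, j) * 'C(N, i))%:R *: ('X^i * (L%:P - 'X) ^+ (N - i)) :> {poly R}.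
Proof.
move=> jN; set Y := L%:P - 'X.
transitivity ('C(N, j)%:R *: ('X^j * (Y + 'X) ^+ (N - j)) : {poly R}).
  by rewrite /Y subrK -scalerA; congr (_ *: _); rewrite -polyC_exp mulrC mul_polyC.
rewrite exprDn mulr_sumr scaler_sumr.
rewrite -(big_mkord xpredT (fun k => 'C(N, j)%:R *: ('X^j * (Y ^+ (N - j - k) * 'X^k *+ 'C(N - j, k))) : {poly R})).
rewrite -(big_mkord xpredT (fun i => ('C(i, j) * 'C(N, i))%:R *: ('X^i * Y ^+ (N - i)))).
rewrite [RHS](@big_cat_nat _ _ _ j)//=; last exact: leq_trans (leqnSn _).
rewrite (_ : \sum_(0 <= i < j) _ = 0) ?add0r; last first.
  rewrite big_nat_cond big1// => i /andP[/andP[_ ij] _].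
  by rewrite bin_small// mul0n scale0r.
rewrite -[RHS]/(\sum_(0 + j <= i < N.+1) _) big_addn subSn//; apply: eq_big_nat => k; rewrite ltnS => /andP[_ kN].
rewrite addnC subnDA mulrnAr -[_ * _ *+ _]scaler_nat scalerA -natrM.
have -> : ('C(j + k, j) * 'C(N, j + k) = 'C(N, j) * 'C(N - j, k))%N.
  have {1 2 3}-> : N = (j + k + (N - j - k))%N by lia.
  rewrite bin_mul_bin; congr (_ * 'C(_, _))%N; lia.
by congr (_ *: _); rewrite exprD; ring.
Qed.

(** The quotient is the product of the (i - l)/(N - l) over l < j. Each factor differs from i/N by
    at most D/(N - D), and errors add up in a product of numbers from [0, 1]. Truncated subtraction
    produces the right value 0 when i <= l. *)
Lemma bin_ratio_bound (N D j i : nat) : (j <= D)%N -> (D < N)%N -> (i <= N)%N ->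
  `|'C(i, j)%:R / 'C(N, j)%:R - (i%:R / N%:R) ^+ j| <= j%:R * (D%:R / (N - D)%:R) :> R.
Proof.
move=> jD DN iN; elim: j jD => [|j IH] jD.
  by rewrite !bin0 divr1 expr0 subrr normr0 mul0r.
have {}IH := IH (ltnW jD).
have jN : (j < N)%N by exact: ltn_trans jD DN.
have N0 : (0 : R) < N%:R by rewrite ltr0n (leq_ltn_trans _ DN).
have ND0 : (0 : R) < (N - D)%:R by rewrite ltr0n subn_gt0.
have Nj0 : (0 : R) < (N - j)%:R by rewrite ltr0n subn_gt0.
have CNj : 'C(N, j)%:R != 0 :> R by rewrite pnatr_eq0 -lt0n bin_gt0 ltnW.
have -> : 'C(i, j.+1)%:R / 'C(N, j.+1)%:R =
    'C(i, j)%:R / 'C(N, j)%:R * ((i - j)%:R / (N - j)%:R) :> R.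
  have CNj1 : 'C(N, j.+1)%:R != 0 :> R by rewrite pnatr_eq0 -lt0n bin_gt0.
  have e n : (n - j)%:R * 'C(n, j)%:R = j.+1%:R * 'C(n, j.+1)%:R :> R.
    by rewrite -!natrM mul_bin_left.
  apply: (mulIf CNj1); rewrite divfK//; apply: (@mulfI _ j.+1%:R); first by rewrite pnatr_eq0.
  rewrite -e mulrCA mulrC mulrA -mulrA -e; field; rewrite CNj andbT; exact: lt0r_neq0.
rewrite exprSr; set x := _ / _; set y := _ ^+ j; set z := _ / _ ; set t := _ / N%:R.
have x01 : 0 <= x <= 1.
  rewrite divr_ge0//= ler_pdivrMr ?mul1r ?ler_nat ?leq_bin2l//.
  by rewrite lt0r CNj ler0n.
have t01 : 0 <= t <= 1 by rewrite divr_ge0//= ler_pdivrMr ?mul1r ?ler_nat.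
have z01 : 0 <= z <= 1 by rewrite divr_ge0//= ler_pdivrMr ?mul1r ?ler_nat// leq_sub2r.
have y01 : 0 <= y <= 1 by rewrite exprn_ge0 ?exprn_ile1//; case/andP: t01.
have zt : `|z - t| <= D%:R / (N - D)%:R.
  have [ij|ji] := leqP j i.
    have -> : z - t = - (j%:R * (N - i)%:R / (N%:R * (N - j)%:R)).
      rewrite /z /t !natrB ?(ltnW jN)//.
      have ne1 : N%:R - j%:R != 0 :> R by rewrite -natrB ?(ltnW jN)// lt0r_neq0.
      have ne2 : N%:R != 0 :> R by rewrite lt0r_neq0.
      by field; rewrite ne1 ne2.
    rewrite normrN ger0_norm; last by rewrite divr_ge0 ?mulr_ge0.
    rewrite ler_pdivrMr ?mulr_gt0// mulrAC ler_pdivlMr// -!natrM ler_nat.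
    rewrite mulnA; apply: leq_mul; last exact: leq_sub2l (ltnW jD).
    by apply: leq_mul; [exact: ltnW jD|exact: leq_subr].
  have -> : z = 0.
    by rewrite /z (_ : (i - j = 0)%N) ?mul0r//; apply/eqP; rewrite subn_eq0 ltnW.
  rewrite sub0r normrN ger0_norm; last by case/andP: t01.
  rewrite ler_pdivrMr// mulrAC ler_pdivlMr// -!natrM ler_nat.
  by apply: leq_mul; [exact: ltnW (ltn_trans ji jD)|exact: leq_subr].
have -> : x * z - y * t = (x - y) * z + y * (z - t) by ring.
move: zt IH; set w := D%:R / _ => zt IH.
have -> : j.+1%:R * w = j%:R * w + w by rewrite -[j.+1%:R]natr1 mulrDl mul1r.
apply: le_trans (ler_normD _ _) _; rewrite (normrM _ z) (normrM y).
case/andP: z01 => z0 z1; case/andP: y01 => y0 y1.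
rewrite (ger0_norm z0) (ger0_norm y0); apply: lerD.
  by apply: le_trans IH; rewrite ler_piMr.
by apply: le_trans zt; rewrite ler_piMl.
Qed.

(* Bernstein: a polynomial positive on [0, L] has nonnegative coefficients in the
   Bernstein basis of high degree, so p(A) >= 0 follows from the case of
   X^i (L - X)^j, and the norm bound from M^2 - p^2 >= 0.  This replaces the
   spectral theorem. *)
Lemma poly_bernstein p (L delta : R) : 0 < L -> 0 < delta ->
  (forall x, 0 <= x <= L -> delta <= p.[x]) ->
  exists N (b : nat -> R), (forall i, (i <= N)%N -> 0 <= b i) /\
    p = \sum_(i < N.+1) b i *: ('X^i * (L%:P - 'X) ^+ (N - i)).
Proof.
move=> L0 d0 hp.
pose D := size p.
pose K := \sum_(j < D) `|p`_j| * L ^+ j * (j%:R * D%:R).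
have K0 : 0 <= K by apply: sumr_ge0 => j _; rewrite !mulr_ge0 ?exprn_ge0 ?(ltW L0).
(* The Bernstein coefficient [beta i] differs from the value of p at L i/N by at most K/(N - D); N
   makes this at most the margin [delta]. *)
pose N := (D + (Num.truncn (K / delta)).+1)%N.
have DN : (D < N)%N by rewrite /N addnS ltnS leq_addr.
have ND0 : (0 : R) < (N - D)%:R by rewrite ltr0n subn_gt0.
have KN : K / (N - D)%:R <= delta.
  rewrite ler_pdivrMr// /N addKn mulrC -ler_pdivrMr//.
  by rewrite ltW// truncnS_gt.
have N0 : (0 : R) < N%:R by rewrite ltr0n (leq_ltn_trans _ DN).
pose beta (i : nat) := \sum_(j < D) p`_j * L ^+ j * ('C(i, j)%:R / 'C(N, j)%:R).
have beta0 i : (i <= N)%N -> 0 <= beta i.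
  move=> iN; have /hp : 0 <= L * (i%:R / N%:R) <= L.
    rewrite mulr_ge0 ?divr_ge0 ?(ltW L0)//= ler_piMr ?(ltW L0)// ler_pdivrMr// mul1r.
    by rewrite ler_nat.
  rewrite horner_coef => h.
  have : `|beta i - \sum_(j < size p) p`_j * (L * (i%:R / N%:R)) ^+ j| <= delta.
    apply: le_trans KN; rewrite -sumrB /K mulr_suml.
    apply: le_trans (ler_norm_sum _ _ _) _; apply: ler_sum => j _.
    rewrite exprMn [X in _ - X]mulrA -mulrBr normrM normrM (ger0_norm (exprn_ge0 _ (ltW L0))).
    rewrite -!mulrA; do 2!(rewrite ler_wpM2l ?exprn_ge0 ?(ltW L0)//).
    by apply: bin_ratio_bound => //; exact: ltnW (ltn_ord j).
  move: h; set q := \sum_(j < _) _; rewrite ler_norml => h /andP[+ _]; lra.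
exists N, (fun i => 'C(N, i)%:R / L ^+ N * beta i); split=> [i iN|].
  by rewrite mulr_ge0 ?beta0 ?divr_ge0 ?exprn_ge0 ?(ltW L0).
rewrite -[LHS]coefK poly_def -/D.
have Lne n : L ^+ n != 0 by rewrite expf_neq0 ?lt0r_neq0.
transitivity (\sum_(j < D) \sum_(i < N.+1) (p`_j * (L ^+ j / L ^+ N) / 'C(N, j)%:R) *:
   (('C(i, j) * 'C(N, i))%:R *: ('X^i * (L%:P - 'X) ^+ (N - i))) : {poly R}).
  apply: eq_bigr => j _; rewrite -scaler_sumr.
  have jN : (j <= N)%N by apply: leq_trans (ltnW (ltn_ord j)) (ltnW DN).
  rewrite -bernstein_monomial// scalerA; congr (_ *: _).
  have CNj : 'C(N, j)%:R != 0 :> R by rewrite pnatr_eq0 -lt0n bin_gt0.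
  rewrite -{1}(subnK jN) exprD; field.
  by rewrite CNj !Lne.
rewrite exchange_big/=; apply: eq_bigr => i _.
rewrite /beta mulr_sumr scaler_suml; apply: eq_bigr => j _.
rewrite scalerA natrM; congr (_ *: _); ring.
Qed.
End Bernstein.

Section PolyBound.
Context {R : realType} {d : nat}.
Local Notation H := (l2 R d).
Variables (A : H -> H) (L : R).
Hypothesis linA : linear A.
Hypothesis symA : forall phi psi, ip (A phi) psi = ip phi (A psi).
Hypothesis L0 : 0 < L.
Hypothesis A_ge0 : forall phi, 0 <= ip (A phi) phi.
Hypothesis A_leL : forall phi, ip (A phi) phi <= L * l2sq phi.
Implicit Types (phi psi : H) (p q : {poly R}).

Lemma poly_op_sym p phi psi : ip (poly_op p A phi) psi = ip phi (poly_op p A psi).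
Proof.
elim/poly_ind: p phi => [|p c IH] phi; first by rewrite !poly_op0 (ipC phi) !ip0l.
rewrite !poly_opD !poly_op_mulX !poly_opC ipDl ipDr IH ipZl ipZr symA.
by rewrite poly_opA.
Qed.

Lemma poly_opX phi : poly_op 'X A phi = A phi.
Proof. by rewrite -['X]mul1r poly_op_mulX poly_opC scale1r. Qed.

(** Even parts of the exponents form a square s^2, and the form of s w s at phi is the form of w at
    s(A) phi. This leaves w among 1, X, Y and X Y with Y = L - X. The mixed case follows from L X Y
    = Y (Y X) + X (X Y), again squares around X and Y. *)
Lemma poly_op_monomial_ge0 i j phi :
  0 <= ip (poly_op ('X^i * (L%:P - 'X) ^+ j) A phi) phi.
Proof.
pose Y : {poly R} := L%:P - 'X.
have opY psi : poly_op Y A psi = L%:C *: psi - A psi.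
  by rewrite poly_opB poly_opC poly_opX.
have pX psi : 0 <= ip (poly_op 'X A psi) psi by rewrite poly_opX.
have pY psi : 0 <= ip (poly_op Y A psi) psi.
  by rewrite opY ipDl ipNl ipZl ipsq subr_ge0.
have sq s w psi : ip (poly_op (s * (s * w)) A psi) psi =
    ip (poly_op w A (poly_op s A psi)) (poly_op s A psi).
  by rewrite poly_opM// poly_op_sym (mulrC s w) poly_opM.
have pXY psi : 0 <= ip (poly_op ('X * Y) A psi) psi.
  rewrite -(pmulr_rge0 _ L0) -ipZl -poly_opZ//.
  have -> : L *: ('X * Y) = Y * (Y * 'X) + 'X * ('X * Y).
    by rewrite -mul_polyC /Y; ring.
  by rewrite poly_opD// ipDl !sq addr_ge0.
have -> : 'X^i * Y ^+ j = ('X^(i./2) * Y ^+ (j./2)) * (('X^(i./2) * Y ^+ (j./2)) *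
    ('X^(odd i) * Y ^+ (odd j))).
  rewrite -{1}(odd_double_half i) -{1}(odd_double_half j) -!addnn !exprD; ring.
rewrite sq; case: (odd i) (odd j) => -[]; rewrite ?expr0 ?expr1 ?mulr1 ?mul1r//.
by rewrite poly_opC scale1r ipsq l2sq_ge0.
Qed.

Lemma poly_op_ge0 p delta phi : 0 < delta ->
  (forall x, 0 <= x <= L -> delta <= p.[x]) -> 0 <= ip (poly_op p A phi) phi.
Proof.
move=> d0 /(poly_bernstein L0 d0)[N [b [b0 ->]]].
rewrite poly_op_sum// ip_suml; apply: sumr_ge0 => i _.
rewrite poly_opZ// ipZl mulr_ge0 ?poly_op_monomial_ge0//.
by apply: b0; rewrite -ltnS.
Qed.

Lemma l2norm_poly_op p (M : R) phi : 0 <= M ->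
  (forall x, 0 <= x <= L -> `|p.[x]| <= M) ->
  l2norm (poly_op p A phi) <= M * l2norm phi.
Proof.
move=> M0 hM.
have [p0|pne0] := eqVneq (l2norm phi) 0.
  by rewrite (l2norm_eq0 p0) (lin0 (poly_op_linear linA p)) l2norm0 mulr0.
have p0 : 0 < l2sq phi by rewrite exprn_gt0// lt0r pne0 l2norm_ge0.
rewrite -(@ler_pXn2r _ 2) ?nnegrE ?mulr_ge0 ?l2norm_ge0// exprMn.
rewrite -/(l2sq _) -/(l2sq phi).
apply/ler_addgt0Pl => e e0.
(* M^2 - p^2 may vanish on [0, L], while [poly_op_ge0] asks for a strict margin; adding [delta]
   supplies it and costs exactly e in the form at [phi]. *)
pose delta := e / l2sq phi; have d0 : 0 < delta by rewrite divr_gt0.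
have : 0 <= ip (poly_op ((M ^+ 2 + delta)%:P - p * p) A phi) phi.
  apply: (poly_op_ge0 _ d0) => x /hM xM.
  rewrite !hornerE -expr2 -[p.[x] ^+ 2]real_normK ?num_real//.
  have : `|p.[x]| ^+ 2 <= M ^+ 2 by rewrite lerXn2r ?nnegrE.
  by move: (_ ^+ 2) (_ ^+ 2) => a b; lra.
rewrite poly_opB// poly_opC poly_opM// ipDl ipNl ipZl !poly_op_sym ipsq.
rewrite -(poly_op_sym p) ipsq mulrDl divfK ?lt0r_neq0//.
by move: (l2sq _) (_ * _) => a b; lra.
Qed.

End PolyBound.

Lemma uniform_cvgP (R : realType) (D : set R) (g : nat -> R -> R) (f : R -> R) :
  {uniform D, g @ \oo --> f} <->
  forall e : R, 0 < e -> \forall k \near \oo, forall x, D x -> `|f x - g k x| < e.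
Proof.
split=> [gf e e0|gf P].
  apply: (gf [set h | forall x, D x -> `|f x - h x| < e]).
  apply/uniform_nbhs; exists [set xy | ball xy.1 e xy.2]; split => //.
  exact: entourage_ball (PosNum e0).
move/uniform_nbhs => [E [+ EP]]; rewrite -entourage_ballE => -[e /= e0 eE].
have := gf e e0; apply: filterS => k hk; apply: EP => x Dx.
by apply: eE => /=; exact: hk.
Qed.

(** * Spectrum and functional calculus *)

Section LazySeries.
Context {R : realType} {d : nat}.
Local Notation H := (l2 R d).
Local Notation M := (@lazy_op R d).
Local Notation L3 := (3 * d%:R : R).
Implicit Types (phi psi : H) (n : 'Z^d).

Lemma lazy_op_linear : linear M.
Proof.
move=> c phi psi; apply: l2P => n; rewrite lazy_opE [RHS]l2D l2Z !lazy_opE mulr_sumr.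
by rewrite -big_split; apply: eq_bigr => i _; rewrite !(l2D,l2Z) /=; ring.
Qed.

Lemma iter_linear (T : H -> H) i : linear T -> linear (iter i T).
Proof. by move=> lT; elim: i => [//|i IH] c phi psi; rewrite !iterS IH lT. Qed.

Lemma L3_ge0 : 0 <= L3. Proof. by rewrite mulr_ge0. Qed.

Lemma l2norm_iter_lazy_op i phi : l2norm (iter i M phi) <= L3 ^+ i * l2norm phi.
Proof.
elim: i => [|i IH]; first by rewrite expr0 mul1r.
rewrite iterS exprS -mulrA (le_trans (l2norm_lazy_op _))//.
by rewrite ler_wpM2l ?L3_ge0.
Qed.

Definition lazy_sum (c : nat -> R) (k : nat) phi : H :=
  \sum_(i < k) (c i)%:C *: iter i M phi.

Lemma lazy_sum_linear c k : linear (lazy_sum c k).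
Proof.
move=> a phi psi; rewrite /lazy_sum scaler_sumr -big_split/=.
apply: eq_bigr => i _; rewrite (iter_linear _ lazy_op_linear).
by rewrite scalerDr !scalerA mulrC.
Qed.

Lemma lazy_sumS c k phi : lazy_sum c k.+1 phi = lazy_sum c k phi + (c k)%:C *: iter k M phi.
Proof. by rewrite /lazy_sum big_ord_recr. Qed.

Lemma lazy_sum0 c phi : lazy_sum c 0 phi = 0.
Proof. by rewrite /lazy_sum big_ord0. Qed.

Lemma lazy_sum_dist c k j phi : (k <= j)%N ->
  l2norm (lazy_sum c j phi - lazy_sum c k phi) <=
    (\sum_(k <= i < j) `|c i| * L3 ^+ i) * l2norm phi.
Proof.
move=> kj; rewrite -(subnKC kj); elim: (j - k)%N => [|m IH].
  by rewrite addn0 subrr l2norm0 big_geq// mul0r.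
rewrite addnS lazy_sumS big_nat_recr/= ?leq_addr// mulrDl.
rewrite addrAC; apply: le_trans (l2normD _ _) _; apply: lerD => //.
by rewrite l2normZ -mulrA ler_wpM2l// l2norm_iter_lazy_op.
Qed.

Section Sum.
Variable c : nat -> R.
Hypothesis cvgc : cvgn (series (fun i => `|c i| * L3 ^+ i)).

Definition series_tail (k : nat) : R :=
  limn (series (fun i => `|c i| * L3 ^+ i)) - series (fun i => `|c i| * L3 ^+ i) k.

Lemma series_tail_cvg0 : series_tail k @[k --> \oo] --> (0 : R).
Proof.
rewrite -(subrr (limn (series (fun i => `|c i| * L3 ^+ i)))).
by apply: cvgB => //; exact: cvg_cst.
Qed.

Lemma sum_le_series_tail k j : (k <= j)%N -> \sum_(k <= i < j) `|c i| * L3 ^+ i <= series_tail k.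
Proof.
move=> kj; rewrite /series_tail lerBrDr addrC.
have -> : series (fun i => `|c i| * L3 ^+ i) k + \sum_(k <= i < j) `|c i| * L3 ^+ i =
    series (fun i => `|c i| * L3 ^+ i) j by rewrite /series /= -big_cat_nat.
apply: nondecreasing_cvgn_le => //; apply: nondecreasing_series => i _ _.
by rewrite mulr_ge0 ?exprn_ge0 ?L3_ge0.
Qed.

Lemma lazy_series_ex : exists S : H -> H, [/\ bounded_linear S,
    (forall k phi, l2norm (S phi - lazy_sum c k phi) <= series_tail k * l2norm phi) &
    forall phi n, (complex.Re (lazy_sum c k phi n) @[k --> \oo] --> complex.Re (S phi n)) /\
              (complex.Im (lazy_sum c k phi n) @[k --> \oo] --> complex.Im (S phi n))].
Proof.
apply: op_cauchy_cvg.
- exact: lazy_sum_linear.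
- exact: series_tail_cvg0.
- move=> k j phi kj; apply: le_trans (lazy_sum_dist c phi kj) _.
  by rewrite ler_wpM2r ?l2norm_ge0 ?sum_le_series_tail.
- by exists 0 => phi; rewrite lazy_sum0 l2norm0 mul0r.
Qed.

End Sum.

Lemma neg_laplacian_sub_lazy (x : R) phi :
  neg_laplacian R d phi - x%:C *: phi = (L3 - x)%:C *: phi - M phi.
Proof.
apply: l2P => n; rewrite !(l2D,l2N,l2Z) rmorphB mulrBl opprD opprK.
by rewrite addrACA subrr add0r addrC.
Qed.

Lemma lazy_resolvent_telescope (y : R) k phi : y != 0 ->
  lazy_sum (fun i => y ^- i.+1) k (y%:C *: phi - M phi) = phi - (y ^- k)%:C *: iter k M phi.
Proof.
move=> y0; elim: k => [|k IH]; first by rewrite lazy_sum0 expr0 invr1 rmorph1 scale1r subrr.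
rewrite lazy_sumS IH iterSr.
have -> : iter k M (y%:C *: phi - M phi) = y%:C *: iter k M phi - iter k M (M phi).
  rewrite -scaleN1r -(addrC (_ *: M phi)) (iter_linear k lazy_op_linear).
  by rewrite scaleN1r addrC (linZ (iter_linear k lazy_op_linear)).
apply: l2P => n; rewrite !(l2D,l2N,l2Z).
have -> : y ^- k = y ^- k.+1 * y by rewrite exprS invfM mulrC mulVKf.
by rewrite rmorphM; ring.
Qed.

Lemma lazy_sum_lazy_op c k phi : lazy_sum c k (M phi) = M (lazy_sum c k phi).
Proof.
rewrite /lazy_sum (lin_sum lazy_op_linear); apply: eq_bigr => i _.
by rewrite (linZ lazy_op_linear) -iterSr.
Qed.

(** The remainder y^(-k) M^k phi of the truncated Neumann series tends to 0, since the norm of M is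
    at most 3d < |y|. Both inverse identities reduce to this: [chi] is the defect, and the term with
    C is the truncation error. *)
Lemma cvg_iter_lazy_op_scaled (y : R) phi (chi : H) (C : R) : L3 < `|y| ->
  (forall (e : R), 0 < e -> \forall k \near \oo,
     l2norm chi <= e * C + l2norm ((y ^- k)%:C *: iter k M phi)) -> chi = 0.
Proof.
move=> ly h; apply: bound_l2norm_le0 => e e0.
have y0 : 0 < `|y| by apply: le_lt_trans ly; exact: L3_ge0.
pose K := `|C| + l2norm phi + 1.
have K0 : 0 < K by rewrite ltr_wpDl// addr_ge0 ?l2norm_ge0.
have eK0 : 0 < e / K by rewrite divr_gt0.
have : (L3 / `|y|) ^+ k @[k --> \oo] --> (0 : R).
  apply: cvg_expr; rewrite ger0_norm ?divr_ge0 ?L3_ge0//.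
  by rewrite ltr_pdivrMr// mul1r.
move/cvgrPdist_lt/(_ _ eK0) => h1.
have [k [/= hk1 hk2]] := filter_ex (filterI h1 (h _ eK0)).
apply: le_trans hk2 _.
rewrite sub0r normrN ger0_norm ?exprn_ge0 ?divr_ge0 ?L3_ge0// in hk1.
have eE : e / K * `|C| + (e / K * l2norm phi + e / K) = e.
  by rewrite -[X in _ + (_ + X)]mulr1 -!mulrDr addrA divfK// lt0r_neq0.
rewrite -[leRHS]eE.
apply: lerD; first by rewrite ler_wpM2l ?ler_norm// ltW.
rewrite l2normZ normfV normrX.
apply: (@le_trans _ _ (`|y| ^- k * (L3 ^+ k * l2norm phi))).
  by rewrite ler_wpM2l ?invr_ge0 ?exprn_ge0// l2norm_iter_lazy_op.
rewrite mulrA [X in X * _ <= _]mulrC -expr_div_n.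
by rewrite ler_wpDr ?(ltW eK0)// ler_wpM2r ?l2norm_ge0// ltW.
Qed.

Lemma cvgn_resolvent (y : R) : L3 < `|y| ->
  cvgn (series (fun i => `|y ^- i.+1| * L3 ^+ i)).
Proof.
move=> ly.
have y0 : 0 < `|y| by apply: le_lt_trans ly; exact: L3_ge0.
have -> : (fun i => `|y ^- i.+1| * L3 ^+ i) = geometric (`|y|^-1) (L3 / `|y|).
  apply/funext => i; rewrite /geometric /= normfV normrX exprS invfM expr_div_n.
  by rewrite -[LHS]mulrA; congr (_ * _); exact: mulrC.
apply: is_cvg_geometric_series; rewrite ger0_norm ?divr_ge0 ?L3_ge0//.
by rewrite ltr_pdivrMr// mul1r.
Qed.

(* For |3d - x| > 3d the Neumann series inverts A - x. *)
Lemma real_spectrum_sub (x : R) :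
  spectrum (neg_laplacian R d) x%:C -> `|L3 - x| <= L3.
Proof.
move=> specx; rewrite leNgt; apply/negP => ltx; apply: specx.
set y := L3 - x in ltx.
have y0 : y != 0 by rewrite -normr_gt0; apply: le_lt_trans ltx; exact: L3_ge0.
have [S [bS hS _]] := lazy_series_ex (cvgn_resolvent ltx).
have t0 := series_tail_cvg0 (cvgn_resolvent ltx).
set t := series_tail _ in hS t0.
exists S; split; first exact: bS.
have small (e : R) : 0 < e -> \forall k \near \oo, t k <= e.
  move=> e0; move/cvgrPdist_le/(_ _ e0): t0; apply: filterS => k.
  by rewrite sub0r normrN; exact: le_trans (ler_norm _).
split=> phi; rewrite neg_laplacian_sub_lazy -/y.
  set psi := _ - M phi.
  apply/eqP; rewrite -subr_eq0; apply/eqP.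
  apply: (@cvg_iter_lazy_op_scaled y phi _ (l2norm psi)) => // e e0.
  near=> k.
  have -> : S psi - phi = (S psi - lazy_sum (fun i => y ^- i.+1) k psi) -
      (y ^- k)%:C *: iter k M phi.
    rewrite lazy_resolvent_telescope//.
    by apply: l2P => n; rewrite !(l2D,l2N) opprB addrA addrAC addrK.
  apply: le_trans (l2normB _ _) _; rewrite lerD2r.
  apply: le_trans (hS k psi) _; rewrite ler_wpM2r ?l2norm_ge0//.
  by near: k; exact: small.
apply/eqP; rewrite -subr_eq0; apply/eqP.
pose C := (`|y| + L3) * l2norm phi.
apply: (@cvg_iter_lazy_op_scaled y phi _ C) => // e e0.
near=> k.
have -> : y%:C *: S phi - M (S phi) - phi =
    (y%:C *: (S phi - lazy_sum (fun i => y ^- i.+1) k phi)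
      - M (S phi - lazy_sum (fun i => y ^- i.+1) k phi))
     - (y ^- k)%:C *: iter k M phi.
  have := lazy_resolvent_telescope k phi y0.
  have lS c : lazy_sum c k (y%:C *: phi - M phi) =
      y%:C *: lazy_sum c k phi - M (lazy_sum c k phi).
    rewrite addrC -scaleN1r (lazy_sum_linear c k) (linZ (lazy_sum_linear c k)).
    by rewrite lazy_sum_lazy_op scaleN1r addrC.
  rewrite lS; set Lk := lazy_sum _ _ _ => e1.
  have -> : (y ^- k)%:C *: iter k M phi = phi - (y%:C *: Lk - M Lk).
    by rewrite e1 opprB addrCA subrr addr0.
  have -> : M (S phi - Lk) = M (S phi) - M Lk.
    by rewrite addrC -scaleN1r lazy_op_linear scaleN1r addrC.
  apply: l2P => n; rewrite !(l2D,l2N,l2Z).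
  move: (l2_fun (M (S phi)) n) (l2_fun (M Lk) n) (l2_fun (S phi) n) => u v w.
  move: (l2_fun Lk n) (l2_fun phi n) => u' v'; ring.
apply: le_trans (l2normB _ _) _; rewrite lerD2r.
apply: le_trans (l2normB _ _) _; rewrite l2normZ.
apply: le_trans (lerD (lexx _) (l2norm_lazy_op _)) _.
rewrite -mulrDl /C [leRHS]mulrCA ler_wpM2l ?addr_ge0 ?L3_ge0//.
apply: le_trans (hS k phi) _; rewrite ler_wpM2r ?l2norm_ge0//.
by near: k; exact: small.
Unshelve. all: by end_near. Qed.

End LazySeries.

(** * Approximate eigenvectors of the Laplacian *)

Section ApproximateEigenvector.
Context {R : realType}.

Lemma sum_geometric_sym (r : R) N : 0 <= r -> r < 1 ->
  \sum_(i < N.*2.+1) r ^+ `|i%:Z - N%:Z| <= 2 / (1 - r).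
Proof.
move=> r0 r1.
have d0 : 0 < 1 - r by rewrite subr_gt0.
(* The remainder 2 r^(N+1) is kept in order to make the induction on N close. *)
suff : (\sum_(i < N.*2.+1) r ^+ `|i%:Z - N%:Z|) * (1 - r) <= 2 - 2 * r ^+ N.+1.
  rewrite ler_pdivlMr//; move/le_trans; apply.
  by rewrite gerBl mulr_ge0 ?exprn_ge0.
elim: N => [|N IH].
  by rewrite big_ord1 subrr/= expr0 expr1; lra.
rewrite doubleS big_ord_recl big_ord_recr/=.
rewrite subn0.
have -> : `|(bump 0 N.*2.+1)%:Z - N.+1%:Z|%N = N.+1 by rewrite /bump/=; lia.
under eq_bigr => i _.
  have -> : `|(bump 0 i)%:Z - N.+1%:Z|%N = `|i%:Z - N%:Z|%N by rewrite /bump/=; lia.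
  over.
move: IH; move: (\sum_(i < _) _) => s; rewrite (exprS r N.+1); move: (r ^+ N.+1) => t.
nra.
Qed.

Variable d : nat.
Local Notation H := (l2 R d).
Implicit Types n : 'Z^d.

Definition geom_weight (r : R) n : R := \prod_(j < d) r ^+ `|n 0 j|.

(** F lies in a cube [-N, N]^d, over which the sum factors into d geometric sums whose bound does
    not depend on N. *)
Lemma geom_weight_fsum (r : R) (F : set 'Z^d) : 0 <= r -> r < 1 -> finite_set F ->
  \sum_(n \in F) geom_weight r n <= (2 / (1 - r)) ^+ d.
Proof.
move=> r0 r1 fF.
have [N hN] : exists N, forall n, F n -> forall j, (`|n 0%R j| <= N)%N.
  exists (\max_(n <- fset_set F) \max_(j < d) `|n 0%R j|)%N => n Fn j.
  apply: leq_trans (@leq_bigmax _ (fun j : 'I_d => absz (n 0%R j)) j) _.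
  by apply: (leq_bigmax_seq (F := fun n : 'Z^d => \max_(j < d) `|n 0%R j|)%N) => //; rewrite in_fset_set// inE.
pose vec (f : {ffun 'I_d -> 'I_N.*2.+1}) : 'Z^d := \row_j ((f j : nat)%:Z - N%:Z).
have injv : injective vec.
  move=> f g /rowP fg; apply/ffunP => j; move: (fg j); rewrite !mxE => /addIr[] e.
  by apply/val_inj.
pose s := [seq vec f | f <- index_enum {ffun 'I_d -> 'I_N.*2.+1}].
have us : uniq s by rewrite map_inj_uniq// index_enum_uniq.
have Fs n : F n -> n \in s.
  move=> Fn.
  have lt j : (absz (n 0%R j + N%:Z)%R < N.*2.+1)%N by move: (hN n Fn j); lia.
  apply/mapP; exists [ffun j => Ordinal (lt j)]; first by rewrite mem_index_enum.
  apply/rowP => j; rewrite mxE ffunE/=; move: (hN n Fn j); lia.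
have w0 n : 0 <= geom_weight r n by apply: prodr_ge0 => j _; rewrite exprn_ge0.
apply: (@le_trans _ _ (\sum_(n <- s) geom_weight r n)).
  rewrite fsbig_finite//= [leRHS](bigID (fun n => n \in fset_set F))/=.
  have ps : perm_eq [seq x <- s | x \in fset_set F] (fset_set F).
    apply: uniq_perm; [by rewrite filter_uniq|exact: fset_uniq|move=> n].
    rewrite mem_filter; case: (boolP (n \in fset_set F)) => //=.
    by rewrite in_fset_set// inE => /Fs ->.
  rewrite -[X in _ <= X + _]big_filter (perm_big _ ps)/=.
  by rewrite lerDl sumr_ge0.
rewrite big_map; rewrite (eq_bigr (fun f : {ffun 'I_d -> 'I_N.*2.+1} => 
    \prod_(j < d) r ^+ `|(f j : nat)%:Z - N%:Z|)); last first.
  by move=> f _; apply: eq_bigr => j _; rewrite mxE.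
rewrite -(bigA_distr_bigA (fun (j : 'I_d) (i : 'I_N.*2.+1) => r ^+ `|(i : nat)%:Z - N%:Z|)).
rewrite prodr_const card_ord lerXn2r ?nnegrE ?sum_geometric_sym//.
  by rewrite sumr_ge0// => i _; rewrite exprn_ge0.
by rewrite divr_ge0// subr_ge0 ltW.
Qed.

Variables (theta rho : R).
Hypothesis rho0 : 0 < rho.
Hypothesis rho1 : rho < 1.

Definition wave1 (k : int) : R[i] :=
  (cos (theta * k%:~R) * rho ^+ `|k|) +i* (sin (theta * k%:~R) * rho ^+ `|k|).

Definition wave_fun n : R[i]^o := \prod_(j < d) wave1 (n 0 j).

Lemma normc_wave1 k : Normc.normc (wave1 k) = rho ^+ `|k|.
Proof.
rewrite /wave1 /= !exprMn -mulrDl cos2Dsin2 mul1r sqrtr_sqr ger0_norm//.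
by rewrite exprn_ge0 ?ltW.
Qed.

Lemma normc_prod (I : Type) (s : seq I) (P : pred I) (f : I -> R[i]) :
  Normc.normc (\prod_(i <- s | P i) f i) = \prod_(i <- s | P i) Normc.normc (f i).
Proof.
by apply: (big_morph _ (@Normc.normcM R)); rewrite Normc.normc1.
Qed.

Lemma sqnormc_wave n : sqnormc (wave_fun n) = geom_weight (rho ^+ 2) n.
Proof.
rewrite -sqnormcE normc_prod -prodrXl; apply: eq_bigr => j _.
by rewrite normc_wave1 exprAC.
Qed.

Lemma wave_l2 : wave_fun \in @l2_pred R d.
Proof.
apply: (sqr_summable_bound (c := (2 / (1 - rho ^+ 2)) ^+ d)) => F fF.
under eq_fsbigr do rewrite sqnormc_wave.
apply: geom_weight_fsum => //; first by rewrite exprn_ge0 ?ltW.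
by rewrite expr_lt1// ltW.
Qed.

Definition wave : H := L2 wave_l2.

Lemma wave_neq0 : wave != 0.
Proof.
apply/eqP => /(congr1 (fun phi : H => sqnormc (phi 0))).
rewrite l20 [sqnormc (wave 0)]sqnormc_wave /sqnormc/= expr0n addr0 => /eqP.
rewrite /geom_weight big1 ?oner_eq0// => j _.
by rewrite mxE expr0.
Qed.

Lemma geom_step (k l : int) : `|k - l| = 1 ->
  `|rho ^+ `|k| - rho ^+ `|l| | <= (rho^-1 - 1) * rho ^+ `|k|.
Proof.
move=> kl; have r0 : rho != 0 by rewrite lt0r_neq0.
have p0 m : 0 <= rho ^+ m by rewrite exprn_ge0 ?ltW.
have rinv : 1 < rho^-1 by rewrite invf_gt1.
have [e|e] : `|l|%N = `|k|.+1 \/ `|k|%N = `|l|.+1 by lia.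
  rewrite e exprS -[X in X - _]mul1r -mulrBl normrM (ger0_norm (p0 _)).
  rewrite ler_wpM2r// ger0_norm ?subr_ge0 ?(ltW rho1)//.
  have : 0 <= (rho - 1) ^+ 2 / rho by rewrite divr_ge0 ?sqr_ge0// ltW.
  have -> : (rho - 1) ^+ 2 / rho = rho + rho^-1 - 2 by field.
  lra.
rewrite e exprS -[X in _ - X]mul1r -mulrBl normrM (ger0_norm (p0 _)).
rewrite mulrA ler_wpM2r// ler0_norm ?subr_le0 ?(ltW rho1)//.
by rewrite mulrBl mulVf// mul1r opprB.
Qed.

(** The undamped wave satisfies u(k-1) + u(k+1) = 2 cos(theta) u(k) exactly. What is left is the
    change of the damping factor between neighbours, of relative size at most 1/rho - 1. *)
Lemma wave1_step k : Normc.normc ((2 * cos theta)%:C * wave1 k -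
    wave1 (k - 1) - wave1 (k + 1)) <= 2 * (rho^-1 - 1) * rho ^+ `|k|.
Proof.
pose u (l : int) : R[i] := cos (theta * l%:~R) +i* sin (theta * l%:~R).
have nu l : Normc.normc (u l) = 1 by rewrite /u /= cos2Dsin2 sqrtr1.
have -> : (2 * cos theta)%:C * wave1 k - wave1 (k - 1) - wave1 (k + 1) =
   u (k - 1) * (rho ^+ `|k| - rho ^+ `|k - 1|)%:C +
   u (k + 1) * (rho ^+ `|k| - rho ^+ `|k + 1|)%:C.
  rewrite /u /wave1 !intrD mulrDr mulrDr rmorphN1 mulrN1 mulr1.
  rewrite !cosD !sinD cosN sinN; simpc.
  by apply/eqP; rewrite eq_complex /=; apply/andP; split; apply/eqP; ring.
apply: le_trans (le_normcD _ _) _; rewrite !Normc.normcM !nu !mul1r.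
have nr (x : R) : Normc.normc x%:C = `|x|.
  by rewrite /= expr0n addr0 sqrtr_sqr.
have -> : 2 * (rho^-1 - 1) * rho ^+ `|k| =
  (rho^-1 - 1) * rho ^+ `|k| + (rho^-1 - 1) * rho ^+ `|k| by ring.
by rewrite !nr; apply: lerD; apply: geom_step; lia.
Qed.

Lemma wave_pointwise n :
  Normc.normc ((neg_laplacian R d wave - (d%:R * (2 - 2 * cos theta))%:C *: wave) n)
    <= d%:R * (2 * (rho^-1 - 1)) * Normc.normc (wave n).
Proof.
pose rest j : R[i] := \prod_(i < d | i != j) wave1 (n 0 i).
have w0 j : wave n = wave1 (n 0 j) * rest j.
  by rewrite /wave /wave_fun /l2_fun (bigD1 j).
have wp j : wave (n + unitv j) = wave1 (n 0 j + 1) * rest j.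
  rewrite /wave /wave_fun /l2_fun (bigD1 j)//= !mxE !eqxx; congr (_ * _).
  by apply: eq_bigr => i ij; rewrite !mxE (negbTE ij) andbF addr0.
have wm j : wave (n - unitv j) = wave1 (n 0 j - 1) * rest j.
  rewrite /wave /wave_fun /l2_fun (bigD1 j)//= !mxE !eqxx; congr (_ * _).
  by apply: eq_bigr => i ij; rewrite !mxE (negbTE ij) andbF subr0.
have -> : (neg_laplacian R d wave - (d%:R * (2 - 2 * cos theta))%:C *: wave) n =
  \sum_(j < d) ((2 * cos theta)%:C * wave1 (n 0 j) -
    wave1 (n 0 j - 1) - wave1 (n 0 j + 1)) * rest j.
  rewrite l2D l2N l2Z neg_laplacianE.
  have -> : (d%:R * (2 - 2 * cos theta))%:C * wave n =
      \sum_(j < d) (2 - 2 * cos theta)%:C * wave n.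
    by rewrite sumr_const card_ord -[RHS]mulr_natl mulrA rmorphM rmorph_nat.
  rewrite -sumrB; apply: eq_bigr => j _; rewrite wp wm (w0 j).
  by rewrite rmorphB rmorph_nat; ring.
have nsum (f : 'I_d -> R[i]) : Normc.normc (\sum_(j < d) f j) <= \sum_(j < d) Normc.normc (f j).
  elim/big_ind2: _ => // [|x x' y y' h1 h2]; first by rewrite Normc.normc0.
  by apply: le_trans (le_normcD _ _) _; exact: lerD.
apply: le_trans (nsum _) _.
have -> : d%:R * (2 * (rho^-1 - 1)) * Normc.normc (wave n) =
    \sum_(j < d) 2 * (rho^-1 - 1) * Normc.normc (wave n).
  by rewrite sumr_const card_ord -[RHS]mulr_natl -[LHS]mulrA.
apply: ler_sum => j _; rewrite (w0 j) !Normc.normcM mulrA normc_wave1 ler_wpM2r//.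
  by rewrite /Normc.normc; case: (rest j) => x y; rewrite sqrtr_ge0.
exact: wave1_step.
Qed.

Lemma wave_approx :
  l2norm (neg_laplacian R d wave - (d%:R * (2 - 2 * cos theta))%:C *: wave)
    <= d%:R * (2 * (rho^-1 - 1)) * l2norm wave.
Proof.
have K0 : 0 <= d%:R * (2 * (rho^-1 - 1)).
  by rewrite !mulr_ge0// subr_ge0 ltW// invf_gt1.
rewrite -(@ler_pXn2r _ 2) ?nnegrE ?l2norm_ge0 ?(mulr_ge0 K0 (l2norm_ge0 _))// exprMn.
set psi := _ - _; rewrite -[_ ^+ 2]/(l2sq psi) -[l2norm wave ^+ 2]/(l2sq wave).
have := @l2sq_le2 _ _ _ 0 psi wave wave (sqr_ge0 (d%:R * (2 * (rho^-1 - 1)))) (lexx 0).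
rewrite mul0r addr0; apply => n; rewrite mul0r addr0 -!sqnormcE -exprMn.
have nge0 (z : R[i]) : 0 <= Normc.normc z by case: z => x y; rewrite sqrtr_ge0.
by rewrite lerXn2r ?nnegrE ?nge0 ?(mulr_ge0 K0 (nge0 _))//; exact: wave_pointwise.
Qed.

End ApproximateEigenvector.

(* The functional calculus only sees polynomials on the spectrum, whereas the norm
   bound needs all of [0, 4d]; plane waves damped by rho ^ |n|, rho -> 1, are
   approximate eigenvectors and show that nothing is missing. *)
Lemma spectrum_neg_laplacian (R : realType) (d : nat) (x : R) : (0 < d)%N ->
  0 <= x <= 4 * d%:R -> spectrum (neg_laplacian R d) x%:C.
Proof.
move=> d0 /andP[x0 xd] [B [[linB [M hM]] [BA _]]].
have dR : (0 : R) < d%:R by rewrite ltr0n.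
(* All coordinates use the same angle: d (2 - 2 cos theta) = x, and x in [0, 4d] is exactly what
   puts this cosine in [-1, 1]. *)
pose c := 1 - x / (2 * d%:R).
have c1 : -1 <= c <= 1.
  have : x / (2 * d%:R) <= 2 by rewrite ler_pdivrMr ?mulr_gt0// mulrA -natrM.
  have : 0 <= x / (2 * d%:R) by rewrite divr_ge0// mulr_ge0.
  by rewrite /c; move: (x / _) => y h1 h2; apply/andP; split; lra.
pose theta := acos c.
have ct : cos theta = c by apply: acosK; rewrite in_itv.
have xE : d%:R * (2 - 2 * cos theta) = x.
  by rewrite ct /c; field; rewrite lt0r_neq0.
(* With 1/rho - 1 = 1/K, applying the alleged inverse B, of bound M, to the defect of the wave gives
   |phi| <= (2d|M|/K) |phi|, where the factor is below 1. *)
pose K := 2 * d%:R * `|M| + 1.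
have K0 : 0 < K by rewrite ltr_wpDl// !mulr_ge0// ltW.
pose rho := (1 + 1 / K)^-1.
have iK0 : 0 < 1 / K by rewrite divr_gt0.
have rho0 : 0 < rho by rewrite invr_gt0 addr_gt0.
have rho1 : rho < 1 by rewrite invf_lt1 ?addr_gt0// ltrDl.
pose phi := @wave R d theta rho rho0 rho1.
have := @wave_approx R d theta rho rho0 rho1; rewrite xE -/phi => h.
have pn0 : 0 < l2norm phi.
  rewrite lt0r l2norm_ge0 andbT; apply/negP => /eqP /l2norm_eq0 p0.
  by have := @wave_neq0 R d theta rho rho0 rho1; rewrite -/phi p0 eqxx.
have := hM (neg_laplacian R d phi - x%:C *: phi); rewrite BA => h2.
have : l2norm phi <= `|M| * (d%:R * (2 * (rho^-1 - 1)) * l2norm phi).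
  apply: le_trans h2 _; apply: le_trans (ler_wpM2r (l2norm_ge0 _) (ler_norm M)) _.
  by rewrite ler_wpM2l.
rewrite /rho invrK addrAC subrr add0r !mulrA -{1}[l2norm phi]mul1r ler_pM2r//.
apply/negP; rewrite -ltNge mulr1 ltr_pdivrMr// mul1r /K.
have -> : `|M| * d%:R * 2 = 2 * d%:R * `|M| by ring.
by rewrite ltrDl.
Qed.

(** * Identification of the functional calculus with the series *)

Section FunCalc.
Context {R : realType} {d : nat}.
Hypothesis d0 : (0 < d)%N.
Local Notation H := (l2 R d).
Local Notation M := (@lazy_op R d).
Local Notation L3 := (3 * d%:R : R).
Local Notation A := (neg_laplacian R d).
Implicit Types (phi psi : H) (n : 'Z^d).
Variables (c : nat -> R) (f : R -> R).
Hypothesis cvgc : cvgn (series (fun i => `|c i| * L3 ^+ i)).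
Hypothesis cvgf : forall x, `|L3 - x| <= L3 ->
  series (fun i => c i * (L3 - x) ^+ i) k @[k --> \oo] --> f x.

Definition lazy_poly (k : nat) : {poly R} := \sum_(i < k) c i *: (L3%:P - 'X) ^+ i.

Lemma poly_op_lazy_poly k phi : poly_op (lazy_poly k) A phi = lazy_sum c k phi.
Proof.
have lA := @neg_laplacian_linear R d.
rewrite /lazy_poly /lazy_sum poly_op_sum; apply: eq_bigr => i _.
rewrite poly_opZ; congr (_ *: _).
elim: (nat_of_ord i) => [|j IH]; first by rewrite expr0 poly_opC scale1r.
by rewrite exprS (poly_opM lA) IH (poly_opB A) poly_opC (poly_opX A).
Qed.

Lemma lazy_poly_dist k x : `|L3 - x| <= L3 ->
  `|f x - (lazy_poly k).[x]| <= @series_tail R d c k.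
Proof.
move=> xL.
have E j : (lazy_poly j).[x] = series (fun i => c i * (L3 - x) ^+ i) j.
  by rewrite /lazy_poly horner_sum /series/= big_mkord; apply: eq_bigr => i _; rewrite !hornerE.
have : `|(lazy_poly j).[x] - (lazy_poly k).[x]| @[j --> \oo] --> `|f x - (lazy_poly k).[x]|.
  apply: cvg_norm; apply: cvgB; last exact: cvg_cst.
  by under eq_fun do rewrite E; exact: cvgf.
move/cvgr_to_le; apply; exists k => // j /= kj.
apply: le_trans (sum_le_series_tail cvgc kj).
rewrite !E /series /= (big_cat_nat (n := k))//= [X in `|X|]addrC addKr.
apply: le_trans (ler_norm_sum _ _ _) _; apply: ler_sum => i _.
by rewrite normrM normrX ler_wpM2l// lerXn2r ?nnegrE ?L3_ge0.
Qed.

(** If p_k is close to f on the spectrum, then p_k minus a fixed partial sum is small on [0, 4d],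
    hence small as an operator, by the norm bound for polynomials. So the sum of the series is one
    admissible value; it must also be shown to be the only one before [fun_calc] can be
    evaluated. *)
Lemma fun_calc_series : exists S : H -> H, fun_calc A f = S /\
  forall phi n, (complex.Re (lazy_sum c k phi n) @[k --> \oo] --> complex.Re (S phi n)) /\
              (complex.Im (lazy_sum c k phi n) @[k --> \oo] --> complex.Im (S phi n)).
Proof.
have [S [bS hS cS]] := lazy_series_ex cvgc; exists S; split => //.
have lA := @neg_laplacian_linear R d.
have t0 := series_tail_cvg0 cvgc; set t := series_tail _ in hS t0.
have small (e : R) : 0 < e -> \forall k \near \oo, t k < e.
  move=> e0; move/cvgrPdist_lt/(_ _ e0): t0; apply: filterS => k.
  by rewrite sub0r normrN; exact: le_lt_trans (ler_norm _).
have calcS : is_fun_calc A f S.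
  split=> // p /uniform_cvgP hp e e0.
  have e40 : 0 < e / 4 by rewrite divr_gt0.
  have [j /= tj] := filter_ex (small _ e40).
  have := hp _ e40; apply: filterS => k hk phi.
  have -> : poly_op (p k) A phi - S phi =
      poly_op (p k - lazy_poly j) A phi - (S phi - lazy_sum c j phi).
    rewrite poly_opB poly_op_lazy_poly; apply: l2P => n; rewrite !(l2D,l2N).
    by move: (l2_fun _ n) (l2_fun _ n) (l2_fun _ n) => u v w; ring.
  apply: le_trans (l2normB _ _) _.
  have -> : e * l2norm phi = (3 * (e / 4)) * l2norm phi + e / 4 * l2norm phi.
    by rewrite -mulrDl; congr (_ * _); field.
  apply: lerD; last first.
    by apply: le_trans (hS j phi) _; rewrite ler_wpM2r ?l2norm_ge0// ltW.
  apply: (@l2norm_poly_op R d A (4 * d%:R)) => //.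
  - exact: neg_laplacian_sym.
  - by rewrite mulr_gt0 ?ltr0n.
  - exact: neg_laplacian_ge0.
  - exact: neg_laplacian_le.
  - by rewrite mulr_ge0// ltW.
  move=> x x4; have xL : `|L3 - x| <= L3.
    have dR : (0 : R) < d%:R by rewrite ltr0n.
    by move: x4 => /andP[x0 x1]; rewrite ler_norml; apply/andP; split; lra.
  rewrite hornerD hornerN.
  have := hk x (spectrum_neg_laplacian d0 x4).
  have := lazy_poly_dist j xL; rewrite -/t => h1 h2.
  have -> : (p k).[x] - (lazy_poly j).[x] = (f x - (lazy_poly j).[x]) - (f x - (p k).[x]).
    by ring.
  apply: le_trans (ler_normB _ _) _.
  by move: h1 h2 tj e40; move: `|_| `|_| (t j) (e / 4) => u v w z; lra.
(* Uniqueness: the partial sums are themselves polynomials converging uniformly to f on the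
   spectrum, so any admissible T is their limit as well. *)
apply: xget_unique => // T [bT hT]; apply/funext => phi.
have ulp : {uniform [set x : R | spectrum A x%:C],
    (fun k x => (lazy_poly k).[x]) @ \oo --> f}.
  apply/uniform_cvgP => e e0; have := small _ e0; apply: filterS => k tk x /=.
  by move=> /real_spectrum_sub /(lazy_poly_dist k) h; exact: le_lt_trans h tk.
apply/eqP; rewrite -subr_eq0; apply/eqP; apply: bound_l2norm_le0 => e e0.
have e10 : 0 < e / (2 * (l2norm phi + 1)).
  by rewrite divr_gt0// mulr_gt0// ltr_wpDl ?l2norm_ge0.
have [k [/= h1 h2]] := filter_ex (filterI (hT _ ulp _ e10) (small _ e10)).
have -> : T phi - S phi = - (poly_op (lazy_poly k) A phi - T phi)
   - (S phi - lazy_sum c k phi).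
  rewrite poly_op_lazy_poly; apply: l2P => n; rewrite !(l2D,l2N).
  by move: (l2_fun _ n) (l2_fun _ n) (l2_fun _ n) => u v w; ring.
apply: le_trans (l2normB _ _) _; rewrite l2normN.
apply: le_trans (lerD (h1 phi) (hS k phi)) _.
apply: (@le_trans _ _ (e / (2 * (l2norm phi + 1)) * l2norm phi +
                       e / (2 * (l2norm phi + 1)) * l2norm phi)).
  by rewrite lerD2l ler_wpM2r ?l2norm_ge0// ltW.
have := l2norm_ge0 phi; move: (l2norm phi) => y y0.
have -> : e / (2 * (y + 1)) * y + e / (2 * (y + 1)) * y = e * (y / (y + 1)).
  by field; rewrite lt0r_neq0// ltr_wpDl.
rewrite ler_piMr ?(ltW e0)// ler_pdivrMr ?ltr_wpDl// mul1r; lra.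
Qed.

End FunCalc.

(** * Lattice walks as matrix elements *)

(** The hold step is counted once per direction. Each step is then a sum of d one-dimensional lazy
    steps, which is what makes the heat kernel a product. *)
Fixpoint lattice_walks (d : nat) (k : nat) (n : 'Z^d) : nat :=
  if k is k'.+1 then
    (\sum_(i < d) (lattice_walks k' n + lattice_walks k' (n - unitv i)
      + lattice_walks k' (n + unitv i)))%N
  else (n == 0).

Section MatrixElements.
Context {R : realType} {d : nat}.
Hypothesis d0 : (0 < d)%N.
Local Notation H := (l2 R d).
Local Notation M := (@lazy_op R d).
Local Notation L3 := (3 * d%:R : R).
Implicit Types (n m : 'Z^d).

Lemma inner_delta n (psi : H) : inner (delta R d n) psi = psi n.
Proof.
unfold inner, summability.sum.
have haus : hausdorff_space (R[i]^o : normedModType R[i]) by exact: norm_hausdorff.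
have FF := @summability.totally_filter 'Z^d.
apply: (cvg_lim haus).
apply: cvg_near_cst; exists [fset n]%fset => // B /= nB.
have nB' : n \in B by apply: (fsubsetP nB); rewrite in_fset1.
rewrite /summability.partial_sum (bigD1 [` nB']%fset)//= big1 => [|i ne].
  by rewrite /delta /l2_fun /delta_fun eqxx rmorph1 mul1r addr0.
rewrite /delta /l2_fun /delta_fun.
have /negbTE -> : val i != n.
  by apply: contra ne => /eqP e; apply/eqP/val_inj.
by rewrite rmorph0 mul0r.
Qed.

Lemma iter_lazy_op_delta k m n : iter k M (delta R d m) n = (lattice_walks k (n - m))%:R.
Proof.
elim: k n => [|k IH] n; first by rewrite /= subr_eq0.
rewrite iterS lazy_opE /= natr_sum; apply: eq_bigr => i _.
by rewrite !IH !natrD [n - unitv i - m]addrAC [n + unitv i - m]addrAC.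
Qed.

Lemma lazy_sum_delta (c : nat -> R) k m n :
  lazy_sum c k (delta R d m) n = (\sum_(i < k) c i * (lattice_walks i (n - m))%:R)%:C.
Proof.
rewrite /lazy_sum l2_sumE rmorph_sum; apply: eq_bigr => i _.
by rewrite l2Z iter_lazy_op_delta rmorphM rmorph_nat.
Qed.

Lemma frac_laplacian_mxE (alpha : R) (c : nat -> R) n m (v : R) :
  cvgn (series (fun i => `|c i| * L3 ^+ i)) ->
  (forall x, `|L3 - x| <= L3 ->
    series (fun i => c i * (L3 - x) ^+ i) k @[k --> \oo] --> x `^ alpha) ->
  \sum_(i < k) c i * (lattice_walks i (n - m))%:R @[k --> \oo] --> v ->
  frac_laplacian_mx alpha n m = v%:C.
Proof.
move=> h1 h2 hv; rewrite /frac_laplacian_mx inner_delta /frac_laplacian.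
have [S [-> /(_ (delta R d m) n)[hRe hIm]]] := fun_calc_series d0 h1 h2.
move: hRe hIm.
under eq_fun do rewrite lazy_sum_delta /=.
under [X in _ -> X @ _ --> _ -> _]eq_fun do rewrite lazy_sum_delta /=.
move=> hRe hIm.
have eRe := cvg_unique _ hRe hv.
have eIm := cvg_unique _ hIm (cvg_cst _).
by apply/eqP; rewrite eq_complex eRe// eIm// !eqxx.
Qed.

End MatrixElements.

(** * Integrals over the half-line *)

Section HalfLine.
Context {R : realType}.
Local Notation mu := (@lebesgue_measure R).
Implicit Types (f F G : R -> R) (a c x p M l : R) (n : nat).

Definition Rpos : set R := `]0, +oo[%classic.

Lemma RposP x : Rpos x = (0 < x) :> Prop.
Proof. by rewrite /Rpos/= in_itv/= andbT. Qed.

Lemma mem_Rpos x : (x \in Rpos) = (0 < x).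
Proof. by apply/idP/idP; rewrite inE RposP. Qed.

Lemma measurable_Rpos : measurable Rpos.
Proof. exact: measurable_itv. Qed.
Hint Resolve measurable_Rpos : core.

Lemma measurable_Rpos_continuous f : (forall x, 0 < x -> {for x, continuous f}) ->
  measurable_fun Rpos f.
Proof.
move=> cf; apply: open_continuous_measurable_fun; first exact: interval_open.
by move=> x; rewrite mem_Rpos => /cf.
Qed.

(** The map x -> c/x exchanges [box 1 n] and [box c n]. Exhausting the half-line by these intervals
    therefore lets the inversion be carried out on compact sets. At n = 0 the box is the single
    point c. *)
Definition box (c : R) (n : nat) : set R := `[c / n.+1%:R, c * n.+1%:R]%classic.

Lemma box_sub c n : 0 < c -> box c n `<=` Rpos.
Proof.
move=> c0 x; rewrite /box RposP/= in_itv/= => /andP[h _].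
by apply: lt_le_trans h; rewrite divr_gt0.
Qed.

Lemma box_nondecreasing c : 0 < c -> nondecreasing_seq (box c).
Proof.
move=> c0 n m nm; apply/subsetPset => x; rewrite /box/= !in_itv/= => /andP[h1 h2].
apply/andP; split.
  by apply: le_trans h1; rewrite ler_pM2l// lef_pV2 ?posrE// ler_nat.
by apply: le_trans h2 _; rewrite ler_pM2l// ler_nat.
Qed.

Lemma bigcup_box c : 0 < c -> \bigcup_n box c n = Rpos.
Proof.
move=> c0; apply/seteqP; split=> [x [n _]|x]; first exact: box_sub.
rewrite RposP => x0.
exists (maxn (Num.truncn (x / c)) (Num.truncn (c / x))) => //.
set m := maxn _ _.
have m1 : x / c < m.+1%:R.
  by apply: lt_le_trans (truncnS_gt _) _; rewrite ler_nat ltnS leq_maxl.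
have m2 : c / x < m.+1%:R.
  by apply: lt_le_trans (truncnS_gt _) _; rewrite ler_nat ltnS leq_maxr.
rewrite /box/= in_itv/=; apply/andP; split.
  by rewrite ler_pdivrMr// mulrC -ler_pdivrMr// ltW.
by rewrite mulrC -ler_pdivrMr// ltW.
Qed.

Lemma measurable_box c n : measurable (box c n).
Proof. exact: measurable_itv. Qed.
Hint Resolve measurable_box : core.

Lemma cvg_integral_box_ge0 c f : 0 < c -> measurable_fun Rpos f ->
  (forall x, 0 < x -> 0 <= f x) ->
  (\int[mu]_(x in box c n) (f x)%:E)%E @[n --> \oo] --> (\int[mu]_(x in Rpos) (f x)%:E)%E.
Proof.
move=> c0 mf f0; rewrite -(bigcup_box c0).
apply: (@ge0_nondecreasing_set_cvg_integral _ (measurableTypeR R) R (box c) (EFin \o f) mu).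
- exact: box_nondecreasing.
- by move=> n; exact: measurable_itv.
- move=> n; apply/measurable_EFinP; apply: measurable_funS mf => //.
  exact: box_sub.
- by move=> n x /(box_sub c0); rewrite RposP lee_fin => /f0.
Qed.

Lemma Rintegral_dominated_cvg (D : set R) (fn : nat -> R -> R) f (g : R -> R) :
  measurable (D : set (measurableTypeR R)) ->
  (forall n, measurable_fun D (fn n)) -> measurable_fun D f ->
  (forall x, D x -> fn n x @[n --> \oo] --> f x) ->
  mu.-integrable D (EFin \o g) ->
  (forall n x, D x -> `|fn n x| <= g x) ->
  mu.-integrable D (EFin \o f) /\
  \int[mu]_(x in D) fn n x @[n --> \oo] --> \int[mu]_(x in D) f x.
Proof.
move=> mD mfn mf cfn ig bfn.
have mEfn n : measurable_fun D (EFin \o fn n) by exact/measurable_EFinP.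
have mEf : measurable_fun D (EFin \o f) by exact/measurable_EFinP.
have ae1 : {ae mu, forall x, D x -> (EFin \o fn n) x @[n --> \oo] --> (EFin \o f) x}.
  by apply: aeW => x Dx; apply: cvg_EFin; [exact: nearW|exact: cfn].
have ae2 : {ae mu, forall x n, D x -> (`|(EFin \o fn n) x| <= (EFin \o g) x)%E}.
  by apply: aeW => x n Dx; rewrite /= lee_fin; exact: bfn.
have [intf _ h] := dominated_convergence mD mEfn mEf ae1 ig ae2.
split => //.
by apply: fine_cvg; rewrite fineK; last exact: integrable_fin_num.
Qed.

Lemma cvg_Rintegral_box c f : 0 < c -> mu.-integrable Rpos (EFin \o f) ->
  \int[mu]_(x in box c n) f x @[n --> \oo] --> \int[mu]_(x in Rpos) f x.
Proof.
move=> c0 intf.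
have mf : measurable_fun Rpos f by apply/measurable_EFinP; case/integrableP: intf.
pose fn n := f \_ (box c n).
have mfn n : measurable_fun Rpos (fn n).
  apply/(measurable_restrict _ (measurable_box c n) measurable_Rpos).
  by apply: (measurable_funS _ _ mf); [exact: measurable_itv|move=> x []].
have cvgfn x : Rpos x -> fn n x @[n --> \oo] --> f x.
  rewrite -(bigcup_box c0) => -[N _ bx].
  apply: cvg_near_cst; exists N => // n /= Nn.
  rewrite /fn patchE mem_set//.
  by have /subsetPset := box_nondecreasing c0 Nn; exact.
have bfn n x : Rpos x -> `|fn n x| <= `|f x|.
  by move=> _; rewrite /fn patchE; case: ifP => //= _; rewrite normr0.
have [_ h] := Rintegral_dominated_cvg measurable_Rpos mfn mf cvgfn (integrable_norm intf) bfn.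
move: h; under eq_fun => n.
  rewrite /fn -Rintegral_mkcondr (_ : Rpos `&` box c n = box c n); first over.
  by apply/setIidPr; exact: box_sub.
exact.
Qed.

Lemma integral_box_FTC F f c n : 0 < c ->
  (forall x, 0 < x -> is_derive x 1 F (f x)) ->
  (forall x, 0 < x -> {for x, continuous f}) ->
  (\int[mu]_(x in box c n) (f x)%:E = (F (c * n.+1%:R) - F (c / n.+1%:R))%:E)%E.
Proof.
move=> c0 dF cf; rewrite /box; case: n => [|n].
  by rewrite invr1 mulr1 set_itv1 integral_set1 subrr.
have lt : c / n.+2%:R < c * n.+2%:R.
  rewrite ltr_pM2l// (@lt_trans _ _ 1)// ?ltr1n// invf_lt1// ltr1n//.
have cF x : 0 < x -> {for x, continuous F}.
  by move=> /dF [dF1 _]; apply: differentiable_continuous; apply/derivable1_diffP.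
have pos : 0 < c / n.+2%:R by rewrite divr_gt0.
rewrite (@continuous_FTC2 _ f F)//.
- by apply: continuous_in_subspaceT => x; rewrite inE/= in_itv/= => /andP[h _]; apply: cf; exact: lt_le_trans h.
- split.
  + by move=> x; rewrite in_itv/= => /andP[h _]; have [] := dF _ (lt_trans pos h).
  + by apply: cvg_at_right_filter; exact: cF.
  + by apply: cvg_at_left_filter; apply: cF; exact: lt_trans lt.
- move=> x; rewrite in_itv/= => /andP[h _]; rewrite derive1E.
  by have [_ ->] := dF _ (lt_trans pos h).
Qed.

Lemma integrable_antiderivative F f M :
  (forall x, 0 < x -> is_derive x 1 F (f x)) ->
  (forall x, 0 < x -> {for x, continuous f}) ->
  (forall x, 0 < x -> 0 <= f x) -> (forall x, 0 < x -> `|F x| <= M) ->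
  mu.-integrable Rpos (EFin \o f).
Proof.
move=> dF cf f0 FM.
have mf := measurable_Rpos_continuous cf.
apply/integrableP; split; first exact/measurable_EFinP.
apply: (@le_lt_trans _ _ (M + M)%:E); last exact: ltry.
under eq_integral => x.
  rewrite inE RposP => x0.
  have -> : (`|(EFin \o f) x| = (f x)%:E)%E by rewrite /= ger0_norm// f0.
  over.
have := cvg_integral_box_ge0 ltr01 mf f0; move/cvge_to_le; apply.
exists 0%N => // n _; rewrite (integral_box_FTC n ltr01 dF cf) lee_fin.
rewrite (le_trans (ler_norm _))// (le_trans (ler_normB _ _))// lerD//.
  by apply: FM; rewrite mul1r.
by apply: FM; rewrite mul1r invr_gt0.
Qed.

Lemma Rintegral_half_line_FTC F f l0 l1 :
  (forall x, 0 < x -> is_derive x 1 F (f x)) ->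
  (forall x, 0 < x -> {for x, continuous f}) ->
  mu.-integrable Rpos (EFin \o f) ->
  F n.+1%:R^-1 @[n --> \oo] --> l0 -> F n.+1%:R @[n --> \oo] --> l1 ->
  \int[mu]_(x in Rpos) f x = l1 - l0.
Proof.
move=> dF cf intf h0 h1.
have := cvg_Rintegral_box ltr01 intf.
have -> : (fun n => \int[mu]_(x in box 1 n) f x) = (fun n => F n.+1%:R - F n.+1%:R^-1).
  apply/funext => n.
  by rewrite /Rintegral (integral_box_FTC n ltr01 dF cf)/= !mul1r.
move/cvg_unique => h; apply: h => //; exact: cvgB.
Qed.

(* An explicit derivative, of - 1 / (a (1 + x^a)), comparable to x^(a-1) near 0 and
   to x^(-a-1) at infinity. *)
Definition dom (a x : R) : R := x `^ (a - 1) / (1 + x `^ a) ^+ 2.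

Lemma continuous_powR_pos (p x : R) : 0 < x -> {for x, continuous (fun y => y `^ p)}.
Proof.
move=> x0; apply: differentiable_continuous; apply/derivable1_diffP.
by apply: derivable_powR; rewrite in_itv/= x0.
Qed.

Lemma continuous_dom a x : 0 < x -> {for x, continuous (dom a)}.
Proof.
move=> x0; rewrite /dom; apply: cvgM; first exact: continuous_powR_pos.
have c1 : {for x, continuous (fun y => 1 + y `^ a)}.
  by apply: cvgD; [exact: cvg_cst|exact: continuous_powR_pos].
apply: cvgV; last by rewrite !expr2; exact: cvgM.
by rewrite expf_neq0// lt0r_neq0// ltr_pwDl// powR_ge0.
Qed.

Lemma dom_ge0 a x : 0 <= dom a x.
Proof. by rewrite divr_ge0 ?sqr_ge0 ?powR_ge0. Qed.

Lemma is_derive_dom a x : 0 < a -> 0 < x ->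
  is_derive x 1 (fun y => - (a^-1 * (1 + y `^ a)^-1)) (dom a x).
Proof.
move=> a0 x0.
have q0 : 1 + x `^ a != 0 by rewrite lt0r_neq0// ltr_pwDl// powR_ge0.
have d1 : is_derive x 1 (fun y => 1 + y `^ a) (0 + a * x `^ (a - 1)).
  by apply: is_deriveD; exact: is_derive1_powR.
have d2 := is_deriveN (is_deriveZ a^-1 (@is_deriveV _ (fun y => 1 + y `^ a) x _ 1 q0 d1)).
apply: (is_derive_eq d2); rewrite /dom add0r /GRing.scale/=.
by field; rewrite ?q0 ?(lt0r_neq0 a0).
Qed.

Lemma integrable_dom a : 0 < a -> mu.-integrable Rpos (EFin \o dom a).
Proof.
move=> a0.
apply: (@integrable_antiderivative (fun x => - (a^-1 * (1 + x `^ a)^-1)) (dom a) a^-1).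
- by move=> x x0; exact: is_derive_dom.
- by move=> x; exact: continuous_dom.
- by move=> x x0; exact: dom_ge0.
move=> x x0; rewrite normrN normrM ger0_norm ?invr_ge0 ?(ltW a0)//.
rewrite ler_piMr ?invr_ge0 ?(ltW a0)// ger0_norm.
  by rewrite invf_le1 ?lerDl ?powR_ge0// ltr_pwDl// powR_ge0.
by rewrite invr_ge0 addr_ge0// powR_ge0.
Qed.

(** The factor 4 bounds (1 + x^a)^2 for x <= 1 and its quotient by x^(2a) for x >= 1. The explicit
    majorant is returned along with integrability, so that it can dominate a whole family sharing
    the constant C. *)
Lemma integrable_Rpos_bound a C f : 0 < a -> measurable_fun Rpos f ->
  (forall x, 0 < x -> x <= 1 -> `|f x| <= C * x `^ (a - 1)) ->
  (forall x, 1 <= x -> `|f x| <= C * x `^ (- a - 1)) ->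
  mu.-integrable Rpos (EFin \o f) /\ (forall x, 0 < x -> `|f x| <= (4 * C) * dom a x).
Proof.
move=> a0 mf h0 h1.
have C0 : 0 <= C.
  have := h1 1 (lexx _); rewrite powR1 mulr1; exact: le_trans.
have key x : 0 < x -> `|f x| <= (4 * C) * dom a x.
  move=> x0; have q0 : 0 <= x `^ (a - 1) by exact: powR_ge0.
  have p0 : 0 < x `^ a by exact: powR_gt0.
  have [x1|/ltW x1] := leP x 1.
    apply: le_trans (h0 x x0 x1) _; rewrite /dom mulrA.
    rewrite ler_pdivlMr; last by rewrite exprn_gt0// ltr_pwDl// ltW.
    have p1 : x `^ a <= 1.
      have := ge0_ler_powR (ltW a0) (ltW x0 : x \in Num.nneg) (ler01 : 1 \in Num.nneg) x1.
      by rewrite powR1.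
    have : (1 + x `^ a) ^+ 2 <= 4 by rewrite expr2; nra.
    have := mulr_ge0 C0 q0; nra.
  apply: le_trans (h1 x x1) _; rewrite /dom mulrA.
  have p1 : 1 <= x `^ a.
    have := ge0_ler_powR (ltW a0) (ler01 : 1 \in Num.nneg) (ltW x0 : x \in Num.nneg) x1.
    by rewrite powR1.
  have -> : x `^ (- a - 1) = x `^ (a - 1) / (x `^ a) ^+ 2.
    have -> : - a - 1 = (a - 1) - (a + a) by ring.
    by rewrite powRB ?powRD ?(lt0r_neq0 x0) ?implybT// expr2.
  rewrite ler_pdivlMr; last by rewrite exprn_gt0// ltr_pwDl// ltW.
  rewrite mulrA mulrAC ler_pdivrMr; last by rewrite exprn_gt0.
  have : (1 + x `^ a) ^+ 2 <= 4 * (x `^ a) ^+ 2 by nra.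
  have := mulr_ge0 C0 q0; nra.
split => //.
have := integrable_dom a0 => id.
apply: (@le_integrable _ _ _ mu Rpos measurable_Rpos _ (EFin \o (fun x => 4 * C * dom a x))).
- exact/measurable_EFinP.
- move=> x; rewrite RposP => x0 /=; rewrite lee_fin [leRHS]ger0_norm ?key//.
  by apply: mulr_ge0; [rewrite mulr_ge0|exact: dom_ge0].
have -> : EFin \o (fun x => 4 * C * dom a x) = (fun x => (4 * C)%:E * (EFin \o dom a) x)%E.
  by apply/funext => x /=; rewrite EFinM.
exact: integrableZl.
Qed.

Lemma Rintegral_gt0 f : mu.-integrable Rpos (EFin \o f) ->
  (forall x, 0 < x -> 0 < f x) -> 0 < \int[mu]_(x in Rpos) f x.
Proof.
move=> intf f0; rewrite lt0r; apply/andP; split; last first.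
  by apply: Rintegral_ge0 => x; rewrite RposP => /f0/ltW.
apply/negP => /eqP I0.
have mf : measurable_fun Rpos (EFin \o f) by case/integrableP: intf.
have E0 : (\int[mu]_(x in Rpos) `|(EFin \o f) x| = 0)%E.
  transitivity (\int[mu]_(x in Rpos) (f x)%:E)%E.
    by apply: eq_integral => x; rewrite mem_Rpos => /f0/ltW h /=; rewrite ger0_norm.
  by rewrite -(fineK (integrable_fin_num _ intf))//; move: I0; rewrite /Rintegral => ->.
have [N [mN N0 sN]] := (@ae_eq_integral_abs _ _ _ mu Rpos measurable_Rpos _ mf).1 E0.
have : (mu Rpos <= mu N)%E.
  apply: le_measure; rewrite ?inE// => x; rewrite RposP => x0; apply: sN => /= h.
  have := h; rewrite RposP => /(_ x0)[] e.
  by have := f0 x x0; rewrite e ltxx.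
rewrite N0 leNgt => /negP; apply.
by rewrite /Rpos lebesgue_measure_itv/= ltry oppr0 adde0 ltry.
Qed.

Lemma integral_box_inv G c n : 0 < c -> (forall x, 0 < x -> {for x, continuous G}) ->
  (\int[mu]_(x in box c n) (G x)%:E = \int[mu]_(x in box 1 n) (G (c / x) * (c / x ^+ 2))%:E)%E.
Proof.
move=> c0 cG.
have n0 : (0 : R) < n.+1%:R^-1 by rewrite invr_gt0.
pose F x := c / x.
have dF x : 0 < x -> is_derive x 1 F (- (c / x ^+ 2)).
  move=> x0; have d := is_deriveZ c (@is_deriveV _ id x _ 1 (lt0r_neq0 x0) (is_derive_id x 1)).
  by apply: (is_derive_eq d); rewrite /GRing.scale/= mulr1 mulrN.
have dF1 x : 0 < x -> (F^`())%classic x = - (c / x ^+ 2).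
  by move=> /dF[_ <-]; rewrite derive1E.
have cF x : 0 < x -> {for x, continuous F}.
  by move=> /dF [h _]; apply: differentiable_continuous; apply/derivable1_diffP.
have cf x : 0 < x -> {for x, continuous (fun x : R => - (c / x ^+ 2))}.
  move=> x0; apply: cvgN; apply: cvgM; first exact: cvg_cst.
  by apply: cvgV; [rewrite expf_neq0// lt0r_neq0|exact: exprn_continuous].
have cF' x : 0 < x -> {for x, continuous (F^`())%classic}.
  move=> x0; rewrite /prop_for /continuous_at dF1//; apply: cvg_trans (cf x x0).
  apply: near_eq_cvg; near=> y; rewrite dF1//.
  by near: y; exact: lt_nbhsr.
have n1 : n.+1%:R^-1 <= n.+1%:R :> R.
  by rewrite (@le_trans _ _ 1)// ?ler1n// invf_le1// ler1n.
have F0 : F n.+1%:R^-1 = c * n.+1%:R by rewrite /F invrK.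
have lt0n : (0 : R) < n.+1%:R by [].
rewrite /box -F0 (integration_by_substitution_decreasing n1).
- rewrite !mul1r; apply: eq_integral => x; rewrite inE/= in_itv/= => /andP[x1 _].
  rewrite -[LHS]/((G (F x) * - (F^`())%classic x)%:E).
  by rewrite dF1 ?(lt_le_trans n0 x1)// opprK.
- move=> x y; rewrite !in_itv/= => /andP[x1 _] /andP[y1 _] xy.
  by rewrite ltr_pM2l// ltf_pV2// posrE (lt_le_trans n0).
- by move=> x; rewrite in_itv/= => /andP[x1 _]; apply: cF'; exact: lt_trans x1.
- by apply/cvg_ex; eexists; apply: cvg_at_right_filter; exact: cF'.
- by apply/cvg_ex; eexists; apply: cvg_at_left_filter; exact: cF'.
- split.
  + by move=> x; rewrite in_itv/= => /andP[h _]; have [] := dF _ (lt_trans n0 h).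
  + by apply: cvg_at_right_filter; exact: cF.
  + by apply: cvg_at_left_filter; exact: cF.
- apply: continuous_in_subspaceT => x; rewrite inE/= in_itv/= => /andP[h _].
  by apply: cG; apply: lt_le_trans h; rewrite /F divr_gt0.
Unshelve. all: by end_near. Qed.

Lemma continuous_Rpos_inv G c : 0 < c -> (forall x, 0 < x -> {for x, continuous G}) ->
  forall x, 0 < x -> {for x, continuous (fun x : R => G (c / x) * (c / x ^+ 2))}.
Proof.
move=> c0 cG x x0.
have cV (k : nat) : {for x, continuous (fun y : R => c / y ^+ k)}.
  apply: cvgM; first exact: cvg_cst.
  by apply: cvgV; [rewrite expf_neq0// lt0r_neq0|exact: exprn_continuous].
apply: cvgM; last exact: cV.
apply: (@continuous_comp _ _ _ (fun y : R => c / y) G); first by have := cV 1.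
by apply: cG; rewrite divr_gt0.
Qed.

Lemma Rpos_inv_ge0 G c x : 0 < c -> (forall x, 0 < x -> 0 <= G x) -> 0 < x ->
  0 <= G (c / x) * (c / x ^+ 2).
Proof.
by move=> c0 G0 x0; rewrite mulr_ge0 ?G0 ?divr_ge0 ?exprn_ge0 ?(ltW c0) ?(ltW x0)// divr_gt0.
Qed.

(** In the extended reals nonnegativity alone makes the limits over the boxes exist on both sides;
    integrability is then transferred from one side to the other. *)
Lemma integral_Rpos_inv G c : 0 < c -> (forall x, 0 < x -> {for x, continuous G}) ->
  (forall x, 0 < x -> 0 <= G x) ->
  (\int[mu]_(x in Rpos) (G x)%:E = \int[mu]_(x in Rpos) (G (c / x) * (c / x ^+ 2))%:E)%E.
Proof.
move=> c0 cG G0.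
have := cvg_integral_box_ge0 c0 (measurable_Rpos_continuous cG) G0.
under eq_fun do rewrite integral_box_inv//.
move/cvg_unique; apply => //.
apply: cvg_integral_box_ge0 => //.
  by apply: measurable_Rpos_continuous; exact: continuous_Rpos_inv.
by move=> x; exact: Rpos_inv_ge0.
Qed.

Lemma integrable_Rpos_inv G c : 0 < c -> (forall x, 0 < x -> {for x, continuous G}) ->
  (forall x, 0 < x -> 0 <= G x) -> mu.-integrable Rpos (EFin \o G) ->
  mu.-integrable Rpos (EFin \o (fun x : R => G (c / x) * (c / x ^+ 2))).
Proof.
move=> c0 cG G0 /integrableP[_ iG]; apply/integrableP; split.
  by apply/measurable_EFinP; apply: measurable_Rpos_continuous; exact: continuous_Rpos_inv.
have E F : (forall x, 0 < x -> 0 <= F x) ->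
    (\int[mu]_(x in Rpos) `|(EFin \o F) x| = \int[mu]_(x in Rpos) (F x)%:E)%E.
  by move=> F0; apply: eq_integral => x; rewrite mem_Rpos => x0; rewrite /= ger0_norm ?F0.
rewrite E; last by move=> x; exact: Rpos_inv_ge0.
by rewrite -(integral_Rpos_inv c0 cG G0) -(E _ G0).
Qed.

Lemma Rintegral_Rpos_inv G c : 0 < c -> (forall x, 0 < x -> {for x, continuous G}) ->
  (forall x, 0 < x -> 0 <= G x) ->
  \int[mu]_(x in Rpos) G x = \int[mu]_(x in Rpos) (G (c / x) * (c / x ^+ 2)).
Proof. by move=> c0 cG G0; rewrite /Rintegral (integral_Rpos_inv c0 cG G0). Qed.

End HalfLine.

Section PowR.
Context {R : realType}.
Implicit Types (x y p q : R).

Lemma powR_le_small x p q : 0 < x -> x <= 1 -> p <= q -> x `^ q <= x `^ p.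
Proof. by move=> x0 x1 pq; apply: ger_powR => //; rewrite x0. Qed.

Lemma powR_inv x p : 0 < x -> x^-1 `^ p = x `^ (- p).
Proof. by move=> x0; rewrite -powR_inv1 ?(ltW x0)// -powRrM mulN1r. Qed.

Lemma mulr_powR x p : 0 < x -> x * x `^ p = x `^ (p + 1).
Proof.
by move=> x0; rewrite powRD ?(lt0r_neq0 x0) ?implybT// powRr1 ?(ltW x0)// mulrC.
Qed.

Lemma cvg_powR_harmonic p : 0 < p -> (n.+1%:R^-1 : R) `^ p @[n --> \oo] --> (0 : R).
Proof.
move=> p0; have /cvg_at_rightP := powR_cvg0 p0; apply.
by split; [move=> n; rewrite invr_gt0|exact: cvg_harmonic].
Qed.

End PowR.

(** * The integral representation of powers *)

Section LevyIntegral.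
Context {R : realType}.
Local Notation mu := (@lebesgue_measure R).
Variable alpha : R.
Hypothesis alpha0 : 0 < alpha.
Hypothesis alpha1 : alpha < 1.
Implicit Types (x t lam : R).

Definition levy_density lam t : R := (1 - expR (- (lam * t))) * t `^ (- alpha - 1).

Definition levy_const : R := \int[mu]_(t in Rpos) levy_density 1 t.

(** The density [levy_density] is O(t^(-alpha)) at 0 and O(t^(-alpha-1)) at infinity, whereas
    [integrable_Rpos_bound] takes a single exponent for both ends; this is the largest that fits
    both. *)
Definition levy_exp : R := Num.min (1 - alpha) alpha.

Lemma levy_exp_gt0 : 0 < levy_exp.
Proof. by rewrite lt_min alpha0 subr_gt0 alpha1. Qed.

Lemma levy_exp_small t : 0 < t -> t <= 1 -> t `^ (- alpha) <= t `^ (levy_exp - 1).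
Proof.
move=> t0 t1; apply: powR_le_small => //.
have : levy_exp <= 1 - alpha by rewrite ge_min lexx.
lra.
Qed.

Lemma levy_exp_large t : 1 <= t -> t `^ (- alpha - 1) <= t `^ (- levy_exp - 1).
Proof.
move=> t1; apply: ler_powR => //.
have : levy_exp <= alpha by rewrite ge_min lexx orbT.
lra.
Qed.

Lemma continuous_expRM (c x : R) : {for x, continuous (fun t => expR (c * t))}.
Proof.
apply: (@continuous_comp _ _ _ (fun t => c * t) expR); last exact: continuous_expR.
by apply: cvgM; [exact: cvg_cst|exact: cvg_id].
Qed.

Lemma is_derive_expRM (c x : R) : is_derive x 1 (fun t => expR (c * t)) (c * expR (c * x)).
Proof.
have h := is_derive1_comp (is_derive_expR (c * x)) (is_deriveZ c (is_derive_id x 1)).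
by apply: (is_derive_eq h); rewrite /GRing.scale/= mulr1 mulrC.
Qed.

Lemma continuous_levy_density lam t : 0 < t -> {for t, continuous (levy_density lam)}.
Proof.
move=> t0; apply: cvgM; last exact: continuous_powR_pos.
apply: cvgB; first exact: cvg_cst.
have := @continuous_expRM (- lam) t; rewrite /prop_for /continuous_at mulNr.
by under eq_fun do rewrite mulNr.
Qed.

Lemma levy_density_ge0 lam t : 0 <= lam -> 0 < t -> 0 <= levy_density lam t.
Proof.
move=> l0 t0; rewrite mulr_ge0 ?powR_ge0// subr_ge0 expR_le1 oppr_le0.
by rewrite mulr_ge0// ltW.
Qed.

Lemma integrable_levy_density lam : 0 <= lam -> mu.-integrable Rpos (EFin \o levy_density lam).
Proof.
move=> l0.
have ml : measurable_fun Rpos (levy_density lam).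
  by apply: measurable_Rpos_continuous => t; exact: continuous_levy_density.
have e1 t : 0 < t -> 0 <= 1 - expR (- (lam * t)) <= 1.
  move=> t0; apply/andP; split; last by rewrite gerBl expR_ge0.
  by rewrite subr_ge0 expR_le1 oppr_le0 mulr_ge0 ?(ltW t0).
have [] // := @integrable_Rpos_bound R levy_exp (lam + 1) _ levy_exp_gt0 ml.
  move=> t t0 t1; rewrite ger0_norm ?levy_density_ge0// /levy_density.
  have h : 1 - expR (- (lam * t)) <= lam * t.
    by have := expR_ge1Dx (- (lam * t)); lra.
  apply: (@le_trans _ _ (lam * t * t `^ (- alpha - 1))).
    by rewrite ler_wpM2r// powR_ge0.
  rewrite -mulrA mulr_powR// subrK; apply: ler_pM => //.
  - exact: powR_ge0.
  - by rewrite lerDl.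
  - exact: levy_exp_small.
move=> t t1; have t0 : 0 < t by exact: lt_le_trans t1.
rewrite ger0_norm ?levy_density_ge0// /levy_density.
have /andP[h0 h1] := e1 _ t0.
apply: ler_pM => //; first exact: powR_ge0.
  by apply: le_trans h1 _; rewrite lerDr.
exact: levy_exp_large.
Qed.

Lemma levy_const_gt0 : 0 < levy_const.
Proof.
apply: Rintegral_gt0; first exact: integrable_levy_density.
move=> t t0; rewrite /levy_density mul1r mulr_gt0 ?powR_gt0//.
by rewrite subr_gt0 expR_lt1 oppr_lt0.
Qed.

(** The dilation t -> lam t is realised by two inversions, t = 1/x on the left and t = lam/x on the
    right. Both produce 1 - e^(-lam/x), and only powers of lam remain to be compared. *)
Lemma Rintegral_levy_density lam : 0 <= lam ->
  \int[mu]_(t in Rpos) levy_density lam t = lam `^ alpha * levy_const.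
Proof.
rewrite le_eqVlt => /predU1P[<-|l0].
  rewrite powR0 ?lt0r_neq0// mul0r.
  have -> : levy_density 0 = cst 0.
    by apply/funext => t; rewrite /levy_density mul0r oppr0 expR0 subrr mul0r.
  by rewrite Rintegral_cst ?mul0r//; exact: measurable_itv.
have cl m t : 0 < t -> {for t, continuous (levy_density m)} by exact: continuous_levy_density.
rewrite (Rintegral_Rpos_inv ltr01 (cl lam)); last by move=> x; exact: levy_density_ge0 (ltW l0).
rewrite /levy_const (Rintegral_Rpos_inv l0 (cl 1)); last by move=> x; exact: levy_density_ge0 ler01.
rewrite -RintegralZl; last 2 first.
- exact: measurable_itv.
- apply: integrable_Rpos_inv => //; first exact: cl.
    by move=> x; exact: levy_density_ge0 ler01.
  exact: integrable_levy_density.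
apply: eq_Rintegral => x; rewrite mem_Rpos => x0.
rewrite /levy_density !mul1r expr2.
have lx : 0 < lam / x by rewrite divr_gt0.
rewrite [(lam / x) `^ _]powRM ?(ltW l0) ?invr_ge0 ?(ltW x0)//.
have e1 : lam `^ alpha * lam `^ (- alpha - 1) * lam = 1.
  rewrite -powRD ?(lt0r_neq0 l0) ?implybT//.
  by rewrite addrA subrr add0r powR_inv1 ?(ltW l0)// mulVf// lt0r_neq0.
move: e1; move: (1 - _) (lam `^ alpha) (lam `^ (- alpha - 1)) (x^-1 `^ _) => E A P Q e1.
rewrite -[LHS]mul1r -e1; move: (x * x)^-1 => y; ring.
Qed.

Lemma cvg_levy_boundary0 :
  (1 - expR (- n.+1%:R^-1)) * n.+1%:R^-1 `^ (- alpha) @[n --> \oo] --> (0 : R).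
Proof.
have h : 0 < 1 - alpha by rewrite subr_gt0.
apply: (@squeeze_cvgr _ _ _ _ (cst 0) (fun n => n.+1%:R^-1 `^ (1 - alpha))).
- apply: nearW => n; have n0 : (0 : R) < n.+1%:R^-1 by rewrite invr_gt0.
  apply/andP; split.
    by apply: mulr_ge0; [rewrite subr_ge0 expR_le1 oppr_le0 ltW|exact: powR_ge0].
  rewrite [1 - alpha]addrC -mulr_powR// ler_wpM2r ?powR_ge0//.
  by rewrite lerBlDr -lerBlDl; exact: expR_ge1Dx.
- exact: cvg_cst.
- exact: cvg_powR_harmonic.
Qed.

Lemma cvg_levy_boundary1 :
  (1 - expR (- n.+1%:R)) * n.+1%:R `^ (- alpha) @[n --> \oo] --> (0 : R).
Proof.
apply: (@squeeze_cvgr _ _ _ _ (cst 0) (fun n => n.+1%:R^-1 `^ alpha)).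
- apply: nearW => n; have n0 : (0 : R) < n.+1%:R by [].
  apply/andP; split.
    by apply: mulr_ge0; [rewrite subr_ge0 expR_le1 oppr_le0 ltW|exact: powR_ge0].
  by rewrite powR_inv// ler_piMl ?powR_ge0// gerBl expR_ge0.
- exact: cvg_cst.
- exact: cvg_powR_harmonic.
Qed.

Lemma integrable_gamma_density :
  mu.-integrable Rpos (EFin \o (fun t => t `^ (- alpha) * expR (- t))).
Proof.
have [] // := @integrable_Rpos_bound R levy_exp 1 (fun t => t `^ (- alpha) * expR (- t)) levy_exp_gt0.
- apply: measurable_Rpos_continuous => t t0; apply: cvgM; first exact: continuous_powR_pos.
  have := @continuous_expRM (- 1) t; rewrite /prop_for /continuous_at mulN1r.
  by under eq_fun do rewrite mulN1r.
- move=> t t0 t1; rewrite mul1r ger0_norm ?mulr_ge0 ?powR_ge0 ?expR_ge0//.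
  apply: le_trans (levy_exp_small t0 t1).
  by rewrite ler_piMr ?powR_ge0// expR_le1 oppr_le0 ltW.
- move=> t t1; have t0 : 0 < t by exact: lt_le_trans t1.
  rewrite mul1r ger0_norm ?mulr_ge0 ?powR_ge0 ?expR_ge0//.
  apply: le_trans (levy_exp_large t1).
  have -> : t `^ (- alpha) = t `^ (- alpha - 1) * t by rewrite mulrC mulr_powR// subrK.
  rewrite -mulrA ler_piMr ?powR_ge0// expRN ler_pdivrMr ?expR_gt0// mul1r.
  by have := expR_ge1Dx t; lra.
Qed.

(** Integration by parts with antiderivative (1 - e^(-t)) t^(-alpha). The boundary terms vanish at 0
    because alpha < 1 and at infinity because alpha > 0. This is where the normalising constant
    becomes a value of Gamma. *)
Lemma Gamma_integral_levy : Gamma_integral (1 - alpha) = alpha * levy_const.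
Proof.
pose F t := (1 - expR (- t)) * t `^ (- alpha).
pose f t := t `^ (- alpha) * expR (- t) - alpha * levy_density 1 t.
have dF t : 0 < t -> is_derive t 1 F (f t).
  move=> t0.
  have d1 : is_derive t 1 (fun s => 1 - expR (- s)) (0 - (-1 * expR (- t))).
    apply: is_deriveB; have h := is_derive_expRM (- 1) t.
    have E : (fun s => expR (- 1 * s)) = (fun s : R => expR (- s)).
      by apply/funext => s; rewrite mulN1r.
    by rewrite E in h; apply: (is_derive_eq h); rewrite (mulN1r t).
  have d2 := is_derive1_powR (- alpha) t0.
  have d3 := is_deriveM d1 d2.
  apply: (is_derive_eq d3).
  by rewrite /f /levy_density /GRing.scale/= mul1r; ring.
have cg t : 0 < t -> {for t, continuous (fun t => t `^ (- alpha) * expR (- t))}.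
  move=> t0; apply: cvgM; first exact: continuous_powR_pos.
  have := @continuous_expRM (- 1) t; rewrite /prop_for /continuous_at mulN1r.
  by under eq_fun do rewrite mulN1r.
have cf t : 0 < t -> {for t, continuous f}.
  move=> t0; apply: cvgB; first exact: cg.
  by apply: cvgM; [exact: cvg_cst|exact: continuous_levy_density].
have mR : measurable (Rpos : set (measurableTypeR R)) by exact: measurable_itv.
have il := integrable_levy_density ler01.
have ial : mu.-integrable Rpos (EFin \o (fun t => alpha * levy_density 1 t)).
  have -> : EFin \o (fun t => alpha * levy_density 1 t) =
      (fun t => alpha%:E * (EFin \o levy_density 1) t)%E.
    by apply/funext => t /=; rewrite EFinM.
  exact: integrableZl.
have intf : mu.-integrable Rpos (EFin \o f).
  by have := integrableB mR integrable_gamma_density ial.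
have := Rintegral_half_line_FTC dF cf intf cvg_levy_boundary0 cvg_levy_boundary1.
rewrite subrr /f (RintegralB mR integrable_gamma_density ial) RintegralZl//.
move/eqP; rewrite subr_eq0 => /eqP <-.
by rewrite /Gamma_integral; apply: eq_Rintegral => t _; rewrite addrAC subrr add0r.
Qed.

End LevyIntegral.

(** * The power series of x^alpha around L *)

Section FracCoef.
Context {R : realType}.
Local Notation mu := (@lebesgue_measure R).
Variables (alpha L : R).
Hypothesis alpha0 : 0 < alpha.
Hypothesis alpha1 : alpha < 1.
Hypothesis L0 : 0 < L.
Implicit Types (x t : R) (w : nat -> R).

Definition egf w t : R := limn (series (fun i => w i * (t ^+ i / i`!%:R))).

Definition levy_moment (i : nat) : R :=
  \int[mu]_(t in Rpos) (expR (- (L * t)) * (t ^+ i / i`!%:R) * t `^ (- alpha - 1)).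

(** The moment of index 0 diverges at t = 0. The constant coefficient is instead the value at the
    centre x = L, where all the higher terms vanish. *)
Definition frac_coef (i : nat) : R :=
  if i is 0 then L `^ alpha else - (levy_moment i / levy_const alpha).

Lemma sum_exp_coeff_le x k : 0 <= x -> \sum_(i < k) x ^+ i / i`!%:R <= expR x.
Proof.
move=> x0.
have -> : \sum_(i < k) x ^+ i / i`!%:R = series (exp_coeff x) k by rewrite /series/= big_mkord.
apply: nondecreasing_cvgn_le; last exact: is_cvg_series_exp_coeff.
by apply: nondecreasing_series => i _ _; rewrite exp_coeff_ge0.
Qed.

Section Weighted.
Variable w : nat -> R.
Hypothesis wL : forall i, `|w i| <= L ^+ i.

Lemma egf_term_le t i : 0 <= t -> `|w i * (t ^+ i / i`!%:R)| <= (L * t) ^+ i / i`!%:R.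
Proof.
move=> t0; rewrite normrM [X in _ * X]ger0_norm ?divr_ge0 ?exprn_ge0//.
by rewrite exprMn -mulrA ler_wpM2r// divr_ge0 ?exprn_ge0.
Qed.

Lemma is_cvg_egf t : 0 <= t -> cvgn (series (fun i => w i * (t ^+ i / i`!%:R))).
Proof.
move=> t0; apply: normed_cvg.
apply: (@series_le_cvg _ _ (exp_coeff (L * t))) => [i|i|i|].
- exact: normr_ge0.
- by rewrite exp_coeff_ge0// mulr_ge0// ltW.
- exact: egf_term_le.
- exact: is_cvg_series_exp_coeff.
Qed.

(** The sum starts at index 1, since t^(-alpha-1) is integrable at 0 only against a factor t. What
    remains is at most e^(L t) - 1, and the weight turns this bound into [levy_density alpha L], the
    majorant for dominated convergence. *)
Definition egf_part k t := \sum_(i < k) w i.+1 * (t ^+ i.+1 / i.+1`!%:R).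

Lemma egf_part_le k t : 0 <= t -> `|egf_part k t| <= expR (L * t) - 1.
Proof.
move=> t0; have Lt0 : 0 <= L * t by rewrite mulr_ge0// ltW.
rewrite lerBrDl; apply: le_trans (sum_exp_coeff_le k.+1 Lt0).
rewrite big_ord_recl expr0 divr1 lerD2l.
apply: le_trans (ler_norm_sum _ _ _) _; apply: ler_sum => i _.
exact: egf_term_le.
Qed.

Lemma cvg_egf_part t : 0 <= t -> egf_part k t @[k --> \oo] --> egf w t - w 0%N.
Proof.
move=> t0; have h := is_cvg_egf t0.
have : series (fun i => w i * (t ^+ i / i`!%:R)) k.+1 - w 0%N @[k --> \oo] --> egf w t - w 0%N.
  by apply: cvgB; [rewrite (cvg_shiftS (series _)); exact: h|exact: cvg_cst].
by under eq_fun do rewrite /series/= big_mkord big_ord_recl expr0 fact0 divr1 mulr1 addrAC subrr add0r.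
Qed.

Definition levy_weight t := expR (- (L * t)) * t `^ (- alpha - 1).

Lemma continuous_levy_weight t : 0 < t -> {for t, continuous levy_weight}.
Proof.
move=> t0; apply: cvgM; last exact: continuous_powR_pos.
have := @continuous_expRM R (- L) t; rewrite /prop_for /continuous_at mulNr.
by under eq_fun do rewrite mulNr.
Qed.

Lemma levy_weight_ge0 t : 0 <= levy_weight t.
Proof. by rewrite mulr_ge0 ?expR_ge0 ?powR_ge0. Qed.

Lemma levy_weight_exp t : levy_weight t * (expR (L * t) - 1) = levy_density alpha L t.
Proof.
rewrite /levy_weight /levy_density mulrAC mulrBr mulr1 -expRD addNr expR0.
by [].
Qed.

Lemma continuous_egf_part k t : {for t, continuous (egf_part k)}.
Proof.
rewrite /prop_for /continuous_at /egf_part; elim: k => [|k IH].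
  by under eq_fun do rewrite big_ord0; rewrite big_ord0; exact: cvg_cst.
under eq_fun do rewrite big_ord_recr/=; rewrite big_ord_recr/=.
apply: cvgD => //; apply: cvgM; first exact: cvg_cst.
by apply: cvgM; [exact: exprn_continuous|exact: cvg_cst].
Qed.

Lemma levy_egf_part_le k t : 0 < t ->
  `|levy_weight t * egf_part k t| <= levy_density alpha L t.
Proof.
move=> t0; rewrite normrM ger0_norm ?levy_weight_ge0// -levy_weight_exp.
by rewrite ler_wpM2l ?levy_weight_ge0// egf_part_le// ltW.
Qed.

Lemma measurable_levy_egf_part k :
  measurable_fun Rpos (fun t => levy_weight t * egf_part k t).
Proof.
apply: measurable_Rpos_continuous => t t0; apply: cvgM.
  exact: continuous_levy_weight.
exact: continuous_egf_part.
Qed.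

Lemma cvg_levy_egf : mu.-integrable Rpos
    (EFin \o (fun t => levy_weight t * (egf w t - w 0%N))) /\
  \int[mu]_(t in Rpos) (levy_weight t * egf_part k t) @[k --> \oo] -->
  \int[mu]_(t in Rpos) (levy_weight t * (egf w t - w 0%N)).
Proof.
have cvgk t : Rpos t -> levy_weight t * egf_part k t @[k --> \oo] -->
    levy_weight t * (egf w t - w 0%N).
  rewrite RposP => t0; apply: cvgM; first exact: cvg_cst.
  by apply: cvg_egf_part; exact: ltW.
apply: (Rintegral_dominated_cvg (g := levy_density alpha L)).
- exact: measurable_itv.
- exact: measurable_levy_egf_part.
- exact: measurable_fun_cvg measurable_levy_egf_part cvgk.
- exact: cvgk.
- by have := integrable_levy_density alpha0 alpha1 (ltW L0); exact.
- by move=> k t; rewrite RposP; exact: levy_egf_part_le.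
Qed.

End Weighted.

Lemma integrable_levy_egf_part w k : (forall i, `|w i| <= L ^+ i) ->
  mu.-integrable Rpos (EFin \o (fun t => levy_weight t * egf_part w k t)).
Proof.
move=> wL; have mR : measurable (Rpos : set (measurableTypeR R)) by exact: measurable_itv.
apply: (le_integrable mR _ _ (integrable_levy_density alpha0 alpha1 (ltW L0))).
  by apply/measurable_EFinP; exact: measurable_levy_egf_part.
move=> t; rewrite RposP => t0 /=; rewrite lee_fin [leRHS]ger0_norm.
  exact: levy_egf_part_le.
by apply: levy_density_ge0 => //; exact: ltW.
Qed.

Lemma integrable_levy_moment i : mu.-integrable Rpos
  (EFin \o (fun t => expR (- (L * t)) * (t ^+ i.+1 / i.+1`!%:R) * t `^ (- alpha - 1))).
Proof.
(* A sequence supported at the index i + 1 turns [egf_part] into one monomial, so integrability of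
   the moment is a special case. *)
pose w (j : nat) := (j == i.+1)%:R * L ^+ j.
have wL j : `|w j| <= L ^+ j.
  have h : 0 <= L ^+ j by rewrite exprn_ge0// ltW.
  by rewrite /w; case: eqP => _; rewrite ?mul1r ?mul0r ?normr0// ger0_norm.
have mR : measurable (Rpos : set (measurableTypeR R)) by exact: measurable_itv.
have := integrableZl mR (L ^- i.+1) (integrable_levy_egf_part i.+1 wL).
congr (mu.-integrable _ _); apply/funext => t /=; rewrite -EFinM; congr EFin.
rewrite /egf_part big_ord_recr/= big1 ?add0r => [|j _]; last first.
  by rewrite /w eqSS ltn_eqF// !mul0r.
rewrite /w eqxx mul1r /levy_weight.
have h : L ^+ i.+1 != 0 by rewrite expf_neq0 ?lt0r_neq0.
rewrite [RHS]mulrAC.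
transitivity (L ^- i.+1 * L ^+ i.+1 * (expR (- (L * t)) * t `^ (- alpha - 1) * (t ^+ i.+1 / i.+1`!%:R))); first by ring.
by rewrite mulVf// mul1r.
Qed.

(** One statement with two uses: w i = (L - x)^i expands the scalar x^alpha, and w i = the number of
    walks of length i evaluates a matrix element. *)
Lemma cvg_frac_series w : (forall i, `|w i| <= L ^+ i) ->
  series (fun i => frac_coef i * w i) k @[k --> \oo] -->
  L `^ alpha * w 0%N -
    (\int[mu]_(t in Rpos) (levy_weight t * (egf w t - w 0%N))) / levy_const alpha.
Proof.
move=> wL; have [_ h] := cvg_levy_egf wL.
have mR : measurable (Rpos : set (measurableTypeR R)) by exact: measurable_itv.
rewrite -(cvg_shiftS (series _)).
have -> : (fun k => series (fun i => frac_coef i * w i) k.+1) =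
   (fun k => L `^ alpha * w 0%N -
    (\int[mu]_(t in Rpos) (levy_weight t * egf_part w k t)) / levy_const alpha).
  apply/funext; elim => [|k IH].
    rewrite /series/= big_nat1 /=.
    rewrite (_ : (fun t => _) = cst 0) ?Rintegral_cst ?mul0r ?subr0//.
    by apply/funext => t; rewrite /egf_part big_ord0 mulr0.
  have E : (\int[mu]_(t in Rpos) (levy_weight t * egf_part w k.+1 t)) =
      \int[mu]_(t in Rpos) (levy_weight t * egf_part w k t) + levy_moment k.+1 * w k.+1.
    have i2 : mu.-integrable Rpos (EFin \o (fun t => (expR (- (L * t)) *
        (t ^+ k.+1 / k.+1`!%:R) * t `^ (- alpha - 1)) * w k.+1)).
      have := integrableZr mR (w k.+1) (integrable_levy_moment k).
      by congr (mu.-integrable _ _); apply/funext => t /=; rewrite -EFinM.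
    rewrite /levy_moment -RintegralZr//; last exact: integrable_levy_moment.
    rewrite -(RintegralD mR (integrable_levy_egf_part k wL) i2).
    apply: eq_Rintegral => t _; rewrite /egf_part big_ord_recr/= mulrDr; congr (_ + _).
    by rewrite /levy_weight; ring.
  by rewrite seriesSr/= IH E; ring.
apply: cvgB; first exact: cvg_cst.
by apply: cvgM => //; exact: cvg_cst.
Qed.

Lemma egf_expR y t : egf (fun i => y ^+ i) t = expR (y * t).
Proof.
rewrite /egf /expR; congr (limn (series _)); apply/funext => i.
by rewrite /exp_coeff/= exprMn mulrA.
Qed.

Lemma cvg_frac_series_powR x : `|L - x| <= L ->
  series (fun i => frac_coef i * (L - x) ^+ i) k @[k --> \oo] --> x `^ alpha.
Proof.
move=> xL.
have wL i : `|(L - x) ^+ i| <= L ^+ i.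
  by rewrite normrX lerXn2r ?nnegrE// ltW.
have x0 : 0 <= x by move: xL; rewrite ler_norml => /andP[_ ?]; lra.
have c0 := levy_const_gt0 alpha0 alpha1.
have := cvg_frac_series wL; congr (_ --> _).
rewrite expr0 mulr1.
have -> : \int[mu]_(t in Rpos) (levy_weight t * (egf (fun i => (L - x) ^+ i) t - 1)) =
    L `^ alpha * levy_const alpha - x `^ alpha * levy_const alpha.
  rewrite -!Rintegral_levy_density ?(ltW L0)//.
  have iL := integrable_levy_density alpha0 alpha1 (ltW L0).
  have ix := integrable_levy_density alpha0 alpha1 x0.
  have mR : measurable (Rpos : set (measurableTypeR R)) by exact: measurable_itv.
  rewrite -(RintegralB mR iL ix); apply: eq_Rintegral => t _.
  rewrite egf_expR /levy_weight /levy_density.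
  have -> : expR (- (x * t)) = expR (- (L * t)) * expR ((L - x) * t).
    by rewrite -expRD; congr expR; ring.
  by ring.
rewrite -mulrBl mulfK ?lt0r_neq0//; ring.
Qed.

Lemma levy_moment_gt0 i : 0 < levy_moment i.+1.
Proof.
apply: Rintegral_gt0; first exact: integrable_levy_moment.
move=> t t0; rewrite !mulr_gt0 ?powR_gt0 ?expR_gt0// ?invr_gt0 ?exprn_gt0//.
Qed.

Lemma frac_coef_lt0 i : frac_coef i.+1 < 0.
Proof. by rewrite oppr_lt0 divr_gt0 ?levy_moment_gt0 ?levy_const_gt0. Qed.

(** All coefficients after the first are negative, so at x = 0, where L - x = L, the convergent
    scalar series is absolutely convergent up to sign: the sum of the |c_i| L^i is 2 L^alpha minus
    its value there. *)
Lemma is_cvg_frac_coef : cvgn (series (fun i => `|frac_coef i| * L ^+ i)).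
Proof.
have L1 : `|L - 0| <= L by rewrite subr0 ger0_norm// ltW.
have := cvg_frac_series_powR L1; rewrite subr0 => h.
apply/cvg_ex; exists (2 * L `^ alpha - 0 `^ alpha).
rewrite -(cvg_shiftS (series _)).
have -> : (fun k => series (fun i => `|frac_coef i| * L ^+ i) k.+1) =
   (fun k => 2 * L `^ alpha - series (fun i => frac_coef i * L ^+ i) k.+1).
  apply/funext; elim => [|k IH].
    rewrite /series/= !big_nat1 /= ger0_norm ?powR_ge0// expr0; ring.
  rewrite !(seriesSr _ k.+1) IH ltr0_norm ?frac_coef_lt0//; ring.
by apply: cvgB; [exact: cvg_cst|rewrite (cvg_shiftS (series _))].
Qed.

End FracCoef.

(** * Trinomial coefficients, the walk counts in dimension one *)

Fixpoint trinom (j : nat) (k : int) : nat :=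
  if j is j'.+1 then (trinom j' k + trinom j' (k - 1) + trinom j' (k + 1))%N
  else (k == 0).

Lemma trinom_le j k : (trinom j k <= 3 ^ j)%N.
Proof.
elim: j k => [|j IH] k; first by rewrite /=; case: eqP.
by rewrite /= expnS !mulSn mul0n addn0 addnA !leq_add.
Qed.

Lemma trinomN j k : trinom j (- k) = trinom j k.
Proof.
elim: j k => [|j IH] k; first by rewrite /= oppr_eq0.
rewrite /= IH -addnA [in RHS]addnAC -addnA; congr (_ + (_ + _))%N.
  by rewrite -IH opprD opprK.
by rewrite -IH opprD opprK.
Qed.

Lemma trinom_out j k : (j < `|k|)%N -> trinom j k = 0%N.
Proof.
elim: j k => [|j IH] k jk.
  by rewrite /=; case: eqP jk => // ->.
by rewrite /= !IH//; lia.
Qed.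

(** Thanks to the hold step, the recursions at k + 1 and at k share two terms; what remains compares
    the values at k + 2 and at |k - 1|, which the induction hypothesis orders. *)
Lemma trinom_decr j (k : nat) : (trinom j k.+1 <= trinom j k)%N.
Proof.
elim: j k => [|j IH] k; first by rewrite /=; lia.
rewrite /=.
have -> : (k.+1%:Z - 1 = k :> int) by lia.
have -> : (k.+1%:Z + 1 = k.+2 :> int) by lia.
case: k => [|k].
  have -> : (0%:Z - 1 = - 1%:Z :> int) by [].
  rewrite trinomN (_ : 0%:Z + 1 = 1%:Z)//.
  have := IH 0%N; have := IH 1%N; lia.
have -> : (k.+1%:Z - 1 = k :> int) by lia.
have -> : (k.+1%:Z + 1 = k.+2 :> int) by lia.
have := IH k; have := IH k.+1; have := IH k.+2; lia.
Qed.

Lemma trinom_homo j (k l : nat) : (k <= l)%N -> (trinom j l <= trinom j k)%N.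
Proof.
move=> kl; rewrite -(subnKC kl); elim: (l - k)%N => [|m IH]; first by rewrite addn0.
by rewrite addnS; apply: leq_trans (trinom_decr _ _) IH.
Qed.

Lemma coef_trinom (R : comNzRingType) j i :
  ((1 + 'X + 'X^2 : {poly R}) ^+ j)`_i = (trinom j (i%:Z - j%:Z))%:R.
Proof.
elim: j i => [|j IH] i; first by rewrite expr0 coef1 /= subr0; case: i.
rewrite exprS !mulrDl mul1r !coefD coefXM coefXnM /= !natrD.
have -> : (i%:Z - j.+1%:Z + 1 = i%:Z - j%:Z) by lia.
set p := _ ^+ j in IH *.
have -> : (if i == 0%N then 0 else p`_i.-1) = (trinom j (i%:Z - j.+1%:Z))%:R.
  case: i => [|i] /=; first by rewrite trinom_out//; lia.
  by rewrite IH; congr (trinom _ _)%:R; lia.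
have -> : (if (i < 2)%N then 0 else p`_(i - 2)) = (trinom j (i%:Z - j.+1%:Z - 1))%:R.
  case: i => [|[|i]] /=.
  - by rewrite trinom_out//; lia.
  - by rewrite trinom_out//; lia.
  by rewrite IH; congr (trinom _ _)%:R; lia.
by rewrite IH; ring.
Qed.

(** * Decay of the one-dimensional heat kernel *)

Section Bounds.
Context {R : realType}.
Implicit Types (t y : R).

(* Laurent coefficients of (1 + y + 1/y)^j; as they decrease in |k|, the one at k
   is at most each of those at 0, ..., k. *)
Lemma trinom_sum_bound (y : R) j (k : nat) : 0 < y ->
  (trinom j k)%:R * (\sum_(l < k.+1) y ^+ l) <= (1 + y + y^-1) ^+ j.
Proof.
move=> y0; have y1 : y != 0 by rewrite lt0r_neq0.
have -> : 1 + y + y^-1 = y^-1 * (1 + 'X + 'X^2 : {poly R}).[y].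
  by rewrite !hornerE; field.
rewrite exprMn exprVn -horner_exp -(ler_pM2l (exprn_gt0 j y0)) mulVKf ?expf_neq0//.
set p : {poly R} := (1 + 'X + 'X^2) ^+ j.
pose N := (maxn (size p) (j + k).+1)%N.
rewrite (@horner_coef_wide _ N) ?leq_maxl//.
have p0 i : 0 <= p`_i * y ^+ i by rewrite coef_trinom mulr_ge0// exprn_ge0// ltW.
apply: (@le_trans _ _ (\sum_(j <= i < (j + k).+1) p`_i * y ^+ i)); last first.
  rewrite -(big_mkord xpredT (fun i => p`_i * y ^+ i)).
  rewrite [leRHS](big_cat_nat (n := j))//=; last first.
    by apply: leq_trans (leq_maxr _ _); rewrite ltnW// ltnS leq_addr.
  rewrite [X in _ <= _ + X](big_cat_nat (n := (j + k).+1))//=; last 2 first.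
  - by rewrite ltnW// ltnS leq_addr.
  - exact: leq_maxr.
  by rewrite addrCA lerDl addr_ge0// sumr_ge0.
rewrite -[leRHS]/(\sum_(0 + j <= i < (j + k).+1) _) big_addn subSn ?leq_addr// addKn.
rewrite big_mkord mulrA mulr_sumr.
apply: ler_sum => l _; rewrite coef_trinom exprD.
have -> : ((l + j)%N%:Z - j%:Z = l :> int) by lia.
rewrite [y ^+ l * _]mulrC mulrA ler_wpM2r ?exprn_ge0 ?(ltW y0)// mulrC.
rewrite ler_wpM2r ?exprn_ge0 ?(ltW y0)// ler_nat.
by apply: trinom_homo; rewrite -ltnS.
Qed.

Definition trinom_egf t (k : int) : R := egf (fun j => (trinom j k)%:R) t.

Definition heat1 t (k : int) : R := expR (- (3 * t)) * trinom_egf t k.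

Lemma trinom_bound (k : int) j : `|(trinom j k)%:R : R| <= 3 ^+ j.
Proof. by rewrite ger0_norm// -natrX ler_nat trinom_le. Qed.

Lemma is_cvg_trinom_egf t k : 0 <= t ->
  cvgn (series (fun j => (trinom j k)%:R * (t ^+ j / j`!%:R) : R)).
Proof. by move=> t0; apply: (@is_cvg_egf _ 3) => //; exact: trinom_bound. Qed.

Lemma heat1N t k : heat1 t (- k) = heat1 t k.
Proof.
rewrite /heat1 /trinom_egf; congr (_ * egf _ _).
by apply/funext => j; rewrite trinomN.
Qed.

Lemma heat1_ge0 t k : 0 <= t -> 0 <= heat1 t k.
Proof.
move=> t0; rewrite mulr_ge0 ?expR_ge0//.
apply: limr_ge; first exact: is_cvg_trinom_egf.
by apply: nearW => n; apply: sumr_ge0 => i _; rewrite mulr_ge0// divr_ge0 ?exprn_ge0.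
Qed.

Lemma egf_le (w : nat -> R) c C t : 0 <= t -> 
  cvgn (series (fun j => w j * (t ^+ j / j`!%:R))) ->
  (forall j, w j * C <= c ^+ j) -> egf w t * C <= expR (c * t).
Proof.
move=> t0 cw wc.
have : series (fun j => w j * (t ^+ j / j`!%:R)) k * C @[k --> \oo] --> egf w t * C.
  by apply: cvgM; [exact: cw|exact: cvg_cst].
move/ler_cvg_to => h.
have := is_cvg_series_exp_coeff (c * t) => h2.
apply: (h _ _ h2); apply: nearW => n.
rewrite /series/= mulr_suml; apply: ler_sum => i _.
rewrite /exp_coeff/= exprMn mulrAC -[leRHS]mulrA ler_wpM2r//.
by rewrite divr_ge0 ?exprn_ge0.
Qed.

Lemma heat1_le1 t k : 0 <= t -> heat1 t k <= 1.
Proof.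
move=> t0; rewrite /heat1 expRN mulrC ler_pdivrMr ?expR_gt0// mul1r.
have := @egf_le (fun j => (trinom j k)%:R) 3 1 t t0 (is_cvg_trinom_egf (k := k) t0).
by rewrite mulr1; apply => j; rewrite mulr1 -natrX ler_nat trinom_le.
Qed.

Lemma expn_le_ffact n m a : (a <= m.+1)%N -> ((n - m) ^ a <= n ^_ a)%N.
Proof.
elim: a => [|a IH] am; first by rewrite expn0 ffactn0.
rewrite expnSr ffactnSr leq_mul ?IH//; first exact: ltnW.
by rewrite leq_sub2l.
Qed.

(** The geometric sum is ((1 + theta)^(k+1) - 1)/theta; only the binomial term of degree m + 1 is
    kept. Its coefficient is at least (k + 1 - m)^(m+1)/(m+1)!, and 2m <= k makes the base at least
    k/2. *)
Lemma sum_pow_lower (theta : R) (m k : nat) : 0 < theta -> (m.*2 <= k)%N ->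
  (k%:R / 2) ^+ m.+1 / m.+1`!%:R * theta ^+ m <= \sum_(l < k.+1) (1 + theta) ^+ l.
Proof.
move=> th0 mk.
have h0 : 0 <= theta by exact: ltW.
have : 'C(k.+1, m.+1)%:R * theta ^+ m.+1 <= (1 + theta) ^+ k.+1 - 1.
  rewrite exprDn big_ord_recl expr1n expr0 mulr1 bin0 mulr1n addrAC subrr add0r.
  have mk1 : (m < k.+1)%N by rewrite ltnS (leq_trans _ mk)// -addnn leq_addr.
  rewrite (bigD1 (Ordinal mk1))//= expr1n mul1r mulr_natl lerDl.
  by apply: sumr_ge0 => i _; rewrite expr1n mul1r mulrn_wge0// exprn_ge0.
rewrite subrX1 (_ : 1 + theta - 1 = theta); last by ring.
rewrite exprS mulrCA ler_pM2l//; apply: le_trans.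
rewrite ler_wpM2r ?exprn_ge0// ler_pdivrMr ?ltr0n ?fact_gt0// -natrM bin_ffact.
have mk1 : (m <= k)%N by rewrite (leq_trans _ mk)// -addnn leq_addr.
apply: (@le_trans _ _ ((k.+1 - m) ^ m.+1)%N%:R); last by rewrite ler_nat expn_le_ffact.
rewrite natrX lerXn2r ?nnegrE ?divr_ge0// ler_pdivrMr// -natrM ler_nat.
by move: mk; rewrite -addnn; lia.
Qed.

(* Take y = 1 + 1/sqrt t in trinom_sum_bound: the right side costs a factor e only,
   and sum_(l <= k) y^l is at least a multiple of k (k / sqrt t)^m. *)
Lemma heat1_decay_large m : exists2 C : R, 0 < C & forall t (k : nat), 1 <= t -> (0 < k)%N ->
  heat1 t k <= C * Num.sqrt t ^+ m / k%:R ^+ m.+1.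
Proof.
pose C1 : R := expR 1 * m.+1`!%:R * 2 ^+ m.+1.
(* C2 takes care of k < 2m, where the trivial bound [heat1_le1] is enough. *)
pose C2 : R := m.*2%:R ^+ m.+1.
have C10 : 0 < C1 by rewrite !mulr_gt0 ?expR_gt0 ?exprn_gt0// ltr0n fact_gt0.
have C20 : 0 <= C2 by rewrite exprn_ge0.
exists (C1 + C2) => [|t k t1 k0]; first by rewrite ltr_pwDl.
have t0 : 0 < t by exact: lt_le_trans t1.
have kR : (0 : R) < k%:R by rewrite ltr0n.
have s1 : 1 <= Num.sqrt t by rewrite -[leLHS]sqrtr1 ler_sqrt ?(ltW t0).
have s0 : 0 < Num.sqrt t by exact: lt_le_trans s1.
have sm : 1 <= Num.sqrt t ^+ m by rewrite exprn_ege1.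
rewrite ler_pdivlMr ?exprn_gt0//.
have [mk|km] := leqP m.*2 k; last first.
  apply: (@le_trans _ _ (1 * C2)).
    apply: ler_pM; rewrite ?heat1_ge0 ?heat1_le1 ?exprn_ge0 ?(ltW t0)//.
    by rewrite lerXn2r ?nnegrE// ler_nat ltnW.
  rewrite mul1r -[leLHS]mulr1; apply: ler_pM => //.
  by rewrite lerDr ltW.
pose theta := (Num.sqrt t)^-1.
have th0 : 0 < theta by rewrite invr_gt0.
have th2 : theta ^+ 2 * t = 1.
  by rewrite exprVn sqr_sqrtr ?(ltW t0)// mulVf// lt0r_neq0.
have y0 : 0 < 1 + theta by rewrite addr_gt0.
set S := \sum_(l < k.+1) (1 + theta) ^+ l.
have hS := sum_pow_lower th0 mk.
have h1 : heat1 t k * S <= expR 1.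
  rewrite /heat1 -mulrA.
  have h := @egf_le (fun j => (trinom j k)%:R) (1 + (1 + theta) + (1 + theta)^-1) S t (ltW t0)
    (is_cvg_trinom_egf (k := k) (ltW t0)) (fun j => trinom_sum_bound j k y0).
  apply: le_trans (ler_wpM2l (expR_ge0 _) h) _.
  rewrite -expRD ler_expR.
  have -> : - (3 * t) + (1 + (1 + theta) + (1 + theta)^-1) * t = theta ^+ 2 * t / (1 + theta).
    by field; rewrite lt0r_neq0.
  by rewrite th2 mul1r invf_le1// lerDl ltW.
have : heat1 t k * ((k%:R / 2) ^+ m.+1 / m.+1`!%:R * theta ^+ m) <= expR 1.
  apply: le_trans h1; rewrite ler_wpM2l ?heat1_ge0 ?(ltW t0)//.
have -> : heat1 t k * ((k%:R / 2) ^+ m.+1 / m.+1`!%:R * theta ^+ m) =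
    heat1 t k * k%:R ^+ m.+1 / (m.+1`!%:R * 2 ^+ m.+1 * Num.sqrt t ^+ m).
  rewrite expr_div_n exprVn; field.
  by rewrite expf_neq0 ?lt0r_neq0// expf_neq0//= pnatr_eq0 -lt0n fact_gt0.
rewrite ler_pdivrMr; last by rewrite !mulr_gt0 ?exprn_gt0// ltr0n fact_gt0.
move/le_trans; apply; rewrite !mulrA ler_wpM2r//.
by rewrite lerDl.
Qed.

(** Reaching k <> 0 takes at least one step, so the series in t has no constant term, and t^j <= t
    for j >= 1 and t <= 1 extracts the factor t. *)
Lemma heat1_small t (k : nat) : 0 < t -> t <= 1 -> (0 < k)%N ->
  heat1 t k <= t * (expR 3 * heat1 1 k).
Proof.
move=> t0 t1 k0.
have -> : expR 3 * heat1 1 k = trinom_egf 1 k.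
  by rewrite /heat1 mulr1 mulrA -expRD subrr expR0 mul1r.
apply: (@le_trans _ _ (trinom_egf t k)).
  rewrite /heat1 ler_piMl//; last by rewrite expR_le1 oppr_le0 mulr_ge0// ltW.
  by apply: limr_ge; [exact: is_cvg_trinom_egf (ltW t0)|apply: nearW => n;
    apply: sumr_ge0 => i _; rewrite mulr_ge0// divr_ge0// exprn_ge0// ltW].
have c1 : t * series (fun j => (trinom j k)%:R * (1 ^+ j / j`!%:R)) n @[n --> \oo] --> t * trinom_egf 1 k.
  by apply: cvgM; [exact: cvg_cst|exact: is_cvg_trinom_egf].
apply: (ler_cvg_to (is_cvg_trinom_egf (k := k) (ltW t0)) c1).
apply: nearW => n; rewrite /series/= mulr_sumr; apply: ler_sum => -[_|j _].
  by rewrite /= (gtn_eqF k0 : (k%:Z == 0) = false) !mul0r mulr0.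
rewrite expr1n [leRHS]mulrCA ler_wpM2l// mulrA ler_wpM2r// mulr1 exprS ler_piMr ?(ltW t0)//.
by rewrite exprn_ile1// ltW.
Qed.

Lemma heat1_decay m : exists2 C : R, 0 < C & forall t (k : nat), 0 < t -> (0 < k)%N ->
  heat1 t k <= C * Num.max t (Num.sqrt t ^+ m) / k%:R ^+ m.+1.
Proof.
have [C C0 hC] := heat1_decay_large m.
exists (expR 3 * C) => [|t k t0 k0]; first by rewrite mulr_gt0 ?expR_gt0.
have kR : (0 : R) < k%:R ^+ m.+1 by rewrite exprn_gt0// ltr0n.
have [t1|/ltW t1] := leP t 1.
  apply: le_trans (heat1_small t0 t1 k0) _.
  have := hC 1 k (lexx _) k0; rewrite sqrtr1 expr1n mulr1 => h.
  rewrite mulrCA -!mulrA ler_wpM2l ?expR_ge0//.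
  apply: (@le_trans _ _ (t * (C / k%:R ^+ m.+1))).
    by rewrite ler_wpM2l// ltW.
  rewrite mulrCA ler_wpM2l ?(ltW C0)// ler_wpM2r ?invr_ge0 ?(ltW kR)//.
  by rewrite le_max lexx.
apply: le_trans (hC t k t1 k0) _.
rewrite ler_wpM2r ?invr_ge0 ?(ltW kR)//.
apply: ler_pM.
- exact: ltW.
- by rewrite exprn_ge0// sqrtr_ge0.
- by rewrite ler_peMl ?(ltW C0)// ltW// expR_gt1.
- by rewrite le_max lexx orbT.
Qed.

End Bounds.

(** * Factorization of the heat kernel *)

Section ProductFormula.
Context {R : realType} {d : nat}.
Implicit Types (n : 'Z^d) (p q : {poly R}).

Definition eq_upto (m : nat) p q := forall i, (i <= m)%N -> p`_i = q`_i.

Lemma eq_upto_mulr m p p' q : eq_upto m p p' -> eq_upto m (p * q) (p' * q).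
Proof.
move=> e i im; rewrite !coefM; apply: eq_bigr => k _; rewrite e//.
by apply: leq_trans im; rewrite -ltnS.
Qed.

Definition trinom_poly (J : nat) (k : int) : {poly R} :=
  \poly_(j < J.+1) ((trinom j k)%:R / j`!%:R).

(* Truncated exponential generating functions; the derivative identity of the
   product is the recursion of lattice_walks. *)
Definition walk_poly (J : nat) n : {poly R} := \prod_(i < d) trinom_poly J (n 0 i).

Lemma deriv_prod (I : eqType) (s : seq I) (F : I -> {poly R}) : uniq s ->
  (\prod_(i <- s) F i)^`() = \sum_(i <- s) ((F i)^`() * \prod_(j <- s | j != i) F j).
Proof.
elim: s => [|i s IH] /=; first by rewrite !big_nil derivC.
move=> /andP[ins us]; rewrite !big_cons derivM IH// eqxx/=; congr (_ * _ + _).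
  rewrite big_seq_cond [RHS]big_seq_cond; apply: eq_bigl => j.
  rewrite andbT; case: (boolP (j \in s)) => //= js.
  by apply/esym; apply: contraNneq ins => <-.
rewrite mulr_sumr [LHS]big_seq [RHS]big_seq; apply: eq_bigr => j js.
have ij : i != j by apply: contra ins => /eqP ->.
by rewrite big_cons ij mulrCA.
Qed.

Lemma deriv_trinom_poly J k : eq_upto J (trinom_poly J.+1 k)^`()
  (trinom_poly J.+1 k + trinom_poly J.+1 (k - 1) + trinom_poly J.+1 (k + 1)).
Proof.
move=> j jJ; rewrite coef_deriv !coefD !coef_poly !ltnS jJ !(leqW jJ).
rewrite -!mulrDl -!natrD -[(_ + _ + _)%N]/(trinom j.+1 k) factS natrM.
rewrite -mulr_natl; field.
by rewrite pnatr_eq0 -lt0n fact_gt0 nat1r pnatr_eq0.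
Qed.

Lemma coef_walk_poly J j n : (j <= J)%N ->
  (walk_poly J n)`_j = (lattice_walks j n)%:R / j`!%:R.
Proof.
elim: j n => [|j IH] n jJ.
  have -> : (walk_poly J n)`_0 = \prod_(i < d) (trinom_poly J (n 0 i))`_0.
    rewrite -horner_coef0 horner_prod; apply: eq_bigr => i _.
    by rewrite horner_coef0.
  rewrite /= fact0 divr1.
  have E i : (trinom_poly J (n 0 i))`_0 = (n 0 i == 0)%:R by rewrite coef_poly /= fact0 divr1.
  under eq_bigr do rewrite E.
  have [->|n0] := eqVneq n 0; first by rewrite big1// => i _; rewrite mxE eqxx.
  have [i ni] : exists i, n 0 i != 0.
    apply/existsP; apply: contra_neqT n0 => /existsPn h; apply/rowP => i.
    by rewrite mxE; apply/eqP; move/negPn: (h i).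
  by rewrite (bigD1 i)//= (negbTE ni) mul0r.
case: J jJ IH => [//|J] jJ IH.
have step : ((walk_poly J.+1 n)^`())`_j = \sum_(i < d) ((walk_poly J.+1 n)`_j
    + (walk_poly J.+1 (n - unitv i))`_j + (walk_poly J.+1 (n + unitv i))`_j).
  rewrite /walk_poly deriv_prod ?index_enum_uniq// coef_sum.
  apply: eq_bigr => i _.
  rewrite (eq_upto_mulr _ (@deriv_trinom_poly J (n 0 i)))//.
  rewrite !mulrDl !coefD.
  have pr (v : 'Z^d) : (forall l, l != i -> v 0 l = n 0 l) ->
      trinom_poly J.+1 (v 0 i) * \prod_(l < d | l != i) trinom_poly J.+1 (n 0 l) =
      \prod_(l < d) trinom_poly J.+1 (v 0 l).
    move=> vn; rewrite [RHS](bigD1 i)//=; congr (_ * _).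
    by apply: eq_bigr => l li; rewrite vn.
  rewrite -(pr n)// -(pr (n - unitv i)) -?(pr (n + unitv i)).
  - by rewrite !mxE !eqxx.
  - by move=> l li; rewrite !mxE (negbTE li) andbF addr0.
  - by move=> l li; rewrite !mxE (negbTE li) andbF subr0.
have := coef_deriv (walk_poly J.+1 n) j; rewrite step => e.
have j1 : j.+1%:R != 0 :> R by rewrite pnatr_eq0.
apply: (mulfI j1); rewrite [LHS]mulr_natl -e.
rewrite (eq_bigr (fun i => ((lattice_walks j n)%:R + (lattice_walks j (n - unitv i))%:R +
   (lattice_walks j (n + unitv i))%:R) / j`!%:R)); last first.
  by move=> i _; rewrite !IH ?(ltnW jJ)// !mulrDl.
rewrite -mulr_suml /= natr_sum factS natrM.
under eq_bigr do rewrite -!natrD.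
field.
by rewrite nat1r j1 pnatr_eq0 -lt0n fact_gt0.
Qed.

Lemma trinom_poly_le J J' k j : (J <= J')%N ->
  0 <= (trinom_poly J k)`_j <= (trinom_poly J' k)`_j.
Proof.
move=> JJ; rewrite !coef_poly; case: ifPn => jJ.
  by rewrite (leq_trans jJ)//= divr_ge0/=.
by rewrite lexx/=; case: ifPn => // _; rewrite divr_ge0.
Qed.

Lemma walk_poly_le J J' n j : (J <= J')%N ->
  0 <= (walk_poly J n)`_j <= (walk_poly J' n)`_j.
Proof.
move=> JJ; rewrite /walk_poly; elim/big_rec2: _ j => [|i p q _ IH] j.
  by rewrite coef1 lexx andbT ler0n.
rewrite !coefM; apply/andP; split.
  apply: sumr_ge0 => l _; have /andP[h1 _] := trinom_poly_le (n 0 i) l JJ.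
  have /andP[h2 h3] := IH (j - l)%N.
  by rewrite mulr_ge0//; exact: le_trans h3.
apply: ler_sum => l _; have /andP[h1 h1'] := trinom_poly_le (n 0 i) l JJ.
have /andP[h2 h3] := IH (j - l)%N.
by apply: ler_pM.
Qed.

Lemma lattice_walks_le j n : (lattice_walks j n <= (3 * d) ^ j)%N.
Proof.
elim: j n => [|j IH] n; first by rewrite /=; case: eqP.
rewrite /= expnS -[X in (_ <= 3 * X * _)%N]card_ord -sum1_card big_distrr/= big_distrl/=.
apply: leq_sum => i _; rewrite muln1.
by have := IH n; have := IH (n - unitv i); have := IH (n + unitv i); lia.
Qed.

Lemma lattice_walks_bound n j : `|(lattice_walks j n)%:R : R| <= (3 * d%:R) ^+ j.
Proof. by rewrite ger0_norm// -natrM -natrX ler_nat lattice_walks_le. Qed.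

Lemma cvg_prodr (I : Type) (s : seq I) (f : nat -> I -> R) (l : I -> R) :
  (forall i, f k i @[k --> \oo] --> l i) ->
  \prod_(i <- s) f k i @[k --> \oo] --> \prod_(i <- s) l i.
Proof.
move=> h; elim: s => [|i s IH].
  by under eq_fun do rewrite big_nil; rewrite big_nil; exact: cvg_cst.
by under eq_fun do rewrite big_cons; rewrite big_cons; exact: cvgM.
Qed.

(** The product of truncations has the exact coefficients up to degree J, and beyond J coefficients
    that are nonnegative and no larger than the exact ones. For t >= 0 its value thus lies between a
    partial sum and the full series, and a squeeze replaces a Cauchy product of infinite series. *)
Lemma egf_lattice_walks n t : (0 < d)%N -> 0 <= t ->
  egf (fun j => (lattice_walks j n)%:R) t = \prod_(i < d) trinom_egf t (n 0 i) :> R.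
Proof.
move=> d0 t0.
have L0 : (0 : R) < 3 * d%:R by rewrite mulr_gt0// ltr0n.
have cw := is_cvg_egf L0 (lattice_walks_bound n) t0.
have c1 : (walk_poly J n).[t] @[J --> \oo] --> \prod_(i < d) trinom_egf t (n 0 i).
  rewrite /walk_poly; under eq_fun do rewrite horner_prod.
  apply: cvg_prodr => i.
  pose u j : R := (trinom j (n 0 i))%:R * (t ^+ j / j`!%:R).
  have h : series u J @[J --> \oo] --> trinom_egf t (n 0 i) by exact: is_cvg_trinom_egf.
  rewrite -(cvg_shiftS (series u)) in h.
  under eq_fun => J.
    rewrite (_ : _.[t] = series u J.+1); first over.
    rewrite horner_poly /series/= big_mkord; apply: eq_bigr => j _.
    by rewrite /u mulrAC mulrA.
  exact: h.
pose u j : R := (lattice_walks j n)%:R * (t ^+ j / j`!%:R).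
have u0 j : 0 <= u j by rewrite mulr_ge0// divr_ge0// exprn_ge0.
have h : series u J @[J --> \oo] --> egf (fun j => (lattice_walks j n)%:R) t by exact: cw.
apply/eqP; rewrite eq_le; apply/andP; split.
  rewrite -(cvg_shiftS (series u)) in h.
  apply: (ler_cvg_to h c1); apply: nearW => J.
  rewrite (horner_coef_wide _ (leq_maxl (size (walk_poly J n)) J.+1)).
  rewrite -(big_mkord xpredT (fun j => (walk_poly J n)`_j * t ^+ j)).
  rewrite [leRHS](big_cat_nat (n := J.+1))//=; last exact: leq_maxr.
  rewrite -[leLHS]addr0; apply: lerD.
    rewrite /series/=; apply: ler_sum_nat => j /andP[_ jJ].
    by rewrite coef_walk_poly// /u mulrAC mulrA.
  apply: sumr_ge0 => j _; have /andP[h1 _] := @walk_poly_le J J n j (leqnn _).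
  by rewrite mulr_ge0// exprn_ge0.
apply: (cvgr_to_le c1); apply: nearW => J.
rewrite horner_coef; apply: (@le_trans _ _ (series u (size (walk_poly J n)))).
  rewrite /series/= big_mkord; apply: ler_sum => j _.
  have /andP[_ h1] := @walk_poly_le J (maxn J j) n j (leq_maxl _ _).
  rewrite /u [leRHS]mulrCA [leLHS]mulrC; apply: ler_wpM2l; first exact: exprn_ge0.
  by rewrite -(@coef_walk_poly (maxn J j)) ?leq_maxr.
by apply: nondecreasing_cvgn_le; [apply: nondecreasing_series => i _ _|exact: cw].
Qed.

End ProductFormula.

(** * The local limit theorem *)

Section Trig.
Context {R : realType}.
Implicit Types (x y : R).

Lemma sin_le_id x : 0 <= x -> sin x <= x.
Proof.
rewrite le_eqVlt => /predU1P[<-|x0]; first by rewrite sin0.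
have [c _] := @MVT R sin cos 0 x x0 (fun y _ => is_derive_sin y)
  (continuous_subspaceT (@continuous_sin R)).
by rewrite sin0 !subr0 => ->; rewrite ler_piMl ?(ltW x0)// cos_le1.
Qed.

Lemma one_sub_cos x : 1 - cos x = 2 * sin (x / 2) ^+ 2.
Proof.
have e : x = x / 2 + x / 2 by field.
rewrite {1}e cosD -!expr2 cos2sin2.
by move: (sin _ ^+ 2) => a; ring.
Qed.

Lemma one_sub_cos_le x : 0 <= x -> 1 - cos x <= x ^+ 2 / 2.
Proof.
move=> x0; rewrite one_sub_cos.
have h0 : 0 <= x / 2 by rewrite divr_ge0.
have h1 : sin (x / 2) ^+ 2 <= (x / 2) ^+ 2.
  have [s0|/ltW s0] := leP 0 (sin (x / 2)).
    by rewrite lerXn2r ?nnegrE// sin_le_id.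
  have : sin (x / 2 ) ^+ 2 <= 1.
    by rewrite -[leLHS]real_normK ?num_real// expr_le1// sin_max.
  have [h2|/ltW h2] := leP (x / 2) 1.
    have : 0 <= sin (x / 2).
      rewrite sin_ge0_pi// h0/=; have := pihalf_ge1 R; lra.
    move=> s1 _; have /eqP -> : sin (x / 2) == 0 by rewrite eq_le s0.
    by rewrite expr0n sqr_ge0.
  by move=> h3; apply: le_trans h3 _; rewrite expr_ge1.
have : x ^+ 2 / 2 = 2 * (x / 2) ^+ 2 by field.
by move: h1; move: (_ ^+ 2) (_ ^+ 2) (_ ^+ 2) => a b c; lra.
Qed.

(** A weak form of Jordan's inequality, with 1/4 in place of 2/pi: the mean value theorem gives 1/2
    up to y = 1, and beyond it sin only increases while y <= pi/2 < 2. Any positive constant serves,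
    as it only enters the exponent of a Gaussian majorant. *)
Lemma sin_ge_lin y : 0 <= y -> y <= pi / 2 -> y / 4 <= sin y.
Proof.
have s1 (z : R) : 0 <= z -> z <= 1 -> z / 2 <= sin z.
  rewrite le_eqVlt => /predU1P[<-|z0 z1]; first by rewrite sin0 mul0r.
  have [c + ] := @MVT R sin cos 0 z z0 (fun y _ => is_derive_sin y)
    (continuous_subspaceT (@continuous_sin R)).
  rewrite in_itv/= => /andP[c0 cz]; rewrite sin0 !subr0 => ->.
  rewrite mulrC ler_wpM2r ?(ltW z0)//.
  have := one_sub_cos_le (ltW c0).
  have : c ^+ 2 <= 1 by rewrite expr_le1 ?(ltW c0)// (le_trans (ltW cz)).
  by move: (c ^+ 2) => c2; lra.
move=> y0 yp; have [y1|y1] := leP y 1.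
  by apply: le_trans (s1 _ y0 y1); lra.
have [c +] := @MVT R sin cos 1 y y1 (fun y _ => is_derive_sin y)
  (continuous_subspaceT (@continuous_sin R)).
rewrite in_itv/= => /andP[c0 cz] e.
have p0 := pihalf_lt2 R.
have cc : 0 <= cos c.
  by rewrite cos_ge0_pihalf//; apply/andP; split; [move: (pihalf_ge1 R); lra|lra].
have := s1 1 ler01 (lexx _).
have : 0 <= cos c * (y - 1) by rewrite mulr_ge0// subr_ge0 ltW.
lra.
Qed.

Lemma one_sub_cos_ge x : 0 <= x -> x <= pi -> x ^+ 2 / 32 <= 1 - cos x.
Proof.
move=> x0 xp; rewrite one_sub_cos.
have h : x / 2 / 4 <= sin (x / 2).
  apply: sin_ge_lin; first by rewrite divr_ge0.
  by rewrite ler_wpM2r.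
have h8 : 0 <= x / 2 / 4 by rewrite !divr_ge0.
have : (x / 2 / 4) ^+ 2 <= sin (x / 2) ^+ 2.
  by rewrite lerXn2r ?nnegrE//; exact: le_trans h.
have : x ^+ 2 / 32 = 2 * (x / 2 / 4) ^+ 2 by field.
by move: (_ ^+ 2) (_ ^+ 2) (_ ^+ 2) => a b c; lra.
Qed.

Lemma sin_nat_pi (n : nat) : sin (n%:R * pi) = 0 :> R.
Proof.
elim: n => [|n IH]; first by rewrite mul0r sin0.
by rewrite -natr1 mulrDl mul1r sinDpi IH oppr0.
Qed.

Lemma sin_int_pi (k : int) : sin (k%:~R * pi) = 0 :> R.
Proof.
case: k => n; first exact: sin_nat_pi.
by rewrite NegzE rmorphN mulNr sinN sin_nat_pi oppr0.
Qed.

(** The left factor of 2 (1 - cos x) = 4 sin(x/2)^2 is x^2 cos(c)^2 with c < x/2, and cos c >= 1 -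
    x^2/8. The loss is of fourth order, so at x = u/s it still vanishes after multiplication by
    s^2. *)
Lemma one_sub_cos_ge_quartic x : 0 <= x -> x <= 1 ->
  x ^+ 2 * (1 - x ^+ 2 / 4) <= 2 * (1 - cos x).
Proof.
rewrite le_eqVlt => /predU1P[<- _|x0 x1].
  by rewrite expr0n mul0r cos0 subrr mulr0.
have y0 : 0 < x / 2 by rewrite divr_gt0.
have [c + ] := @MVT R sin cos 0 (x / 2) y0 (fun y _ => is_derive_sin y)
  (continuous_subspaceT (@continuous_sin R)).
rewrite in_itv/= sin0 !subr0 one_sub_cos => /andP[c0 cy] ->.
rewrite exprMn.
have h := one_sub_cos_le (ltW c0).
have h2 : c ^+ 2 <= (x / 2) ^+ 2 by rewrite lerXn2r ?nnegrE// ltW.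
have h3 : 1 - x ^+ 2 / 8 <= cos c.
  move: h h2; rewrite expr_div_n; move: (c ^+ 2) (x ^+ 2) => a b; lra.
have h4 : x ^+ 2 <= 1 by rewrite expr_le1 ?(ltW x0).
have h5 : 1 - x ^+ 2 / 4 <= cos c ^+ 2.
  apply: (@le_trans _ _ ((1 - x ^+ 2 / 8) ^+ 2)); last first.
    rewrite lerXn2r ?nnegrE//; first by move: h4; move: (x ^+ 2) => a; lra.
    by apply: le_trans h3; move: h4; move: (x ^+ 2) => a; lra.
  have := sqr_ge0 (x ^+ 2 / 8); move: (x ^+ 2) => a; nra.
rewrite expr_div_n.
have := sqr_ge0 x; move: h5; move: (x ^+ 2) (cos c ^+ 2) => a b; nra.
Qed.

Lemma cvg_one_sub_cos_scaled (s : nat -> R) (u : R) : 0 <= u -> (forall n, 0 < s n) ->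
  (s n)^-1 @[n --> \oo] --> (0 : R) ->
  2 * s n ^+ 2 * (1 - cos (u / s n)) @[n --> \oo] --> u ^+ 2.
Proof.
move=> u0 s0 scv.
have x0 n : 0 <= u / s n by rewrite divr_ge0 ?(ltW (s0 n)).
have cv : u / s n @[n --> \oo] --> (0 : R).
  by rewrite -[X in _ --> X](mulr0 u); apply: cvgM => //; exact: cvg_cst.
have cl : u ^+ 2 * (1 - (u / s n) ^+ 2 / 4) @[n --> \oo] --> u ^+ 2.
  rewrite -[X in _ --> X]mulr1; apply: cvgM; first exact: cvg_cst.
  rewrite -[X in _ --> X]subr0; apply: cvgB; first exact: cvg_cst.
  rewrite -[X in _ --> X](mul0r 4^-1); apply: cvgM; last exact: cvg_cst.
  by rewrite -[X in _ --> X](mulr0 0); apply: cvgM.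
apply: squeeze_cvgr cl (cvg_cst _); near=> n.
have e : u ^+ 2 = s n ^+ 2 * (u / s n) ^+ 2 by field; rewrite lt0r_neq0.
have x1 : u / s n <= 1 by apply: ltW; near: n; apply: (cvgr_lt _ cv); exact: ltr01.
have := one_sub_cos_ge_quartic (x0 n) x1; have := one_sub_cos_le (x0 n).
rewrite /cst e; have := sqr_ge0 (s n).
move: (s n ^+ 2) ((u / s n) ^+ 2) (1 - cos _) => a b c a0 h1 h2.
by apply/andP; split; nra.
Unshelve. all: by end_near.
Qed.

End Trig.

(** * Fourier representation of the heat kernel *)

Section Fourier.
Context {R : realType}.
Local Notation mu := (@lebesgue_measure R).
Implicit Types (t s x u b : R) (k : int) (j : nat).

Lemma integrable_segment (f : R -> R) (a b : R) : continuous f ->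
  mu.-integrable `[a, b] (EFin \o f).
Proof.
move=> cf; apply: continuous_compact_integrable; first exact: segment_compact.
exact: continuous_subspaceT.
Qed.

Lemma continuous_is_derive (F f : R -> R) : (forall x, is_derive x 1 F (f x)) -> continuous F.
Proof.
by move=> dF x; have [h _] := dF x; apply: differentiable_continuous; apply/derivable1_diffP.
Qed.

Lemma Rintegral_segment_FTC (F f : R -> R) (a b : R) : a < b ->
  (forall x, is_derive x 1 F (f x)) -> continuous f ->
  \int[mu]_(x in `[a, b]) f x = F b - F a.
Proof.
move=> ab dF cf; have cF := continuous_is_derive dF.
rewrite /Rintegral (@continuous_FTC2 _ f F)//.
- exact: continuous_subspaceT.
- split.
  + by move=> x _; have [] := dF x.
  + by apply: cvg_at_right_filter; exact: cF.
  + by apply: cvg_at_left_filter; exact: cF.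
- by move=> x _; rewrite derive1E; have [_ ->] := dF x.
Qed.

Lemma continuous_cosZ (a : R) : continuous (fun x => cos (a * x)).
Proof.
move=> x; apply: continuous_comp; last exact: continuous_cos.
by apply: cvgM; [exact: cvg_cst|exact: cvg_id].
Qed.

Lemma is_derive_sinZ (a x : R) : is_derive x 1 (fun x => sin (a * x)) (a * cos (a * x)).
Proof.
have d1 : is_derive x 1 (fun x => a * x) a.
  by apply: is_derive_eq (is_deriveZ a (is_derive_id x 1)) _; rewrite /GRing.scale/= mulr1.
have := @is_derive1_comp R sin (fun x => a * x) x _ _ (is_derive_sin _) d1.
by rewrite mulrC.
Qed.

Lemma is_derive_cosZ (a x : R) : is_derive x 1 (fun x => cos (a * x)) (- (a * sin (a * x))).
Proof.
have d1 : is_derive x 1 (fun x => a * x) a.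
  by apply: is_derive_eq (is_deriveZ a (is_derive_id x 1)) _; rewrite /GRing.scale/= mulr1.
have := @is_derive1_comp R cos (fun x => a * x) x _ _ (is_derive_cos _) d1.
by rewrite mulNr mulrC.
Qed.

Lemma Rintegral_cos k : \int[mu]_(x in `[0, pi]) cos (k%:~R * x) = pi * (k == 0)%:R.
Proof.
have cc := @continuous_cosZ k%:~R.
have [k0|k0] := eqVneq k 0.
  have dF x : is_derive x 1 id (cos (k%:~R * x)) by rewrite k0 mul0r cos0; exact: is_derive_id.
  by rewrite (Rintegral_segment_FTC (pi_gt0 R) dF cc) subr0 mulr1.
have kR : k%:~R != 0 :> R by rewrite intr_eq0.
have dF x : is_derive x 1 (fun x => k%:~R^-1 * sin (k%:~R * x)) (cos (k%:~R * x)).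
  apply: is_derive_eq (is_deriveZ _ (is_derive_sinZ k%:~R x)) _.
  by rewrite /GRing.scale/= mulKf.
by rewrite (Rintegral_segment_FTC (pi_gt0 R) dF cc) sin_int_pi !mulr0 sin0 mulr0 subrr.
Qed.

Lemma continuous_trigpoly j k : continuous (fun x => (1 + 2 * cos x) ^+ j * cos (k%:~R * x)).
Proof.
move=> x; apply: cvgM; last exact: continuous_cosZ.
apply: (@continuous_comp _ _ _ (fun x => 1 + 2 * cos x) (fun y => y ^+ j)); last exact: exprn_continuous.
apply: cvgD; first exact: cvg_cst.
by apply: cvgM; [exact: cvg_cst|exact: continuous_cos].
Qed.

(** Since 2 cos x cos(k x) = cos((k-1) x) + cos((k+1) x), one more factor 1 + 2 cos x acts on the
    integral exactly as the recursion of [trinom]. By evenness half a period suffices. *)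
Lemma Rintegral_trigpoly j k :
  \int[mu]_(x in `[0, pi]) ((1 + 2 * cos x) ^+ j * cos (k%:~R * x)) = pi * (trinom j k)%:R.
Proof.
elim: j k => [|j IH] k.
  rewrite /= -[k == 0]/(k == 0)%R -Rintegral_cos; congr fine.
  by apply: eq_integral => x _; rewrite expr0 mul1r.
have I i := @integrable_segment _ 0 pi (@continuous_trigpoly j i).
have mD : measurable (`[0, pi]%classic : set (measurableTypeR R)) by exact: measurable_itv.
have I2 : mu.-integrable `[0, pi] (EFin \o (fun x => (1 + 2 * cos x) ^+ j * cos (k%:~R * x) +
    (1 + 2 * cos x) ^+ j * cos ((k - 1)%:~R * x))).
  apply: (@integrable_segment (fun x => (1 + 2 * cos x) ^+ j * cos (k%:~R * x) +
    (1 + 2 * cos x) ^+ j * cos ((k - 1)%:~R * x))) => x.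
  by apply: cvgD; exact: continuous_trigpoly.
rewrite /= !natrD !mulrDr -!IH -(RintegralD mD (I _) (I _)) -(RintegralD mD I2 (I _)).
congr fine; apply: eq_integral => x _; congr EFin.
rewrite -!mulrDr exprSr -mulrA; congr (_ * _).
rewrite rmorphB rmorphD !mulrDl !mul1r mulNr mul1r cosB cosD.
by ring.
Qed.

Lemma continuous_sum_nat (f : nat -> R -> R) n : (forall i, continuous (f i)) ->
  continuous (fun x => \sum_(0 <= i < n) f i x).
Proof.
move=> cf; elim: n => [|n IH].
  have -> : (fun x => \sum_(0 <= i < 0) f i x) = cst 0 by apply/funext => y; rewrite big_nil.
  by move=> x; exact: cvg_cst.
have -> : (fun x => \sum_(0 <= i < n.+1) f i x) = (fun x => \sum_(0 <= i < n) f i x + f n x).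
  by apply/funext => y; rewrite big_nat_recr.
by move=> x; apply: cvgD; [exact: IH|exact: cf].
Qed.

Lemma Rintegral_sum_segment (a b : R) (f : nat -> R -> R) n : (forall i, continuous (f i)) ->
  \int[mu]_(x in `[a, b]) (\sum_(0 <= i < n) f i x) = \sum_(0 <= i < n) \int[mu]_(x in `[a, b]) f i x.
Proof.
move=> cf; have cs m := @continuous_sum_nat f m cf.
elim: n => [|n IH]; first by under eq_Rintegral do rewrite big_nil; rewrite Rintegral_cst// mul0r big_nil.
rewrite big_nat_recr//= -IH -RintegralD//; try exact: integrable_segment.
by congr fine; apply: eq_integral => x _; rewrite big_nat_recr.
Qed.

Lemma trinom_egf_fourier t k : 0 <= t ->
  trinom_egf t k * pi = \int[mu]_(x in `[0, pi]) (expR (t * (1 + 2 * cos x)) * cos (k%:~R * x)).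
Proof.
move=> t0; have h := is_cvg_trinom_egf (k := k) t0.
pose fn n x := (\sum_(0 <= i < n) t ^+ i / i`!%:R * ((1 + 2 * cos x) ^+ i * cos (k%:~R * x)) : R).
pose f x := expR (t * (1 + 2 * cos x)) * cos (k%:~R * x).
have ci i : continuous (fun x => t ^+ i / i`!%:R * ((1 + 2 * cos x) ^+ i * cos (k%:~R * x)) : R).
  by move=> x; apply: cvgM; [exact: cvg_cst|exact: continuous_trigpoly].
have cf : continuous f.
  move=> x; apply: cvgM; last exact: continuous_cosZ.
  apply: (@continuous_comp _ _ _ (fun x => t * (1 + 2 * cos x)) expR); last exact: continuous_expR.
  apply: cvgM; first exact: cvg_cst.
  apply: cvgD; first exact: cvg_cst.
  by apply: cvgM; [exact: cvg_cst|exact: continuous_cos].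
have fnE n x : fn n x = series (exp_coeff (t * (1 + 2 * cos x))) n * cos (k%:~R * x).
  rewrite /fn /series/= mulr_suml; apply: eq_bigr => i _.
  by rewrite /exp_coeff/= exprMn mulrA; congr (_ * _); rewrite mulrAC.
have cosb x : `|1 + 2 * cos x| <= 3.
  have := cos_max x; rewrite !ler_norml => /andP[h1 h2]; apply/andP; split; lra.
have mD : measurable (`[0, pi]%classic : set (measurableTypeR R)) by exact: measurable_itv.
have := @Rintegral_dominated_cvg R `[0, pi]%classic fn f (cst (expR (3 * t))) mD.
case.
- move=> n; apply: measurable_funTS; apply: continuous_measurable_fun.
  by rewrite /fn; exact: (@continuous_sum_nat (fun i x => t ^+ i / i`!%:R * ((1 + 2 * cos x) ^+ i * cos (k%:~R * x)))).
- by apply: measurable_funTS; exact: continuous_measurable_fun.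
- move=> x _; under eq_fun do rewrite fnE; apply: cvgM; last exact: cvg_cst.
  exact: is_cvg_series_exp_coeff.
- exact: (@integrable_segment (cst (expR (3 * t))) 0 pi (fun x => cvg_cst _)).
- move=> n x _; rewrite fnE normrM.
  apply: (@le_trans _ _ (`|series (exp_coeff (t * (1 + 2 * cos x))) n| * 1)).
    by rewrite ler_wpM2l// cos_max.
  rewrite mulr1 /series/=; apply: (le_trans (ler_norm_sum _ _ _)).
  apply: (@le_trans _ _ (series (exp_coeff (3 * t)) n)).
    rewrite /series/=; apply: ler_sum => i _; rewrite /exp_coeff/= normrM normrX normrM.
    rewrite [X in _ * X]ger0_norm// ler_wpM2r// lerXn2r ?nnegrE ?mulr_ge0//.
    by rewrite [leRHS]mulrC (ger0_norm t0) ler_wpM2l.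
  apply: nondecreasing_cvgn_le; last exact: is_cvg_series_exp_coeff.
  by apply: nondecreasing_series => i _ _; rewrite /exp_coeff/= divr_ge0// exprn_ge0// mulr_ge0.
move=> _ h2.
have : series (fun j => (trinom j k)%:R * (t ^+ j / j`!%:R)) n * pi @[n --> \oo] --> trinom_egf t k * pi.
  by apply: cvgM; [exact: h|exact: cvg_cst].
suff -> : (fun n => series (fun j => (trinom j k)%:R * (t ^+ j / j`!%:R)) n * pi) =
   (fun n => \int[mu]_(x in `[0, pi]) fn n x) by move/cvg_unique; apply.
apply/funext => n; rewrite Rintegral_sum_segment//.
rewrite /series/= mulr_suml; apply: eq_bigr => i _.
rewrite RintegralZl//; last exact: integrable_segment (@continuous_trigpoly i k).
by rewrite Rintegral_trigpoly; ring.
Qed.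

Lemma heat1_fourier t k : 0 <= t ->
  heat1 t k * pi = \int[mu]_(x in `[0, pi]) (expR (- (2 * t * (1 - cos x))) * cos (k%:~R * x)).
Proof.
move=> t0; rewrite /heat1 -mulrA trinom_egf_fourier// -RintegralZl//.
  congr fine; apply: eq_integral => x _; congr EFin.
  by rewrite mulrA -expRD; congr (expR _ * _); ring.
apply: (@integrable_segment (fun x => expR (t * (1 + 2 * cos x)) * cos (k%:~R * x))).
move=> x; apply: cvgM; last exact: continuous_cosZ.
apply: (@continuous_comp _ _ _ (fun x => t * (1 + 2 * cos x)) expR); last exact: continuous_expR.
apply: cvgM; first exact: cvg_cst.
apply: cvgD; first exact: cvg_cst.
by apply: cvgM; [exact: cvg_cst|exact: continuous_cos].
Qed.

End Fourier.

(** * The cosine transform of the Gaussian *)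

Section LocalLimit.
Context {R : realType}.
Local Notation mu := (@lebesgue_measure R).
Implicit Types (t s x u b : R) (k : int).
Hint Resolve measurable_Rpos : core.

Definition gauss u : R := expR (- u ^+ 2).

Lemma continuous_gaussE : continuous gauss.
Proof.
move=> x; apply: (@continuous_comp _ _ _ (fun u => - u ^+ 2) expR); last exact: continuous_expR.
by apply: cvgN; exact: exprn_continuous.
Qed.

Lemma Rpos_measurable_continuous (f : R -> R) : continuous f -> measurable_fun Rpos f.
Proof. by move=> cf; apply: measurable_funTS; exact: continuous_measurable_fun. Qed.

(** The factor 1 + u covers at once the Gaussian and its product with u, which arises when the
    cosine transform is differentiated in its parameter. *)
Lemma integrable_gauss_scaled (c : R) : 0 < c ->
  mu.-integrable Rpos (EFin \o (fun u => (1 + u) * expR (- (c * u ^+ 2)))).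
Proof.
move=> c0.
have cf : continuous (fun u => (1 + u) * expR (- (c * u ^+ 2))).
  move=> x; apply: cvgM; first by apply: cvgD; [exact: cvg_cst|exact: cvg_id].
  apply: (@continuous_comp _ _ _ (fun u => - (c * u ^+ 2)) expR); last exact: continuous_expR.
  by apply: cvgN; apply: cvgM; [exact: cvg_cst|exact: exprn_continuous].
(* The 2 bounds 1 + x for x <= 1. For x >= 1, e^(c x^2) >= (c x^2/2)^2 and 1 + x <= 2 x^2 give 8/c^2
   times x^(-2). *)
pose C := 2 + 8 / c ^+ 2 : R.
have c2 : 0 < c ^+ 2 by rewrite exprn_gt0.
have C0 : 0 < 8 / c ^+ 2 by rewrite divr_gt0.
have [] // := @integrable_Rpos_bound R 1 C (fun u => (1 + u) * expR (- (c * u ^+ 2))) ltr01.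
- exact: Rpos_measurable_continuous.
- move=> x x0 x1; rewrite subrr powRr0 mulr1 ger0_norm; last first.
    by rewrite mulr_ge0 ?expR_ge0// addr_ge0// ltW.
  apply: (@le_trans _ _ (1 + x)); last by rewrite /C; lra.
  rewrite ler_piMr ?addr_ge0 ?(ltW x0)//.
  by rewrite expR_le1 oppr_le0 mulr_ge0 ?sqr_ge0// ltW.
move=> x x1; have x0 : 0 < x by exact: lt_le_trans x1.
rewrite ger0_norm; last by rewrite mulr_ge0 ?expR_ge0// addr_ge0// ltW.
have -> : x `^ (- 1 - 1) = (x ^+ 2)^-1.
  by rewrite (_ : - 1 - 1 = - 2%:R); [rewrite powRN powR_mulrn// ltW|ring].
rewrite -ler_pdivlMl ?ltr_pwDl ?(ltW x0)//.
have e : expR (c * x ^+ 2) = expR (c * x ^+ 2 / 2) ^+ 2.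
  by rewrite [RHS]expr2 -expRD; congr expR; field.
have h1 : c * x ^+ 2 / 2 <= expR (c * x ^+ 2 / 2).
  by apply: le_trans (expR_ge1Dx _); rewrite lerDr.
have y0 : 0 <= c * x ^+ 2 / 2 by rewrite divr_ge0// mulr_ge0 ?sqr_ge0// ltW.
have h2 : (c * x ^+ 2 / 2) ^+ 2 <= expR (c * x ^+ 2).
  by rewrite e lerXn2r ?nnegrE ?expR_ge0.
have x3 : x ^+ 2 * (1 + x) <= 2 * x ^+ 4.
  have -> : x ^+ 4 = x ^+ 2 * x ^+ 2 by ring.
  have : 1 + x <= 2 * x ^+ 2 by rewrite expr2; nra.
  have : 0 < x ^+ 2 by rewrite exprn_gt0.
  by move: (x ^+ 2) => a; nra.
rewrite expRN -div1r ler_pdivrMr ?expR_gt0//.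
apply: (@le_trans _ _ ((1 + x)^-1 * (C / x ^+ 2) * (c * x ^+ 2 / 2) ^+ 2)); last first.
  rewrite ler_wpM2l// mulr_ge0// ?invr_ge0 ?divr_ge0 ?sqr_ge0// ?addr_ge0 ?(ltW x0)//.
  by rewrite /C; lra.
rewrite -mulrA ler_pdivlMl ?ltr_pwDl ?(ltW x0)// mulr1.
have -> : C / x ^+ 2 * (c * x ^+ 2 / 2) ^+ 2 = (C * c ^+ 2) * x ^+ 2 / 4.
  by field; rewrite lt0r_neq0.
have -> : C * c ^+ 2 = 2 * c ^+ 2 + 8 by rewrite /C; field; rewrite lt0r_neq0.
have : 0 <= c ^+ 2 * x ^+ 2 by rewrite mulr_ge0 ?sqr_ge0.
have : x <= x ^+ 2 by rewrite expr2; nra.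
by move: (x ^+ 2) (c ^+ 2) => a q; nra.
Qed.

Lemma integrable_Rpos_le (f g : R -> R) : measurable_fun Rpos f ->
  mu.-integrable Rpos (EFin \o g) -> (forall x, 0 < x -> `|f x| <= g x) ->
  mu.-integrable Rpos (EFin \o f).
Proof.
move=> mf ig fg; apply: (@le_integrable _ _ _ mu Rpos measurable_Rpos _ (EFin \o g)) => //.
- exact/measurable_EFinP.
- move=> x; rewrite RposP => x0 /=; rewrite lee_fin.
  by apply: le_trans (fg x x0) _; exact: ler_norm.
Qed.

Lemma integrable_RposZ (c : R) (f : R -> R) : mu.-integrable Rpos (EFin \o f) ->
  mu.-integrable Rpos (EFin \o (fun x => c * f x)).
Proof.
move=> h; have -> : EFin \o (fun x => c * f x) = (fun x => c%:E * (EFin \o f) x)%E.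
  by apply/funext => x /=; rewrite EFinM.
by apply: (@integrableZl _ _ _ mu Rpos measurable_Rpos).
Qed.

Lemma integrable_RposD (f g : R -> R) : mu.-integrable Rpos (EFin \o f) ->
  mu.-integrable Rpos (EFin \o g) -> mu.-integrable Rpos (EFin \o (fun x => f x + g x)).
Proof. by move=> h1 h2; exact: (@integrableD _ _ _ mu Rpos measurable_Rpos _ _ h1 h2). Qed.

Definition gauss_cos b : R := \int[mu]_(u in Rpos) (gauss u * cos (b * u)).

Lemma continuous_gauss_cos b : continuous (fun u => gauss u * cos (b * u)).
Proof. by move=> u; apply: cvgM; [exact: continuous_gaussE|exact: continuous_cosZ]. Qed.

Lemma gauss_le u : 0 < u -> gauss u <= (1 + u) * expR (- (1 * u ^+ 2)).
Proof. by move=> u0; rewrite mul1r ler_peMl ?expR_ge0// lerDl ltW. Qed.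

Lemma integrable_gauss_cos b : mu.-integrable Rpos (EFin \o (fun u => gauss u * cos (b * u))).
Proof.
apply: integrable_Rpos_le (integrable_gauss_scaled ltr01) _.
  by apply: Rpos_measurable_continuous; exact: continuous_gauss_cos.
move=> x x0; apply: le_trans (gauss_le x0); rewrite normrM ger0_norm ?expR_ge0//.
by rewrite ler_piMr ?expR_ge0// cos_max.
Qed.

Lemma gauss_cos0 : gauss_cos 0 = Num.sqrt pi / 2.
Proof.
rewrite /gauss_cos; transitivity (fine (Num.sqrt pi / 2 : R)%:E) => //.
rewrite -integral0y_gauss /Rintegral; congr fine.
rewrite -integral_itv_obnd_cbnd.
  by apply: eq_integral => x _; rewrite mul0r cos0 mulr1.
apply/measurable_EFinP; apply: Rpos_measurable_continuous; exact: continuous_gaussE.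
Qed.

Lemma is_derive_gauss u : is_derive u 1 gauss (- (2 * u * gauss u)).
Proof.
have d1 : is_derive u 1 (fun u : R => - u ^+ 2) (- (2 * u)).
  apply: is_deriveN; have := @is_deriveX R R id 2 u 1 1 (is_derive_id u 1).
  by move=> h; apply: is_derive_eq h _; rewrite /GRing.scale/= mulr1 expr1 -mulr_natr mulrC.
have := @is_derive1_comp R expR (fun u => - u ^+ 2) u _ _ (is_derive_expR _) d1.
by move=> h; apply: is_derive_eq h _; rewrite /gauss mulrC mulNr.
Qed.

(* Integration by parts, with antiderivative (1/2) gauss u * sin (b u). *)
Lemma gauss_sin_moment b : 
  \int[mu]_(u in Rpos) (- (gauss u * (u * sin (b * u)))) = - (b / 2) * gauss_cos b.
Proof.
pose F u := 2^-1 * (gauss u * sin (b * u)).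
pose f u := b / 2 * (gauss u * cos (b * u)) + - (gauss u * (u * sin (b * u))).
have cs : continuous (fun u => sin (b * u)) := continuous_is_derive (is_derive_sinZ b).
have cg2 : continuous (fun u => - (gauss u * (u * sin (b * u)))).
  move=> u; apply: cvgN; apply: cvgM; first exact: continuous_gaussE.
  by apply: cvgM; [exact: cvg_id|exact: cs].
have I2 : mu.-integrable Rpos (EFin \o (fun u => - (gauss u * (u * sin (b * u))))).
  apply: integrable_Rpos_le (integrable_gauss_scaled ltr01) _.
    exact: Rpos_measurable_continuous.
  move=> x x0; rewrite normrN !normrM ger0_norm ?expR_ge0// (gtr0_norm x0).
  rewrite mulrC mul1r ler_wpM2r ?expR_ge0//.
  apply: (@le_trans _ _ (x * 1)); last by rewrite mulr1 lerDr.
  by rewrite ler_wpM2l ?(ltW x0)// sin_max.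
have I1 : mu.-integrable Rpos (EFin \o (fun u => b / 2 * (gauss u * cos (b * u)))).
  exact/integrable_RposZ/integrable_gauss_cos.
have dF u : is_derive u 1 F (f u).
  have h := is_deriveZ 2^-1 (is_deriveM (is_derive_gauss u) (is_derive_sinZ b u)).
  apply: is_derive_eq h _; rewrite /GRing.scale/= /f.
  by field.
have cf : continuous f.
  move=> u; apply: cvgD; last exact: cg2.
  by apply: cvgM; [exact: cvg_cst|exact: continuous_gauss_cos].
have I0 : \int[mu]_(u in Rpos) f u = 0 - 0.
  apply: (@Rintegral_half_line_FTC R F f 0 0) => //.
  - by move=> x _; exact: cf.
  - exact: integrable_RposD.
  - have cF := continuous_is_derive dF.
    have h : n.+1%:R^-1 @[n --> \oo] --> (0 : R) by exact: cvg_harmonic.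
    have : F n.+1%:R^-1 @[n --> \oo] --> F 0 by apply: continuous_cvg h; exact: cF.
    by rewrite /F mulr0 sin0 !mulr0.
  - apply/norm_cvg0P; have c0 : (fun=> 0) n @[n --> \oo] --> (0 : R) by exact: cvg_cst.
    apply: (squeeze_cvgr _ c0 (@cvg_harmonic R)).
    apply: nearW => n; rewrite normr_ge0/= /F !normrM ger0_norm// ger0_norm ?expR_ge0//.
    rewrite /harmonic/=.
    apply: (@le_trans _ _ (1 * (gauss n.+1%:R * 1))).
      apply: ler_pM; rewrite ?mulr_ge0 ?expR_ge0 ?invf_le1 ?ler1n//.
      by rewrite ler_wpM2l ?expR_ge0// sin_max.
    rewrite mul1r mulr1 /gauss expRN lef_pV2 ?posrE ?expR_gt0//.
    apply: le_trans (expR_ge1Dx _); have : (1 : R) <= n.+1%:R by rewrite ler1n.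
    by move: (n.+1%:R : R) => a; nra.
rewrite subrr in I0.
have e1 := @RintegralD _ _ _ mu Rpos _ _ measurable_Rpos I1 I2.
have e2 := @RintegralZl _ _ _ mu Rpos _ (b / 2) measurable_Rpos (integrable_gauss_cos b).
move: I0; rewrite /f e1 e2 -/(gauss_cos b) => /eqP; rewrite addr_eq0 => /eqP h.
by rewrite mulNr h opprK.
Qed.

Lemma is_derive_gauss_cos b : is_derive b 1 gauss_cos (- (b / 2) * gauss_cos b).
Proof.
pose f b u := gauss u * cos (b * u).
have df x u : is_derive x 1 (f^~ u) (- (gauss u * (u * sin (x * u)))).
  have h : is_derive x 1 (fun x => cos (x * u)) (- (u * sin (x * u))).
    by have := is_derive_cosZ u x; rewrite (mulrC u x); under eq_fun do rewrite mulrC.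
  have h2 : is_derive x 1 (f^~ u) _ := is_deriveZ (gauss u) h.
  by apply: is_derive_eq h2 _; rewrite /GRing.scale/= mulrN.
have E x u : partial1of2 f x u = - (gauss u * (u * sin (x * u))).
  by rewrite partial1of2E; have [_ ->] := df x u.
(* The absolute value makes the majorant nonnegative on the whole line, as differentiation under the
   integral requires. *)
pose G u : R := `|1 + u| * expR (- (1 * u ^+ 2)).
have G0 u : 0 <= G u by rewrite mulr_ge0 ?expR_ge0.
have IG : mu.-integrable Rpos (EFin \o G).
  apply: integrable_Rpos_le (integrable_gauss_scaled ltr01) _.
    apply: Rpos_measurable_continuous => x; apply: cvgM.
      by apply: cvg_norm; apply: cvgD; [exact: cvg_cst|exact: cvg_id].
    apply: (@continuous_comp _ _ _ (fun u => - (1 * u ^+ 2)) expR); last exact: continuous_expR.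
    by apply: cvgN; apply: cvgM; [exact: cvg_cst|exact: exprn_continuous].
  move=> x x0; rewrite ger0_norm// /G ger0_norm//.
  by rewrite addr_ge0// ltW.
have bd x u : `]b - 1, b + 1[%classic x -> Rpos u -> `|partial1of2 f x u| <= G u.
  move=> _; rewrite RposP => u0; rewrite E normrN !normrM ger0_norm ?expR_ge0// (gtr0_norm u0) mulrC /G mul1r.
  rewrite ler_wpM2r ?expR_ge0// [leRHS]ger0_norm ?addr_ge0 ?(ltW u0)//.
  apply: (@le_trans _ _ (u * 1)); last by rewrite mulr1 lerDr.
  by rewrite ler_wpM2l ?(ltW u0)// sin_max.
have bI : `]b - 1, b + 1[%classic b by rewrite /= in_itv/=; apply/andP; split; lra.
have iI x : `]b - 1, b + 1[%classic x -> mu.-integrable Rpos (EFin \o f x).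
  by move=> _; exact: integrable_gauss_cos.
have dI x u : `]b - 1, b + 1[%classic x -> Rpos u -> derivable (f^~ u) x 1.
  by move=> _ _; have [] := df x u.
have d1 := @derivable_under_integral R _ _ mu f Rpos measurable_Rpos b (b - 1) (b + 1) bI iI dI G G0 IG bd.
have d2 := @differentiation_under_integral R _ _ mu f Rpos measurable_Rpos b (b - 1) (b + 1) bI iI dI G G0 IG bd.
split; first exact: d1.
rewrite -derive1E -gauss_sin_moment [LHS]d2.
by congr fine; apply: eq_integral => u _; rewrite E.
Qed.

(** The transform solves y' = -(b/2) y, so its product with e^(b^2/4) is constant; the constant is
    the Gaussian integral. *)
Lemma gauss_cosE b : gauss_cos b = Num.sqrt pi / 2 * expR (- (b ^+ 2 / 4)).
Proof.
pose H x := expR (x ^+ 2 / 4) * gauss_cos x.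
have dH x : is_derive x 1 H 0.
  have d1 : is_derive x 1 (fun x : R => x ^+ 2 / 4) (x / 2).
    have h1 := @is_deriveX R R id 2 x 1 1 (is_derive_id x 1).
    have -> : (fun x : R => x ^+ 2 / 4) = (fun x : R => 4^-1 *: (x ^+ 2 : R^o)).
      by apply/funext => y; rewrite mulrC.
    have h2 : is_derive x 1 (fun x : R => 4^-1 *: (x ^+ 2 : R^o)) _ := is_deriveZ 4^-1 h1.
    apply: is_derive_eq h2 _.
    by rewrite /GRing.scale/= mulr1 expr1 -mulr_natr; field.
  have d2 := @is_derive1_comp R expR (fun x => x ^+ 2 / 4) x _ _ (is_derive_expR _) d1.
  have d3 := is_deriveM d2 (is_derive_gauss_cos x).
  by apply: is_derive_eq d3 _; rewrite /GRing.scale/=; ring.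
have := @is_derive_0_is_cst R H b 0 dH.
rewrite /H gauss_cos0 expr0n mul0r expR0 mul1r expRN => <-.
by rewrite mulrAC mulfV ?mul1r// lt0r_neq0// expR_gt0.
Qed.

End LocalLimit.

(** * The rescaled heat kernel and its Gaussian limit *)

Section Scaling.
Context {R : realType}.
Local Notation mu := (@lebesgue_measure R).
Implicit Types (t s x u b : R) (k : int).
Hint Resolve measurable_Rpos : core.

Definition heat_symbol s u : R := expR (- (2 * s ^+ 2 * (1 - cos (s^-1 * u)))).

(* After u = s x, s = sqrt t, the Fourier integral of the heat kernel over [0, pi]
   becomes one over (0, oo) whose integrand is this function times a cosine. *)
Definition cut_symbol s : R -> R := heat_symbol s \_ `[0, pi * s].

Lemma continuous_heat_symbol s : continuous (heat_symbol s).
Proof.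
move=> x; apply: (@continuous_comp _ _ _ (fun u => - (2 * s ^+ 2 * (1 - cos (s^-1 * u)))) expR).
  apply: cvgN; apply: cvgM; first exact: cvg_cst.
  by apply: cvgB; [exact: cvg_cst|exact: continuous_cosZ].
exact: continuous_expR.
Qed.

Lemma measurable_cut_symbol s : measurable_fun Rpos (cut_symbol s).
Proof.
have mD : measurable (`[0, pi * s]%classic : set (measurableTypeR R)) by exact: measurable_itv.
apply/(measurable_restrict _ mD measurable_Rpos).
by apply: measurable_funTS; apply: continuous_measurable_fun; exact: continuous_heat_symbol.
Qed.

Lemma cut_symbol_ge0 s u : 0 <= cut_symbol s u.
Proof. by rewrite /cut_symbol patchE; case: ifP => // _; exact: expR_ge0. Qed.

(** The cut at pi s keeps u/s inside [0, pi], where 1 - cos dominates a multiple of the square;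
    hence a Gaussian bound uniform in s. The constant 1/16 is 2/32, from [one_sub_cos_ge]. *)
Lemma cut_symbol_le s u : 0 < s -> 0 < u ->
  cut_symbol s u <= (1 + u) * expR (- (16^-1 * u ^+ 2)).
Proof.
move=> s0 u0; rewrite /cut_symbol patchE; case: ifPn => [|_]; last first.
  by rewrite mulr_ge0 ?expR_ge0// addr_ge0// ltW.
rewrite inE/= in_itv/= => /andP[_ us].
apply: (@le_trans _ _ (expR (- (16^-1 * u ^+ 2)))); last first.
  by rewrite ler_peMl ?expR_ge0// lerDl ltW.
rewrite ler_expR lerN2.
have x0 : 0 <= s^-1 * u by rewrite mulr_ge0 ?invr_ge0 ?(ltW s0) ?(ltW u0).
have xp : s^-1 * u <= pi by rewrite mulrC ler_pdivrMr.
have := one_sub_cos_ge x0 xp.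
have -> : u ^+ 2 = s ^+ 2 * (s^-1 * u) ^+ 2 by field; rewrite lt0r_neq0.
have := sqr_ge0 s; move: (s ^+ 2) ((s^-1 * u) ^+ 2) (1 - cos _) => a b c; nra.
Qed.

Let mass : R := \int[mu]_(u in Rpos) ((1 + u) * expR (- (16^-1 * u ^+ 2))).

Lemma inv16_gt0 : (0 : R) < 16^-1. Proof. by []. Qed.

Lemma integrable_cut_symbol_cos s b : 0 < s ->
  mu.-integrable Rpos (EFin \o (fun u => cut_symbol s u * cos (b * u))).
Proof.
move=> s0; apply: integrable_Rpos_le (integrable_gauss_scaled inv16_gt0) _.
  apply: measurable_funM; first exact: measurable_cut_symbol.
  by apply: Rpos_measurable_continuous; exact: continuous_cosZ.
move=> u u0; apply: le_trans (cut_symbol_le s0 u0); rewrite normrM ger0_norm ?cut_symbol_ge0//.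
by rewrite ler_piMr ?cut_symbol_ge0// cos_max.
Qed.

Lemma heat1_scaled s k : 0 < s ->
  s * heat1 (s ^+ 2) k * pi = \int[mu]_(u in Rpos) (cut_symbol s u * cos (k%:~R / s * u)).
Proof.
move=> s0; rewrite -mulrA heat1_fourier ?sqr_ge0//.
pose g x := expR (- (2 * s ^+ 2 * (1 - cos x))) * cos (k%:~R * x).
have cg : continuous g.
  move=> x; apply: cvgM; last exact: continuous_cosZ.
  apply: (@continuous_comp _ _ _ (fun u => - (2 * s ^+ 2 * (1 - cos u))) expR); last exact: continuous_expR.
  apply: cvgN; apply: cvgM; first exact: cvg_cst.
  by apply: cvgB; [exact: cvg_cst|exact: continuous_cos].
pose F u := s^-1 * u.
have dF u : is_derive u 1 F s^-1.
  by apply: is_derive_eq (is_deriveZ s^-1 (is_derive_id u 1)) _; rewrite /GRing.scale/= mulr1.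
have F'E : (F^`())%classic = cst s^-1.
  by apply/funext => u; rewrite derive1E; have [_ ->] := dF u.
have cF := continuous_is_derive dF.
have ps0 : 0 <= pi * s by rewrite mulr_ge0 ?pi_ge0 ?(ltW s0).
have F0 : F 0 = 0 by rewrite /F mulr0.
have Fps : F (pi * s) = pi by rewrite /F mulrC mulfK// lt0r_neq0.
have e1 : \int[mu]_(x in `[0, pi]) g x = \int[mu]_(u in `[0, pi * s]) (s^-1 * g (F u)).
  rewrite -{1}Fps -{1}F0 /Rintegral; congr fine.
  rewrite (integration_by_substitution_increasing ps0).
  - by rewrite F'E; apply: eq_integral => u _; rewrite /= mulrC.
  - by move=> x y _ _ xy; rewrite /F ltr_pM2l ?invr_gt0.
  - by rewrite F'E => x _; exact: cvg_cst.
  - by rewrite F'E; exact: is_cvg_cst.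
  - by rewrite F'E; exact: is_cvg_cst.
  - split.
    + by move=> u _; have [] := dF u.
    + by apply: cvg_at_right_filter; exact: cF.
    + by apply: cvg_at_left_filter; exact: cF.
  - exact: continuous_subspaceT.
have cgF : continuous (fun u => g (F u)).
  by move=> u; apply: continuous_comp; [exact: cF|exact: cg].
have mD : measurable (`[0, pi * s]%classic : set (measurableTypeR R)) by exact: measurable_itv.
rewrite e1 (RintegralZl _ mD (integrable_segment _ _ cgF)) mulrA mulfV ?lt0r_neq0// mul1r.
rewrite -Rintegral_itv_obnd_cbnd; last first.
  apply: (@integrableS _ _ _ mu `[0, pi * s]%classic) => //.
    exact: subset_itv_oc_cc.
  exact: integrable_segment.
have -> : `]0, (pi * s)]%classic = Rpos `&` `[0, (pi * s)]%classic.
  apply/seteqP; split => u; rewrite /Rpos/= !in_itv/= andbT.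
    by move=> /andP[u0 us]; rewrite u0 us (ltW u0).
  by move=> [-> /andP[_ ->]].
rewrite Rintegral_mkcondr; congr fine; apply: eq_integral => u _; congr EFin.
rewrite /cut_symbol !patchE; case: ifP => _; last by rewrite mul0r.
by rewrite /g /F /heat_symbol; congr (_ * cos _); rewrite mulrA.
Qed.

Lemma heat1_le_invsqrt : exists2 C : R, 0 < C & forall s k, 0 < s -> s * heat1 (s ^+ 2) k <= C.
Proof.
have m0 : 0 <= mass.
  by apply: Rintegral_ge0 => u; rewrite RposP => u0; rewrite mulr_ge0 ?expR_ge0// addr_ge0// ltW.
exists (mass / pi + 1) => [|s k s0].
  by rewrite ltr_pwDr// divr_ge0// pi_ge0.
apply: (@le_trans _ _ (mass / pi)); last by rewrite lerDl.
rewrite ler_pdivlMr ?pi_gt0// heat1_scaled//.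
have I1 := integrable_cut_symbol_cos (k%:~R / s) s0.
have I2 := integrable_gauss_scaled inv16_gt0.
apply: (@le_Rintegral _ _ _ mu Rpos _ _ measurable_Rpos I1 I2).
move=> u; rewrite RposP => u0; apply: le_trans (cut_symbol_le s0 u0).
by rewrite ler_piMr ?cut_symbol_ge0// cos_le1.
Qed.

Definition symbol_error s : R := \int[mu]_(u in Rpos) `|cut_symbol s u - gauss u|.

Lemma integrable_symbol_error s : 0 < s ->
  mu.-integrable Rpos (EFin \o (fun u => cut_symbol s u - gauss u)).
Proof.
move=> s0.
have h1 := integrable_cut_symbol_cos 0 s0.
have h2 := integrable_RposZ (-1) (@integrable_gauss_cos R 0).
have -> : (fun u => cut_symbol s u - gauss u) =
    (fun u => cut_symbol s u * cos (0 * u) + -1 * (gauss u * cos (0 * u))).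
  by apply/funext => u; rewrite !mul0r cos0 !mulr1 mulN1r.
exact: integrable_RposD h1 h2.
Qed.

Lemma cvg_symbol_error (s : nat -> R) : (forall n, 0 < s n) ->
  (s n)^-1 @[n --> \oo] --> (0 : R) -> symbol_error (s n) @[n --> \oo] --> (0 : R).
Proof.
move=> s0 scv.
have mg : measurable_fun Rpos (gauss : R -> R).
  by apply: Rpos_measurable_continuous; exact: continuous_gaussE.
have mn n : measurable_fun Rpos (fun u => `|cut_symbol (s n) u - gauss u|).
  apply: measurableT_comp => //; apply: measurable_funB => //; exact: measurable_cut_symbol.
have I1 := integrable_gauss_scaled inv16_gt0.
have I2 := integrable_gauss_scaled (ltr01 : (0 : R) < 1).
have := @Rintegral_dominated_cvg R Rpos (fun n u => `|cut_symbol (s n) u - gauss u|) (cst 0) _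
  measurable_Rpos mn _ _ (integrable_RposD I1 I2).
rewrite (_ : \int[mu]_(x in Rpos) cst 0 x = 0); last first.
  by rewrite /Rintegral integral0.
case.
- exact: measurable_cst.
- move=> u; rewrite RposP => u0 /=.
  apply/norm_cvg0P; rewrite -(subrr (gauss u)); apply: cvgB; last exact: cvg_cst.
  have c1 : heat_symbol (s n) u @[n --> \oo] --> gauss u.
    apply: continuous_cvg; first exact: continuous_expR.
    apply: cvgN; under eq_fun do rewrite (mulrC _^-1).
    exact: cvg_one_sub_cos_scaled (ltW u0) s0 scv.
  apply: cvg_trans c1; apply: near_eq_cvg; near=> n.
  rewrite /cut_symbol patchE mem_set//= in_itv/= (ltW u0)/=.
  rewrite -ler_pdivrMr// -ler_pdivlMl//.
  apply: ltW; near: n; apply: (cvgr_lt _ scv).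
  by rewrite mulr_gt0 ?invr_gt0 ?pi_gt0.
- move=> n u; rewrite RposP => u0; rewrite normr_id.
  apply: (le_trans (ler_normB _ _)); apply: lerD.
    by rewrite ger0_norm ?cut_symbol_ge0// cut_symbol_le.
  by rewrite ger0_norm ?expR_ge0// gauss_le.
by [].
Unshelve. all: by end_near.
Qed.

(** Both terms are cosine integrals with the same frequency, and |cos| <= 1 leaves the L^1 distance
    of the symbols. The error does not depend on k, which matters because the lattice point moves
    along with s. *)
Lemma heat1_local_limit s k : 0 < s ->
  `|s * heat1 (s ^+ 2) k - expR (- ((k%:~R / s) ^+ 2 / 4)) / (2 * Num.sqrt pi)| <= symbol_error s / pi.
Proof.
move=> s0; rewrite ler_pdivlMr ?pi_gt0//.
rewrite -[X in _ * X <= _](ger0_norm (pi_ge0 R)) -normrM mulrBl heat1_scaled//.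
have -> : expR (- ((k%:~R / s) ^+ 2 / 4)) / (2 * Num.sqrt pi) * pi = gauss_cos (k%:~R / s).
  rewrite gauss_cosE -[X in _ * X = _](sqr_sqrtr (pi_ge0 R)).
  by field; rewrite lt0r_neq0// sqrtr_gt0 pi_gt0.
have I1 := integrable_cut_symbol_cos (k%:~R / s) s0.
have I2 := integrable_gauss_cos (k%:~R / s).
rewrite /gauss_cos -(@RintegralB _ _ _ mu Rpos _ _ measurable_Rpos I1 I2).
have I0 := integrable_symbol_error s0.
have I3 : mu.-integrable Rpos (EFin \o (fun u => cut_symbol s u * cos (k%:~R / s * u) -
    gauss u * cos (k%:~R / s * u))).
  by have := @integrableB _ _ _ mu Rpos measurable_Rpos _ _ I1 I2.
apply: (le_trans (@le_normr_Rintegral _ _ _ mu Rpos _ measurable_Rpos I3)).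
apply: (@le_Rintegral _ _ _ mu Rpos _ _ measurable_Rpos (integrable_norm I3) (integrable_norm I0)).
by move=> u _; rewrite /= -mulrBl normrM ler_piMr// cos_max.
Qed.

End Scaling.

(** * The kernel of the fractional Laplacian *)

Section EgfContinuity.
Context {R : realType}.
Variables (w : nat -> R) (L : R).
Hypothesis L0 : 0 < L.
Hypothesis wL : forall i, `|w i| <= L ^+ i.
Implicit Types (s t x : R).

(** Term by term, |w i| <= L^i bounds the increment by that of e^(L t), which then serves as a
    modulus of continuity. *)
Lemma egf_lipschitz s t : 0 <= s -> s <= t ->
  `|egf w t - egf w s| <= expR (L * t) - expR (L * s).
Proof.
move=> s0 st; have t0 : 0 <= t by exact: le_trans st.
pose u x i := w i * (x ^+ i / i`!%:R).
have c1 : `|series (u t) n - series (u s) n| @[n --> \oo] --> `|egf w t - egf w s|.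
  apply: cvg_norm; apply: cvgB; [exact: (is_cvg_egf L0 wL t0)|exact: (is_cvg_egf L0 wL s0)].
have c2 : series (exp_coeff (L * t)) n - series (exp_coeff (L * s)) n @[n --> \oo] -->
    expR (L * t) - expR (L * s).
  by apply: cvgB; exact: is_cvg_series_exp_coeff.
apply: (ler_cvg_to c1 c2); apply: nearW => n; rewrite /u.
rewrite /series/= -[X in `|X|]sumrB -[leRHS]sumrB.
apply: le_trans (ler_norm_sum _ _ _) _; apply: ler_sum => i _.
rewrite -mulrBr -mulrBl /exp_coeff/= -mulrBl !exprMn -mulrBr normrM -mulrA.
apply: ler_pM => //.
rewrite ger0_norm// mulr_ge0// subr_ge0 lerXn2r ?nnegrE//.
Qed.

Lemma continuous_egf x : 0 < x -> {for x, continuous (egf w)}.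
Proof.
move=> x0; apply/cvgrPdist_le => e e0.
have /cvgrPdist_le/(_ e e0) h := @continuous_expRM R L x.
near=> y.
have y0 : 0 < y by near: y; exact: lt_nbhsr.
have : `|expR (L * x) - expR (L * y)| <= e by near: y.
apply: le_trans; have [xy|/ltW yx] := leP x y.
  rewrite distrC [leRHS]distrC; apply: le_trans (egf_lipschitz (ltW x0) xy) _.
  exact: ler_norm.
by apply: le_trans (egf_lipschitz (ltW y0) yx) _; exact: ler_norm.
Unshelve. all: by end_near.
Qed.

End EgfContinuity.

Section Heat1Extra.
Context {R : realType}.
Implicit Types (t : R) (k : int).

Lemma trinom_diag (k : nat) : (0 < trinom k k)%N.
Proof.
elim: k => [//|k IH]; rewrite /= (_ : k.+1%:Z - 1 = k); last by lia.
by rewrite addn_gt0 addn_gt0 IH orbT.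
Qed.

Lemma heat1_abs t k : heat1 t k = heat1 t `|k|%N.
Proof. by case: k => // k; rewrite NegzE heat1N. Qed.

Lemma heat1_gt0 t k : 0 < t -> 0 < heat1 t k.
Proof.
move=> t0; rewrite heat1_abs mulr_gt0 ?expR_gt0//; move: `|k|%N => {}k.
pose u j : R := (trinom j k)%:R * (t ^+ j / j`!%:R).
have u0 j : 0 <= u j by rewrite mulr_ge0// divr_ge0// exprn_ge0// ltW.
have h : series u k.+1 <= limn (series u).
  apply: nondecreasing_cvgn_le; first by apply: nondecreasing_series => j _ _.
  exact: is_cvg_trinom_egf (ltW t0).
apply: lt_le_trans h; rewrite /series/= big_nat_recr//=.
rewrite ltr_wpDl ?sumr_ge0// /u mulr_gt0 ?ltr0n ?trinom_diag//.
by rewrite divr_gt0 ?exprn_gt0// ltr0n fact_gt0.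
Qed.

End Heat1Extra.

Section LatticeHeat.
Context {R : realType} {d : nat}.
Hypothesis d0 : (0 < d)%N.
Implicit Types (v : 'Z^d) (t s x : R).

Definition heatd t v : R :=
  expR (- (3 * d%:R * t)) * egf (fun j => (lattice_walks j v)%:R) t.

Lemma heatdE t v : 0 <= t -> heatd t v = \prod_(i < d) heat1 t (v 0 i).
Proof.
move=> t0; rewrite /heatd egf_lattice_walks// /heat1 big_split/=; congr (_ * _).
by rewrite prodr_const card_ord -expRM_natl; congr expR; ring.
Qed.

Lemma heatd_gt0 t v : 0 < t -> 0 < heatd t v.
Proof. by move=> t0; rewrite heatdE ?(ltW t0)// prodr_gt0// => i _; exact: heat1_gt0. Qed.

Lemma rate_gt0 : (0 : R) < 3 * d%:R.
Proof. by rewrite mulr_gt0// ltr0n. Qed.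

Lemma continuous_heatd v x : 0 < x -> {for x, continuous (heatd ^~ v)}.
Proof.
move=> x0; apply: cvgM; last exact: (continuous_egf rate_gt0 (lattice_walks_bound v)).
have := @continuous_expRM R (- (3 * d%:R)) x; rewrite /prop_for /continuous_at mulNr.
by under eq_fun do rewrite mulNr.
Qed.

Lemma scaled_heatd s v : s ^+ d * heatd (s ^+ 2) v = \prod_(i < d) (s * heat1 (s ^+ 2) (v 0 i)).
Proof. by rewrite heatdE ?sqr_ge0// [RHS]big_split/= prodr_const card_ord. Qed.

Lemma scaled_heatd_le : exists2 C : R, 0 < C & forall s v, 0 < s -> s ^+ d * heatd (s ^+ 2) v <= C.
Proof.
have [C C0 hC] := @heat1_le_invsqrt R.
exists (C ^+ d) => [|s v s0]; first by rewrite exprn_gt0.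
rewrite scaled_heatd -[X in C ^+ X]card_ord -prodr_const; apply: ler_prod => i _.
by rewrite hC// mulr_ge0 ?heat1_ge0 ?sqr_ge0 ?(ltW s0).
Qed.

Lemma euclid_ge0 v : 0 <= euclid R v.
Proof. exact: sqrtr_ge0. Qed.

Lemma sqr_euclid v : euclid R v ^+ 2 = \sum_(i < d) (v 0 i)%:~R ^+ 2.
Proof. by rewrite sqr_sqrtr// sumr_ge0// => i _; exact: sqr_ge0. Qed.

Lemma coord_le_euclid v i : (absz (v 0%R i))%:R <= euclid R v.
Proof.
rewrite -[leLHS](ger0_norm (ler0n _ _)) -sqrtr_sqr ler_sqrt; last first.
  by apply: sumr_ge0 => j _; exact: sqr_ge0.
rewrite natr_absz intr_norm real_normK ?num_real// (bigD1 i)//= lerDl.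
by apply: sumr_ge0 => j _; exact: sqr_ge0.
Qed.

Lemma euclid_le_max v (k : nat) : (forall i, absz (v 0%R i) <= k)%N -> euclid R v <= d%:R * k%:R.
Proof.
move=> vk; rewrite -(@ler_pXn2r _ 2) ?nnegrE ?euclid_ge0 ?mulr_ge0// sqr_euclid.
apply: (@le_trans _ _ (\sum_(i < d) k%:R ^+ 2)).
  apply: ler_sum => i _; rewrite -real_normK ?num_real// -intr_norm.
  by rewrite lerXn2r ?nnegrE// -natr_absz ler_nat.
rewrite sumr_const card_ord -[leLHS]mulr_natl exprMn ler_wpM2r ?sqr_ge0//.
by rewrite -natrX ler_nat -{1}(expn1 d) leq_pexp2l.
Qed.

Lemma euclid_gt0 v : v <> 0 -> 0 < euclid R v.
Proof.
move=> /eqP v0; rewrite lt0r euclid_ge0 andbT; apply: contra v0 => /eqP e.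
apply/eqP/rowP => i; rewrite mxE; have := coord_le_euclid v i.
by rewrite e lern0 absz_eq0 => /eqP.
Qed.

(** The largest coordinate k satisfies |v| <= d k, and its factor alone supplies k^(-d-2), by
    [heat1_decay] with m = d + 1, at the price max(t, s^(d+1)) <= t M^(d-1), where s = sqrt t and M
    = max(1, s). The other d - 1 factors are each O(1/M), which cancels M^(d-1). *)
Lemma heatd_decay : exists2 C : R, 0 < C & forall t v, 0 < t -> v <> 0 ->
  heatd t v * euclid R v ^+ d.+2 <= C * t.
Proof.
have [C C0 hC] := @heat1_decay R d.+1.
have [C' C'0 hC'] := @heat1_le_invsqrt R.
pose C1 := Num.max 1 C'.
have C10 : 0 < C1 by rewrite lt_max ltr01.
exists (C * C1 ^+ d.-1 * d%:R ^+ d.+2) => [|t v t0 v0].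
  by apply: mulr_gt0; [apply: mulr_gt0 => //|]; apply: exprn_gt0; rewrite // ltr0n.
pose i := [arg max_(j > Ordinal d0) absz (v 0%R j)].
pose k := absz (v 0%R i).
have vk j : (absz (v 0%R j) <= k)%N by rewrite /k /i; case: arg_maxnP => // l _ h; exact: h.
have ek := euclid_le_max vk.
have k0 : (0 < k)%N.
  rewrite lt0n; apply/negP => /eqP k0; have := euclid_gt0 v0.
  by rewrite ltNge; move: ek; rewrite k0 mulr0 => ->.
have kR : (0 : R) < k%:R by rewrite ltr0n.
pose s := Num.sqrt t; have s0 : 0 < s by rewrite sqrtr_gt0.
have s2 : s ^+ 2 = t by rewrite sqr_sqrtr// ltW.
pose M := Num.max 1 s.
have M1 : 1 <= M by rewrite le_max lexx.
have M0 : 0 < M by exact: lt_le_trans M1.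
have h1 j : heat1 t (v 0 j) <= C1 / M.
  rewrite ler_pdivlMr// /M; case: (leP 1 s) => _.
    by rewrite mulrC -s2 (le_trans (hC' _ _ s0))// le_max lexx orbT.
  by rewrite mulr1 (le_trans (heat1_le1 _ (ltW t0)))// le_max lexx.
have h2 : heat1 t (v 0 i) <= C * (t * M ^+ d.-1) / k%:R ^+ d.+2.
  rewrite heat1_abs; apply: le_trans (hC t _ t0 k0) _.
  rewrite ler_wpM2r ?invr_ge0 ?exprn_ge0// ler_wpM2l ?(ltW C0)//.
  rewrite ge_max; apply/andP; split.
    by rewrite ler_peMr ?(ltW t0)// exprn_ege1.
  rewrite -/s (_ : d.+1 = (2 + d.-1)%N); last by rewrite addSn add1n prednK.
  rewrite exprD s2 ler_wpM2l ?(ltW t0)// lerXn2r ?nnegrE ?(ltW s0) ?(ltW M0)//.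
  by rewrite le_max lexx orbT.
rewrite heatdE ?(ltW t0)// (bigD1 i)//=.
set P := \prod_(j < d | j != i) _.
have P0 : 0 <= P by apply: prodr_ge0 => j _; rewrite heat1_ge0// ltW.
have hP : P <= (C1 / M) ^+ d.-1.
  have -> : d.-1 = #|[pred j : 'I_d | j != i]| by rewrite cardC1 card_ord.
  rewrite -prodr_const; apply: ler_prod => j _.
  by rewrite h1 heat1_ge0// ltW.
have hE : euclid R v ^+ d.+2 <= (d%:R * k%:R) ^+ d.+2.
  by rewrite lerXn2r ?nnegrE ?euclid_ge0// mulr_ge0.
apply: (@le_trans _ _ (C * (t * M ^+ d.-1) / k%:R ^+ d.+2 * (C1 / M) ^+ d.-1 * (d%:R * k%:R) ^+ d.+2)).
  apply: ler_pM => //.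
  - by rewrite mulr_ge0// heat1_ge0// ltW.
  - by rewrite exprn_ge0// euclid_ge0.
  - by apply: ler_pM => //; rewrite heat1_ge0// ltW.
rewrite expr_div_n [(d%:R * k%:R) ^+ _]exprMn le_eqVlt; apply/orP; left; apply/eqP.
have : M ^+ d.-1 != 0 by rewrite expf_neq0// lt0r_neq0.
have : (k%:R : R) ^+ d.+2 != 0 by rewrite expf_neq0// lt0r_neq0.
move: (M ^+ _) (_ ^+ d.+2) (d%:R ^+ d.+2) (C1 ^+ _) => a b e f b0 a0.
by field; rewrite a0 b0.
Qed.

End LatticeHeat.

Lemma prod_dist_le (R : realType) (n : nat) (a b : 'I_n -> R) (M e : R) : 1 <= M -> 0 <= e ->
  (forall i, `|a i| <= M) -> (forall i, `|b i| <= M) -> (forall i, `|a i - b i| <= e) ->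
  `|\prod_(i < n) a i - \prod_(i < n) b i| <= n%:R * M ^+ n * e.
Proof.
move=> M1 e0; have M0 : 0 <= M by exact: le_trans M1.
elim: n a b => [|n IH] a b aM bM abe; first by rewrite !big_ord0 subrr normr0 !mul0r.
rewrite !big_ord_recl.
set A := \prod_(i < n) a _; set B := \prod_(i < n) b _.
have hA : `|A| <= M ^+ n.
  rewrite normr_prod -[X in M ^+ X]card_ord -prodr_const; apply: ler_prod => i _.
  by rewrite aM normr_ge0.
have hAB : `|A - B| <= n%:R * M ^+ n * e by apply: IH.
have -> : a ord0 * A - b ord0 * B = (a ord0 - b ord0) * A + b ord0 * (A - B) by ring.
apply: le_trans (ler_normD _ _) _; rewrite !normrM.
have h1 : `|a ord0 - b ord0| * `|A| <= e * M ^+ n by apply: ler_pM.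
have h2 : `|b ord0| * `|A - B| <= M * (n%:R * M ^+ n * e) by apply: ler_pM.
apply: le_trans (lerD h1 h2) _; rewrite exprS -natr1.
have : e * M ^+ n <= M * (e * M ^+ n) by rewrite ler_peMl// mulr_ge0// exprn_ge0.
by move: (M ^+ n) (n%:R : R) => x y; nra.
Qed.

(** * Signs, rescaling and the limit of the matrix elements *)

Section MatrixElement.
Context {R : realType} {d : nat}.
Variable alpha : R.
Hypothesis d0 : (0 < d)%N.
Hypothesis alpha0 : 0 < alpha.
Hypothesis alpha1 : alpha < 1.
Local Notation mu := (@lebesgue_measure R).
Local Notation L := (3 * d%:R : R).
Implicit Types (n m v : 'Z^d) (t s u : R).
Hint Resolve measurable_Rpos : core.

Let L0 : 0 < L. Proof. exact: rate_gt0. Qed.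

Let walks v (i : nat) : R := (lattice_walks i v)%:R.

Let mx_value v : R := L `^ alpha * walks v 0%N -
  (\int[mu]_(t in Rpos) (levy_weight alpha L t * (egf (walks v) t - walks v 0%N))) / levy_const alpha.

Let cvg_mx_value v :
  series (fun i => frac_coef alpha L i * walks v i) k @[k --> \oo] --> mx_value v.
Proof. exact: (cvg_frac_series alpha0 alpha1 L0 (lattice_walks_bound v)). Qed.

Let mx_valueE n m : frac_laplacian_mx alpha n m = (mx_value (n - m))%:C.
Proof.
apply: (frac_laplacian_mxE d0 (is_cvg_frac_coef alpha0 alpha1 L0)).
  by move=> x xL; exact: cvg_frac_series_powR.
have := @cvg_mx_value (n - m).
by under eq_fun do rewrite /series/= big_mkord.
Qed.

(** The coefficients satisfy: the sum of the c_i L^i is 0^alpha = 0. Subtracting this writes the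
    diagonal element as the sum of c_i (w_i - L^i), w_i being the number of closed walks of length
    i. The term i = 0 vanishes, the others are nonnegative because c_i < 0 and w_i <= L^i, and i = 1
    is strictly positive because w_1 = d < 3d. *)
Lemma frac_laplacian_mx_diag_gt0 n : 0 < frac_laplacian_mx alpha n n.
Proof.
rewrite mx_valueE subrr ltcR.
pose c i := frac_coef alpha L i.
have c1 : series (fun i => c i * (L - 0) ^+ i) k @[k --> \oo] --> (0 : R) `^ alpha.
  by apply: cvg_frac_series_powR => //; rewrite subr0 ger0_norm// ltW.
rewrite powR0 ?lt0r_neq0// subr0 in c1.
have c2 : series (fun i => c i * walks 0 i) k - series (fun i => c i * L ^+ i) k
    @[k --> \oo] --> mx_value 0.
  by rewrite -[X in _ --> X]subr0; apply: cvgB => //; exact: cvg_mx_value.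
have w1 : walks 0 1%N < L.
  rewrite /walks /= (eq_bigr (fun=> 1%N)).
    rewrite sum1_card card_ord ltr_pMl ?ltr0n// ltr1n//.
  move=> i _; rewrite eqxx sub0r add0r oppr_eq0.
  have /negbTE -> // : unitv i != 0 :> 'Z^d.
  by apply/eqP => /rowP/(_ i); rewrite !mxE !eqxx.
have pos i : 0 <= c i.+1 * walks 0 i.+1 - c i.+1 * L ^+ i.+1.
  rewrite -mulrBr mulr_le0 ?(ltW (frac_coef_lt0 _ _ _ _))//.
  rewrite subr_le0; exact: le_trans (ler_norm _) (lattice_walks_bound 0 i.+1).
apply: (@lt_le_trans _ _ (c 1%N * walks 0 1%N - c 1%N * L)).
  by rewrite -mulrBr nmulr_rgt0 ?frac_coef_lt0// subr_lt0.
apply: (cvgr_to_ge c2); exists 2%N => // k /= k2.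
rewrite /series/= -[leRHS]sumrB -(subnKC k2) add2n !big_nat_recl//= expr0 expr1.
have -> : walks 0 0%N = 1 by rewrite /walks /= eqxx.
rewrite subrr add0r lerDl.
by apply: sumr_ge0 => i _; exact: pos.
Qed.

Definition levy_kernel v : R :=
  (\int[mu]_(t in Rpos) (heatd t v * t `^ (- alpha - 1))) / levy_const alpha.

Let integrand v : v <> 0 -> (fun t => levy_weight alpha L t * (egf (walks v) t - walks v 0%N)) =
  (fun t => heatd t v * t `^ (- alpha - 1)).
Proof.
move=> v0; apply/funext => t; rewrite {2}/walks /=.
by have /eqP/negbTE -> := v0; rewrite subr0 /levy_weight /heatd mulrAC.
Qed.

Lemma integrable_heatd_levy v : v <> 0 ->
  mu.-integrable Rpos (EFin \o (fun t => heatd t v * t `^ (- alpha - 1))).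
Proof.
move=> v0; have [h _] := cvg_levy_egf alpha0 alpha1 L0 (lattice_walks_bound v).
by rewrite -integrand.
Qed.

Lemma frac_laplacian_mx_kernel n m : n <> m ->
  frac_laplacian_mx alpha n m = (- levy_kernel (n - m))%:C.
Proof.
move=> nm; have v0 : n - m <> 0 by move=> /eqP; rewrite subr_eq0 => /eqP.
rewrite mx_valueE /mx_value integrand// {1}/walks /=.
by have /eqP/negbTE -> := v0; rewrite mulr0 add0r.
Qed.

Lemma levy_kernel_gt0 v : v <> 0 -> 0 < levy_kernel v.
Proof.
move=> v0; rewrite divr_gt0 ?levy_const_gt0//; apply: Rintegral_gt0.
  exact: integrable_heatd_levy.
by move=> t t0; rewrite mulr_gt0 ?powR_gt0 ?heatd_gt0.
Qed.

Definition scaled_kernel v u : R :=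
  euclid R v ^+ d * heatd (euclid R v ^+ 2 / 4 / u) v * u `^ (alpha - 1).

Let scale v u : R := euclid R v / (2 * Num.sqrt u).

Let scale_sqr v u : 0 < u -> scale v u ^+ 2 = euclid R v ^+ 2 / 4 / u.
Proof.
move=> u0; rewrite /scale expr_div_n exprMn (sqr_sqrtr (ltW u0)).
by field; rewrite lt0r_neq0.
Qed.

Let scale_gt0 v u : v <> 0 -> 0 < u -> 0 < scale v u.
Proof. by move=> v0 u0; rewrite divr_gt0 ?euclid_gt0// mulr_gt0// sqrtr_gt0. Qed.

Let euclid_scale v u : 0 < u -> euclid R v = 2 * Num.sqrt u * scale v u.
Proof. by move=> u0; rewrite /scale mulrC divfK// lt0r_neq0// mulr_gt0// sqrtr_gt0. Qed.

Let scaled_kernelE v u : 0 < u -> scaled_kernel v u =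
  (2 * Num.sqrt u) ^+ d * (scale v u ^+ d * heatd (scale v u ^+ 2) v) * u `^ (alpha - 1).
Proof.
by move=> u0; rewrite scale_sqr// mulrA -exprMn -euclid_scale.
Qed.

Lemma continuous_scaled_kernel v u : v <> 0 -> 0 < u -> {for u, continuous (scaled_kernel v)}.
Proof.
move=> v0 u0; apply: cvgM; last exact: continuous_powR_pos.
apply: cvgM; first exact: cvg_cst.
apply: (@continuous_comp _ _ _ (fun u => euclid R v ^+ 2 / 4 / u) (fun t => heatd t v)).
  apply: cvgM; first exact: cvg_cst.
  by apply: cvgV; [rewrite lt0r_neq0|exact: cvg_id].
apply: continuous_heatd => //.
by rewrite !divr_gt0// exprn_gt0// euclid_gt0.
Qed.

(** For u <= 1, that is large t, the bound t^(-d/2) leaves u^(d/2 + alpha - 1) <= u^(alpha - 1). For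
    u >= 1 the decay bound leaves u^(alpha - 2). Both are integrable at their ends because 0 < alpha
    < 1, and the constant is the same for all v. *)
Lemma scaled_kernel_bound : exists2 C : R, 0 < C & forall v, v <> 0 ->
  (forall u, 0 < u -> u <= 1 -> `|scaled_kernel v u| <= C * u `^ (levy_exp alpha - 1)) /\
  (forall u, 1 <= u -> `|scaled_kernel v u| <= C * u `^ (- levy_exp alpha - 1)).
Proof.
have [C1 C10 h1] := @scaled_heatd_le R d d0.
have [C2 C20 h2] := @heatd_decay R d d0.
have le1 : levy_exp alpha <= alpha by rewrite ge_min lexx orbT.
have le2 : levy_exp alpha <= 1 - alpha by rewrite ge_min lexx.
exists (2 ^+ d * C1 + C2) => [|v v0]; first by rewrite addr_gt0// mulr_gt0// exprn_gt0.
have r0 := euclid_gt0 (R := R) v0.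
have sk0 u : 0 < u -> 0 <= scaled_kernel v u.
  move=> u0; rewrite mulr_ge0 ?powR_ge0// mulr_ge0 ?exprn_ge0 ?(ltW r0)//.
  by rewrite ltW// heatd_gt0// !divr_gt0// exprn_gt0.
split=> [u u0 u1|u u1].
  have hk : 0 <= scale v u ^+ d * heatd (scale v u ^+ 2) v.
    have sc0 := scale_gt0 v0 u0.
    apply: mulr_ge0; first exact/exprn_ge0/ltW.
    by apply/ltW/heatd_gt0 => //; exact: exprn_gt0.
  rewrite ger0_norm ?sk0// scaled_kernelE//; apply: ler_pM; rewrite ?powR_ge0//.
  - by apply: mulr_ge0 => //; rewrite exprn_ge0// mulr_ge0// sqrtr_ge0.
  - apply: (@le_trans _ _ (2 ^+ d * C1)); last by rewrite lerDl ltW.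
    apply: ler_pM.
    + by rewrite exprn_ge0// mulr_ge0// sqrtr_ge0.
    + exact: hk.
    + rewrite lerXn2r ?nnegrE ?mulr_ge0 ?sqrtr_ge0// ler_piMr//.
      by rewrite -[leRHS]sqrtr1 ler_sqrt.
    + by apply: h1; exact: scale_gt0.
  - by apply: powR_le_small => //; rewrite lerD2r.
have u0 : 0 < u by exact: lt_le_trans u1.
rewrite ger0_norm ?sk0//.
have t0 : 0 < euclid R v ^+ 2 / 4 / u by rewrite !divr_gt0// exprn_gt0.
have h3 : euclid R v ^+ d * heatd (euclid R v ^+ 2 / 4 / u) v <= C2 / u.
  rewrite -(ler_pM2r (exprn_gt0 2 r0)) mulrAC -exprD addn2 [leLHS]mulrC.
  apply: le_trans (h2 _ _ t0 v0) _.
  have -> : C2 / u * euclid R v ^+ 2 = 4 * (C2 * (euclid R v ^+ 2 / 4 / u)).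
    by field; rewrite lt0r_neq0.
  by rewrite ler_peMl ?ler1n// mulr_ge0 ?(ltW C20) ?(ltW t0).
apply: le_trans (ler_wpM2r (powR_ge0 _ _) h3) _.
rewrite -mulrA; apply: ler_pM; first exact: ltW.
- by rewrite mulr_ge0 ?powR_ge0// invr_ge0 ltW.
- by rewrite lerDr mulr_ge0 ?(ltW C10)// exprn_ge0.
have -> : u^-1 * u `^ (alpha - 1) = u `^ (alpha - 2).
  rewrite -powR_inv1 ?(ltW u0)// -powRD ?(lt0r_neq0 u0) ?implybT//.
  by congr (_ `^ _); ring.
by apply: ler_powR => //; lra.
Qed.

Lemma integrable_scaled_kernel v : v <> 0 -> mu.-integrable Rpos (EFin \o scaled_kernel v).
Proof.
move=> v0; have [C _ /(_ v v0)[h1 h2]] := scaled_kernel_bound.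
have mS : measurable_fun Rpos (scaled_kernel v).
  by apply: measurable_Rpos_continuous => u u0; exact: continuous_scaled_kernel.
by have [] := integrable_Rpos_bound (levy_exp_gt0 alpha0 alpha1) mS h1 h2.
Qed.

Lemma levy_kernel_scaled v : v <> 0 ->
  euclid R v `^ (d%:R + 2 * alpha) * levy_kernel v =
  4 `^ alpha / levy_const alpha * \int[mu]_(u in Rpos) scaled_kernel v u.
Proof.
move=> v0; have r0 := euclid_gt0 (R := R) v0.
set r := euclid R v; pose c := r ^+ 2 / 4.
have c0 : 0 < c by rewrite divr_gt0// exprn_gt0.
pose G t := heatd t v * t `^ (- alpha - 1).
have cG t : 0 < t -> {for t, continuous G}.
  by move=> t0; apply: cvgM; [exact: continuous_heatd|exact: continuous_powR_pos].
have G0 t : 0 < t -> 0 <= G t.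
  by move=> t0; rewrite mulr_ge0 ?powR_ge0// ltW// heatd_gt0.
rewrite /levy_kernel -/G (Rintegral_Rpos_inv c0 cG G0).
have iG := integrable_Rpos_inv c0 cG G0 (integrable_heatd_levy v0).
rewrite mulrA [RHS]mulrAC; congr (_ / _).
rewrite -(@RintegralZl _ _ _ mu Rpos _ _ measurable_Rpos iG).
rewrite -(@RintegralZl _ _ _ mu Rpos _ _ measurable_Rpos (integrable_scaled_kernel v0)).
congr fine; apply: eq_integral => u; rewrite mem_Rpos => u0; congr EFin.
rewrite /G /scaled_kernel -/r -/c.
have e1 : (c / u) `^ (- alpha - 1) * (c / u ^+ 2) = c `^ (- alpha) * u `^ (alpha - 1).
  rewrite powRM ?invr_ge0 ?(ltW c0) ?(ltW u0)// powR_inv//.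
  have -> : c `^ (- alpha) = c * c `^ (- alpha - 1).
    by rewrite mulr_powR//; congr (_ `^ _); ring.
  have -> : u `^ (- (- alpha - 1)) = u * (u * u `^ (alpha - 1)).
    by rewrite !mulr_powR//; congr (_ `^ _); ring.
  by field; rewrite lt0r_neq0.
have e2 : r `^ (d%:R + 2 * alpha) * c `^ (- alpha) = 4 `^ alpha * r ^+ d.
  rewrite powRD ?(lt0r_neq0 r0) ?implybT// powR_mulrn ?(ltW r0)//.
  rewrite powRrM powR_mulrn ?(ltW r0)// -powR_inv// mulrC mulrA.
  rewrite -mulrA [_ * (r ^+ d * _)]mulrCA mulrC; congr (_ * _).
  rewrite -powRM ?invr_ge0 ?(ltW c0) ?exprn_ge0 ?(ltW r0)//.
  by congr (_ `^ _); rewrite /c; field; rewrite lt0r_neq0.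
transitivity (heatd (c / u) v * (r `^ (d%:R + 2 * alpha) * ((c / u) `^ (- alpha - 1) * (c / u ^+ 2)))).
  by ring.
by rewrite e1 [r `^ _ * _]mulrA e2; ring.
Qed.

Lemma levy_kernel_upper : exists2 C : R, 0 < C & forall v, v <> 0 ->
  euclid R v `^ (d%:R + 2 * alpha) * levy_kernel v <= C.
Proof.
have [C C0 h] := scaled_kernel_bound.
have a0 := levy_exp_gt0 alpha0 alpha1.
have I2 := integrable_RposZ (4 * C) (integrable_dom a0).
pose I := \int[mu]_(u in Rpos) (4 * C * dom (levy_exp alpha) u).
have I0 : 0 <= I.
  by apply: Rintegral_ge0 => u _; rewrite mulr_ge0 ?dom_ge0// mulr_ge0// ltW.
have q0 : 0 < 4 `^ alpha / levy_const alpha by rewrite divr_gt0 ?powR_gt0// levy_const_gt0.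
exists (4 `^ alpha / levy_const alpha * (I + 1)) => [|v v0].
  by rewrite mulr_gt0// ltr_pwDr.
rewrite levy_kernel_scaled// ler_pM2l//.
have [h1 h2] := h v v0.
have mS : measurable_fun Rpos (scaled_kernel v).
  by apply: measurable_Rpos_continuous => u u0; exact: continuous_scaled_kernel.
have [I1 b] := integrable_Rpos_bound a0 mS h1 h2.
apply: (@le_trans _ _ I); last by rewrite lerDl.
apply: (@le_Rintegral _ _ _ mu Rpos _ _ measurable_Rpos I1 I2) => u.
by rewrite RposP => u0; apply: le_trans (ler_norm _) (b u u0).
Qed.

Definition gamma_profile u : R :=
  pi `^ (- (d%:R / 2)) * (u `^ (d%:R / 2 + alpha - 1) * expR (- u)).

Lemma cvg_scaled_kernel (v : nat -> 'Z^d) u : (forall k, v k <> 0) ->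
  (euclid R (v k))^-1 @[k --> \oo] --> (0 : R) -> 0 < u ->
  scaled_kernel (v k) u @[k --> \oo] --> gamma_profile u.
Proof.
move=> v0 rcv u0.
pose s k := scale (v k) u.
have s0 k : 0 < s k by exact: scale_gt0.
have scv : (s k)^-1 @[k --> \oo] --> (0 : R).
  have -> : (fun k => (s k)^-1) = (fun k => 2 * Num.sqrt u * (euclid R (v k))^-1).
    by apply/funext => k; rewrite /s /scale invf_div.
  by rewrite -[X in _ --> X](mulr0 (2 * Num.sqrt u)); apply: cvgM => //; exact: cvg_cst.
have ecv := cvg_symbol_error s0 scv.
have sp : 0 < Num.sqrt (pi : R) by rewrite sqrtr_gt0 pi_gt0.
have [C C0 hC] := @heat1_le_invsqrt R.
pose b k i : R := expR (- (((v k 0 i)%:~R / s k) ^+ 2 / 4)) / (2 * Num.sqrt pi).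
pose a k i : R := s k * heat1 (s k ^+ 2) (v k 0 i).
pose M := Num.max 1 (C + 1 / (2 * Num.sqrt pi)).
have M1 : 1 <= M by rewrite le_max lexx.
have q0 : 0 <= 1 / (2 * Num.sqrt pi) :> R by rewrite divr_ge0// mulr_ge0// ltW.
have aM k i : `|a k i| <= M.
  have h0 : 0 <= a k i by apply: mulr_ge0; [exact: ltW|exact/heat1_ge0/sqr_ge0].
  rewrite ger0_norm// /M le_max; apply/orP; right.
  by apply: le_trans (hC _ _ (s0 k)) _; rewrite lerDl.
have bM k i : `|b k i| <= M.
  rewrite ger0_norm; last by rewrite divr_ge0 ?expR_ge0// mulr_ge0// ltW.
  rewrite /M le_max; apply/orP; right; apply: (@le_trans _ _ (1 / (2 * Num.sqrt pi))).
    rewrite ler_wpM2r ?invr_ge0 ?mulr_ge0 ?(ltW sp)// expR_le1 oppr_le0.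
    by rewrite divr_ge0// sqr_ge0.
  by rewrite lerDr ltW.
(* The squared coordinates add up to |v|^2 = 4 u s^2, so the product of the Gaussians equals its
   limit for every k. Only |v| enters, whence no restriction on the direction in which v k goes to
   infinity. *)
have bE k : \prod_(i < d) b k i = expR (- u) / (2 * Num.sqrt pi) ^+ d.
  rewrite /b big_split/= prodr_const card_ord exprVn; congr (_ / _).
  rewrite -expR_sum; congr expR; rewrite sumrN; congr (- _).
  rewrite -mulr_suml.
  under eq_bigr do rewrite expr_div_n.
  rewrite -mulr_suml -sqr_euclid /s scale_sqr//.
  have r0 : euclid R (v k) != 0 by rewrite lt0r_neq0// euclid_gt0.
  have r2 : euclid R (v k) ^+ 2 != 0 by rewrite expf_neq0.
  move: (euclid R (v k) ^+ 2) r2 => r r2.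
  by field; rewrite r2 lt0r_neq0.
have abcv : \prod_(i < d) a k i @[k --> \oo] --> expR (- u) / (2 * Num.sqrt pi) ^+ d.
  have h : \prod_(i < d) a k i - \prod_(i < d) b k i @[k --> \oo] --> (0 : R).
    apply/norm_cvg0P.
    have c0 : (fun=> 0) n @[n --> \oo] --> (0 : R) by exact: cvg_cst.
    have c1 : d%:R * M ^+ d * (symbol_error (s n) / pi) @[n --> \oo] --> (0 : R).
      rewrite -[X in _ --> X](mulr0 (d%:R * M ^+ d)); apply: cvgM; first exact: cvg_cst.
      by rewrite -[X in _ --> X](mul0r (pi^-1)); apply: cvgM => //; exact: cvg_cst.
    apply: (squeeze_cvgr _ c0 c1); apply: nearW => k; rewrite normr_ge0/=.
    apply: prod_dist_le => // [|i]; last exact: heat1_local_limit.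
    by rewrite divr_ge0 ?pi_ge0//; apply: Rintegral_ge0.
  have h2 : \prod_(i < d) a k i - \prod_(i < d) b k i + expR (- u) / (2 * Num.sqrt pi) ^+ d
      @[k --> \oo] --> 0 + expR (- u) / (2 * Num.sqrt pi) ^+ d.
    by apply: cvgD => //; exact: cvg_cst.
  rewrite add0r in h2; apply: cvg_trans h2; apply: near_eq_cvg; apply: nearW => k.
  by rewrite bE subrK.
have -> : gamma_profile u = (2 * Num.sqrt u) ^+ d * (expR (- u) / (2 * Num.sqrt pi) ^+ d) * u `^ (alpha - 1).
  have sq (x : R) : 0 < x -> Num.sqrt x ^+ d = x `^ (d%:R / 2).
    move=> x0; rewrite -powR12_sqrt ?(ltW x0)// -powR_mulrn ?powR_ge0// -powRrM.
    by congr (_ `^ _); rewrite mulrC.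
  rewrite /gamma_profile powRN -addrA [X in X * expR _]powRD ?(lt0r_neq0 u0) ?implybT//.
  rewrite !exprMn !sq ?pi_gt0//.
  have p0 : (pi : R) `^ (d%:R / 2) != 0 by rewrite lt0r_neq0// powR_gt0// pi_gt0.
  by field; rewrite p0 /= expf_neq0.
under eq_fun do rewrite scaled_kernelE//.
apply: cvgM; last exact: cvg_cst.
apply: cvgM; first exact: cvg_cst.
by under eq_fun do rewrite scaled_heatd//.
Qed.

Lemma continuous_gamma_profile u : 0 < u -> {for u, continuous gamma_profile}.
Proof.
move=> u0; apply: cvgM; first exact: cvg_cst.
apply: cvgM; first exact: continuous_powR_pos.
by apply: (@continuous_comp _ _ _ (fun u => - u) expR); [apply: cvgN; exact: cvg_id|exact: continuous_expR].
Qed.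

Lemma cvg_Rintegral_scaled_kernel (v : nat -> 'Z^d) : (forall k, v k <> 0) ->
  (euclid R (v k))^-1 @[k --> \oo] --> (0 : R) ->
  mu.-integrable Rpos (EFin \o gamma_profile) /\
  \int[mu]_(u in Rpos) scaled_kernel (v k) u @[k --> \oo] -->
    \int[mu]_(u in Rpos) gamma_profile u.
Proof.
move=> v0 rcv; have [C C0 h] := scaled_kernel_bound.
have a0 := levy_exp_gt0 alpha0 alpha1.
have mS k : measurable_fun Rpos (scaled_kernel (v k)).
  by apply: measurable_Rpos_continuous => u u0; exact: continuous_scaled_kernel.
apply: (@Rintegral_dominated_cvg R Rpos (fun k => scaled_kernel (v k)) gamma_profile
  (fun u => 4 * C * dom (levy_exp alpha) u)) => //.
- exact: measurable_Rpos.
- by apply: measurable_Rpos_continuous => u u0; exact: continuous_gamma_profile.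
- by move=> u; rewrite RposP => u0; exact: cvg_scaled_kernel.
- exact: integrable_RposZ (integrable_dom a0).
move=> k u; rewrite RposP; have [h1 h2] := h _ (v0 k).
by have [_] := integrable_Rpos_bound a0 (mS k) h1 h2; exact.
Qed.

Definition tail_const : R := 4 `^ alpha / levy_const alpha * \int[mu]_(u in Rpos) gamma_profile u.

(** Dominated convergence yields integrability of its limit as a by-product; one explicit sequence
    of lattice points going to infinity is enough. *)
Lemma integrable_gamma_profile : mu.-integrable Rpos (EFin \o gamma_profile).
Proof.
pose v k : 'Z^d := \row_i k.+1%:Z.
have vk k : k.+1%:R <= euclid R (v k).
  by have := @coord_le_euclid R d (v k) (Ordinal d0); rewrite mxE.
have [] // := @cvg_Rintegral_scaled_kernel v.
  by move=> k /rowP/(_ (Ordinal d0)); rewrite !mxE.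
have c0 : (fun=> 0) n @[n --> \oo] --> (0 : R) by exact: cvg_cst.
apply: (squeeze_cvgr _ c0 (@cvg_harmonic R)); apply: nearW => k.
by rewrite invr_ge0 euclid_ge0//= lef_pV2 ?posrE// (lt_le_trans _ (vk k)).
Qed.

Lemma tail_const_gt0 : 0 < tail_const.
Proof.
rewrite mulr_gt0 ?divr_gt0 ?powR_gt0 ?levy_const_gt0//.
apply: Rintegral_gt0; first exact: integrable_gamma_profile.
by move=> u u0; rewrite !mulr_gt0 ?powR_gt0 ?expR_gt0 ?pi_gt0.
Qed.

Lemma tail_constE : Kconst d alpha = tail_const.
Proof.
have i1 : mu.-integrable Rpos (EFin \o (fun u => u `^ (d%:R / 2 + alpha - 1) * expR (- u))).
  have p0 : (pi : R) `^ (- (d%:R / 2)) != 0 by rewrite lt0r_neq0// powR_gt0// pi_gt0.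
  have := integrable_RposZ (pi `^ (- (d%:R / 2)))^-1 integrable_gamma_profile.
  rewrite (_ : (fun x => _) = (fun u => u `^ (d%:R / 2 + alpha - 1) * expR (- u)))//.
  by apply/funext => u; rewrite /gamma_profile mulKf.
have e1 : Gamma (d%:R / 2 + alpha) = Gamma_integral (d%:R / 2 + alpha).
  rewrite /Gamma (_ : Num.truncn _ = 0%N) ?big_ord0 ?divr1 ?addr0//.
  by apply/truncn0Pn; rewrite -ltNge ltrBlDr ltrDl addr_gt0// divr_gt0// ltr0n.
(* As 1 + alpha lies in [1, 2), the definition of [Gamma] shifts exactly once: Gamma(-alpha) =
   Gamma(1 - alpha)/(-alpha), and [Gamma_integral_levy] cancels alpha. *)
have e2 : `|Gamma (- alpha)| = levy_const alpha.
  rewrite /Gamma (_ : Num.truncn _ = 1%N); last first.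
    apply: truncn_def; rewrite opprK lerDl (ltW alpha0)/= -natr1 addrC ltrD2r.
    exact: alpha1.
  rewrite big_ord_recl big_ord0 mulr1 addr0 addrC Gamma_integral_levy//.
  rewrite invrN mulrN normrN mulrAC mulfV ?lt0r_neq0// mul1r ger0_norm//.
  exact/ltW/levy_const_gt0.
rewrite /Kconst e1 e2 /tail_const /gamma_profile.
rewrite (@RintegralZl _ _ _ mu Rpos _ _ measurable_Rpos i1) /Gamma_integral powRN.
have p0 : (pi : R) `^ (d%:R / 2) != 0 by rewrite lt0r_neq0// powR_gt0// pi_gt0.
have c0 : levy_const alpha != 0 by rewrite lt0r_neq0// levy_const_gt0.
by field; rewrite p0 c0.
Qed.

(** Dominated convergence speaks of sequences only. If no radius worked, a choice of counterexamples
    v k with |v k| > k + 1 would contradict it; so the limit is uniform in the direction. *)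
Lemma cvg_levy_kernel (e : R) : 0 < e -> exists r0 : R, forall v, r0 < euclid R v ->
  `|tail_const - euclid R v `^ (d%:R + 2 * alpha) * levy_kernel v| <= e.
Proof.
move=> e0; apply: contrapT => /forallNP h.
have {}h (k : nat) : exists v : 'Z^d, k.+1%:R < euclid R v /\
    ~ `|tail_const - euclid R v `^ (d%:R + 2 * alpha) * levy_kernel v| <= e.
  have /existsNP[v /not_implyP hv] := h k.+1%:R.
  by exists v.
have [v hv] := choice h.
have vk k : k.+1%:R < euclid R (v k) by case: (hv k).
have v0 k : v k <> 0.
  move=> vk0; have := vk k; rewrite vk0 /euclid big1 ?sqrtr0 ?ltNge ?ler0n//.
  by move=> i _; rewrite mxE expr0n.
have rcv : (euclid R (v k))^-1 @[k --> \oo] --> (0 : R).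
  have c0 : (fun=> 0) n @[n --> \oo] --> (0 : R) by exact: cvg_cst.
  apply: (squeeze_cvgr _ c0 (@cvg_harmonic R)); apply: nearW => k.
  by rewrite invr_ge0 euclid_ge0//= lef_pV2 ?posrE ?(ltW (vk k))// (lt_trans _ (vk k)).
have [_ hc] := cvg_Rintegral_scaled_kernel v0 rcv.
have : euclid R (v k) `^ (d%:R + 2 * alpha) * levy_kernel (v k) @[k --> \oo] --> tail_const.
  under eq_fun do rewrite levy_kernel_scaled//.
  by apply: cvgM; [exact: cvg_cst|exact: hc].
move=> /cvgrPdist_le/(_ e e0)[N _ hN].
by case: (hv N) => _; apply; exact: (hN N (leqnn N)).
Qed.

End MatrixElement.

(** * Finite balls and bounds uniform over the lattice *)

Section Assembly.
Context {R : realType} {d : nat}.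
Implicit Types (v : 'Z^d) (e r : R).

Lemma finite_euclid_ball r : finite_set [set v : 'Z^d | euclid R v <= r].
Proof.
pose N := (Num.truncn r).+1.
pose g (f : {ffun 'I_d -> 'I_(N + N).+1}) : 'Z^d := \row_i ((f i : nat)%:Z - N%:Z).
apply: (@sub_finite_set _ _ (g @` setT)); last first.
  by apply: finite_image; exact: finite_finset.
move=> v /= vr.
have vN i : (absz (v 0%R i) < N)%N.
  have r0 : 0 <= r by exact: le_trans (euclid_ge0 v) vr.
  rewrite -(ltr_nat R); apply: le_lt_trans (coord_le_euclid v i) _.
  by apply: le_lt_trans vr _; exact: truncnS_gt.
exists [ffun i => inord (absz (v 0%R i + N%:Z))] => //.
apply/rowP => i; rewrite mxE ffunE inordK; have := vN i; lia.
Qed.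

Lemma finite_pos_lower_bound (T : choiceType) (A : set T) (f : T -> R) : finite_set A ->
  (forall a, A a -> 0 < f a) -> exists2 c : R, 0 < c & forall a, A a -> c <= f a.
Proof.
move=> /finite_seqP[s ->] /=; elim: s => [|x s IH] f0; first by exists 1.
have [|c c0 hc] := IH; first by move=> a ins; apply: f0; rewrite /= inE ins orbT.
have fx : 0 < f x by apply: f0; rewrite /= inE eqxx.
exists (Num.min c (f x)) => [|a]; first by rewrite lt_min c0.
rewrite /= inE ge_min => /predU1P[->|/hc ->]; by rewrite ?lexx ?orbT.
Qed.

Lemma dist_infty_filter : Filter (dist_infty R d).
Proof.
apply: filter_from_filter; first by exists 0.
move=> r s _ _; exists (Num.max r s) => // nm /=.
by rewrite gt_max => /andP[].
Qed.

End Assembly.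

(** Outside a ball the rescaled kernel is at least half of its limit; inside there are finitely many
    lattice points, each with a positive value. *)
Lemma levy_kernel_lower (R : realType) (d : nat) (alpha : R) : (0 < d)%N -> 0 < alpha -> alpha < 1 ->
  exists2 c : R, 0 < c & forall v : 'Z^d, v <> 0 ->
    c <= euclid R v `^ (d%:R + 2 * alpha) * levy_kernel alpha v.
Proof.
move=> d0 a0 a1; have K0 := tail_const_gt0 d0 a0 a1.
set K := tail_const _ in K0.
have [r0 hr] := cvg_levy_kernel d0 a0 a1 (divr_gt0 K0 (ltr0n R 2) : 0 < K / 2).
pose A := [set v : 'Z^d | euclid R v <= r0] `&` [set v | v <> 0].
have fA : finite_set A by apply: (sub_finite_set (@subIsetl _ _ _)); exact: finite_euclid_ball.
have [|c c0 hc] := @finite_pos_lower_bound R _ A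
    (fun v => euclid R v `^ (d%:R + 2 * alpha) * levy_kernel alpha v) fA.
  by move=> v [_ v0]; rewrite mulr_gt0 ?levy_kernel_gt0// powR_gt0// euclid_gt0.
exists (Num.min c (K / 2)) => [|v v0]; first by rewrite lt_min c0 divr_gt0.
rewrite ge_min; have [vr|vr] := leP (euclid R v) r0; first by rewrite hc.
by have := hr v vr; rewrite ler_norml -/K => /andP[_ h]; apply/orP; right; lra.
Qed.

Theorem theorem2p2 (R : realType) (d : nat) (alpha : R)
    (hd : (1 <= d)%N) (halpha0 : 0 < alpha) (halpha1 : alpha < 1) :
  [/\ (forall n m : 'Z^d, n <> m -> frac_laplacian_mx alpha n m < 0) /\
      (forall n : 'Z^d, 0 < frac_laplacian_mx alpha n n),
      ((fun nm : 'Z^d * 'Z^d =>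
          (euclid R (nm.1 - nm.2) `^ (d%:R + 2 * alpha))%:C *
          - frac_laplacian_mx alpha nm.1 nm.2 : R[i]^o)
         @ dist_infty R d --> ((Kconst d alpha)%:C : R[i]^o)) /\
      0 < Kconst d alpha
    & exists c C : R, 0 < c /\ 0 < C /\
        forall n m : 'Z^d, n <> m ->
          (c / euclid R (n - m) `^ (d%:R + 2 * alpha))%:C
            <= - frac_laplacian_mx alpha n m /\
          - frac_laplacian_mx alpha n m
            <= (C / euclid R (n - m) `^ (d%:R + 2 * alpha))%:C].
Proof.
have kE (n m : 'Z^d) : n <> m ->
    frac_laplacian_mx alpha n m = (- levy_kernel alpha (n - m))%:C.
  exact: frac_laplacian_mx_kernel.
have nm0 (n m : 'Z^d) : n <> m -> n - m <> 0.
  by move=> nm /eqP; rewrite subr_eq0 => /eqP.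
rewrite tail_constE//; split.
- split; last exact: frac_laplacian_mx_diag_gt0.
  by move=> n m nm; rewrite kE// ltcR oppr_lt0 levy_kernel_gt0//; exact: nm0.
- split; last exact: tail_const_gt0.
  have FF := @dist_infty_filter R d; apply/cvgrPdist_le => e e0.
  (* In the order of [R[i]], 0 < e forces e to be real. *)
  have [Re0 eE] : 0 < complex.Re e /\ e = (complex.Re e)%:C.
    by move: e0; case: e => a b; rewrite ltcE/= => /andP[/eqP -> ->].
  have [r0 hr] := cvg_levy_kernel hd halpha0 halpha1 Re0.
  (* The maximum with 0 keeps n <> m even if r0 is negative; the kernel formula holds off the
     diagonal. *)
  exists (Num.max r0 0) => // -[n m] /=; rewrite gt_max => /andP[rr r1].
  have nm : n <> m.
    move=> e1; move: r1; rewrite e1 subrr /euclid big1 ?sqrtr0 ?ltxx//.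
    by move=> i _; rewrite mxE expr0n.
  rewrite kE// rmorphN opprK -rmorphM -rmorphB normc_def/= expr0n addr0 sqrtr_sqr.
  by rewrite eE lecR; exact: hr.
have [c c0 hc] := levy_kernel_lower hd halpha0 halpha1.
have [C C0 hC] := levy_kernel_upper hd halpha0 halpha1.
exists c, C; split => //; split => // n m nm.
have v0 := nm0 n m nm.
have r0 : 0 < euclid R (n - m) `^ (d%:R + 2 * alpha) by rewrite powR_gt0// euclid_gt0.
rewrite kE// rmorphN opprK !lecR ler_pdivrMr// ler_pdivlMr// mulrC.
by split; [exact: hc|exact: hC].
Qed.
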